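(* Let $F$ be a non-Archimedean local field and $E=F\times E'$ with $E'/F$ a ramified quadratic field extension with uniformizer $x$. Let $R$ be an order of $E$ with conductor $(\pi^{f_1})\times(x^{f_2})\subset\mathfrak o\times\mathcal O_{E'}=\mathcal O_E$. Put $b=S(R)-f_1$ and $C=\left\lceil\frac{2S(R)-f_2}{2}\right\rceil$. Then, with all summation indices $a',b'$ ranging over integers, $$\begin{aligned} \#\overline{\mathrm{Cl}}(R)={}&2\sum_{0\le b'\le b}\Biggl(\ \sum_{\substack{0\le a'\le f_1\\ a'\le 2b'+1\\ a'\le C}}q^{\min(\lfloor a'/2\rfloor,\,b-b')}+\sum_{\substack{C<a'\le f_1\\ a'\le 2b'+1\\ \lceil a'/2\rceil-b'\le C-b}}q^{b-b'}\Biggr)-(b+1)\\ &-\sum_{\substack{0<a'\le f_1\\ a'\le C\\ 2\mid(a'-1)}}q^{\min\left(\frac{a'-1}2,\,b-\frac{a'-1}2\right)}-\sum_{\substack{C<a'\le f_1\\ 2\mid(a'-1)\\ b+1\le C}}q^{b-\frac{a'-1}2}\\ &-\sum_{0<b'\le b}\ \sum_{\substack{0<a'\le f_1\\ a'<2b'+1,\ 2\mid a'\\ a'\le C\\ \frac{a'}2\le b-b'}}\left(q^{\frac{a'}2}-q^{\frac{a'}2-1}\right)-\sum_{\substack{C<a'\le f_1\\ 2\mid a'\\ C\le b}}q^{C-\frac{a'}2}. \end{aligned}$$ (A condition not involving the summation index means that the sum is empty unless the condition holds.)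
   Context: $F$ has any characteristic, ring of integers $\mathfrak o$, uniformizer $\pi$, residue field of cardinality $q$; $\mathcal O_{E'}$ is the ring of integers of $E'$, so $\mathcal O_{E'}=\mathfrak o[x]$. The maximal order of $E$ is $\mathcal O_E=\mathfrak o\times\mathcal O_{E'}$. An order of $E$ is a subring $\mathcal O\subset E$ containing $\mathfrak o$ (embedded diagonally), finitely generated as an $\mathfrak o$-module, with $F\mathcal O=E$. The conductor of $R$ is $\{a\in\mathcal O_E: a\mathcal O_E\subset R\}$, and $S(R)$ is the length of $\mathcal O_E/R$ as an $\mathfrak o$-module. A fractional $R$-ideal is a finitely generated $R$-submodule $I\subset E$ with $FI=E$; $\overline{\mathrm{Cl}}(R)$ is the set (monoid) of fractional $R$-ideals modulo multiplication by $E^\times$. *)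

(* Defs.v *)
From HB Require Import structures.
From mathcomp Require Import all_boot all_order all_algebra all_field.
From mathcomp Require Import classical_sets functions cardinality.

Set Implicit Arguments.
Unset Strict Implicit.
Unset Printing Implicit Defensive.

Import Order.TTheory GRing.Theory Num.Theory.
Local Open Scope classical_set_scope.
Local Open Scope ring_scope.

(* Subrings, ideals and modules are represented by their underlying sets
   inside an ambient field, or inside the ambient ring E = F * L. *)

Definition scale_set (E : nzRingType) (u : E) (A : set E) : set E :=
  [set u * a | a in A].

Definition nonunits (K : fieldType) (A : set K) : set K :=
  [set a | A a /\ (a = 0 \/ ~ A a^-1)].

(* x generates the maximal ideal of the discrete valuation ring A *)
Definition uniformizer (K : fieldType) (A : set K) (x : K) : Prop :=
  nonunits A = scale_set x A.

(* the set of cosets of the maximal ideal of the local ring A *)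
Definition residue_field (K : fieldType) (A : set K) : set (set K) :=
  [set [set a + m | m in nonunits A] | a in A].

Section LocalField.
Context {F : fieldType}.
Implicit Type v : F -> int.

(* The value of v at 0 is irrelevant: v 0 stands for infinity. *)
Definition normalized_discrete_valuation v : Prop :=
  [/\ forall x y, x != 0 -> y != 0 -> v (x * y) = v x + v y,
      forall x y, x != 0 -> y != 0 -> x + y != 0 ->
        Num.min (v x) (v y) <= v (x + y)
    & exists2 x, x != 0 & v x = 1].

Definition val_geq v (n : int) : set F := [set x | x = 0 \/ n <= v x].

Definition valuation_ring v : set F := val_geq v 0.

Definition complete_valuation v : Prop :=
  forall u : nat -> F,
    (forall n : int, exists N : nat, forall i j : nat,
       (N <= i)%N -> (N <= j)%N -> val_geq v n (u i - u j)) ->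
    exists l : F, forall n : int, exists N : nat, forall i : nat,
      (N <= i)%N -> val_geq v n (u i - l).

Definition nonarchimedean_local_field v : Prop :=
  [/\ normalized_discrete_valuation v, complete_valuation v
    & finite_set (residue_field (valuation_ring v))].

Definition integral_closure (o : set F) (L : fieldExtType F) : set L :=
  [set z | exists p : {poly F},
     [/\ p \is monic, forall i, o p`_i & root (map_poly (in_alg L) p) z]].
Arguments integral_closure o L : clear implicits.

(* For uniformizers p of o and x of its integral closure in L, the exponent e
   is the ramification index of L / F. *)
Definition ramified (o : set F) (L : fieldExtType F) (p : F) (x : L) : Prop :=
  exists2 e : nat, (1 < e)%N &
    scale_set p%:A (integral_closure o L)
    = scale_set (x ^+ e) (integral_closure o L).

End LocalField.
Arguments integral_closure {F} o L.
Arguments ramified {F} o {L} p x.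

Section Modules.
Context {E : comNzRingType}.
Implicit Types A M N : set E.

Definition submodule A M : Prop :=
  GRing.zmod_closed (mem M) /\ (forall a m, A a -> M m -> M (a * m)).

(* finite A-linear combinations of elements of M *)
Definition span_set A M : set E :=
  [set y | exists n (a m : 'I_n -> E),
     [/\ forall i, A (a i), forall i, M (m i) & y = \sum_(i < n) a i * m i]].

Definition finitely_generated A M : Prop :=
  exists s : seq E, M = span_set A [set` s].

(* A-submodules of the quotient M / N are represented by the A-submodules
   lying between N and M. *)
Definition has_strict_chain A N M (n : nat) : Prop :=
  exists c : nat -> set E,
    (forall i, (i <= n)%N ->
       [/\ submodule A (c i), N `<=` c i & c i `<=` M]) /\
    (forall i, (i < n)%N -> c i `<` c i.+1).

Definition quotient_length A N M (n : nat) : Prop :=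
  has_strict_chain A N M n /\
  (forall m, has_strict_chain A N M m -> (m <= n)%N).

End Modules.

Section Orders.
Context {F : fieldType} {L : fieldExtType F}.
Local Notation E := (F * L)%type.
Implicit Types (o : set F) (R I : set E).

Definition diag (a : F) : E := (a, a%:A).

Definition maximal_order o : set E := o `*` integral_closure o L.

Definition is_order o R : Prop :=
  [/\ GRing.subring_closed (mem R), diag @` o `<=` R,
      finitely_generated (diag @` o) R & span_set (range diag) R = setT].

Definition conductor o R : set E :=
  [set a | maximal_order o a /\
           scale_set a (maximal_order o) `<=` R].

Definition fractional_ideal R I : Prop :=
  [/\ submodule R I, finitely_generated R I & span_set (range diag) I = setT].

Definition ideal_class R I : set (set E) :=
  [set J | fractional_ideal R J /\
           exists2 u : E, u \is a GRing.unit & J = scale_set u I].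

Definition Cl_bar R : set (set (set E)) :=
  [set ideal_class R I | I in fractional_ideal R].

End Orders.

Definition int_range (m n : int) : seq int :=
  if m <= n then [seq m + k%:Z | k <- iota 0 `|n - m|.+1] else [::].

Lemma mem_int_range m n k : (k \in int_range m n) = (m <= k <= n).
Proof.
rewrite /int_range; case: ifPn => [le_mn|nle_mn]; last first.
  apply/esym/negbTE; apply: contraNN nle_mn => /andP[]; exact: le_trans.
apply/mapP/andP => [[i]|[le_mk le_kn]].
  rewrite mem_iota add0n ltnS => /= lei ->.
  by rewrite lerDl lez_nat leq0n -lerBrDl -[n - m]gez0_abs ?subr_ge0 // lez_nat.
exists `|k - m|%N; last by rewrite gez0_abs ?subr_ge0 // subrKC.
rewrite mem_iota add0n ltnS leq0n /= -lez_nat !gez0_abs ?subr_ge0 //.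
by rewrite lerD2r.
Qed.

Lemma int_range_uniq m n : uniq (int_range m n).
Proof.
rewrite /int_range; case: ifP => // _.
by rewrite map_inj_uniq ?iota_uniq // => i j /addrI [].
Qed.

Definition floor_half (a : int) : int := Num.floor (a%:Q / 2).
Definition ceil_half (a : int) : int := Num.ceil (a%:Q / 2).

(* Main.v *)
Require Import Defs.
From HB Require Import structures.
From mathcomp Require Import all_boot all_order all_algebra all_field.
From mathcomp Require Import boolp classical_sets functions cardinality.
From mathcomp Require Import zify ring.
Set Implicit Arguments.
Unset Strict Implicit.
Unset Printing Implicit Defensive.
Import Order.TTheory GRing.Theory Num.Theory.
Local Open Scope classical_set_scope.
Local Open Scope card_scope.
Local Open Scope ring_scope.

(* Write L = F + F x with x^2 = t x + n, where v(n) = 1 and v(t) >= 1.  An order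
   of conductor (p^f1) x (x^f2) is the set of all (a, s + u x) with s in o, u in
   p^b o and a = s + u kap mod p^f1, for some kap in p^(-b) o; its colength is
   f1 + b, and the conductor gives C = min(f1, b + 1, b + v(kap)).  Up to E^*,
   a fractional ideal projects onto o + p^k x o in L and meets F x 0 in o, so it
   is generated over o by (1, 0), (al, 1) and p^k (be, x).  The units of
   o + p^k x o reduce (al, be) to (0, p^(-j-k)), with 0 <= j <= min(b - k, C), or
   to p^(-a) (1, g), with 1 <= a <= f1; two slopes g, g' with the same k and a
   give equivalent ideals iff g - g' lies in p^k (g'^2 - t g' - n) o + p^(a-k) o.
   Counting these cosets and summing over k for fixed a gives the formula. *)

(** * Discrete valuations: balls and spheres *)

Section Valuation.
Variables (F : fieldType) (v : F -> int).
Hypothesis hv : normalized_discrete_valuation v.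
Local Notation V := (val_geq v).

(** As the residue characteristic may be 2, the trace t of x cannot be normalized away. What
    replaces it is a parity argument: s^2 and n u^2 have valuations of different parity, so
    integrality in L is read off the norm. A unit s + w x acts on a slope g = be / al by a
    fractional linear map that moves g by w times P(g) = g^2 - t g - n, up to a unit; the bound g in
    p^(1-k) o keeps the denominator a unit. Hence the class of a slope is a ball whose radius
    depends on v(P(g)), which is 2 v(g) for v(g) <= 0 and 1 otherwise. For a <= C the admissible
    slopes form a ball around 0, to be cut into spheres and an inner ball; for a > C they lie in a
    ball around kap on which v(P) is constant, so that all classes have the same size. The counts
    for a single k do not agree with the summands of the formula: the comparison is possible only
    for fixed a after summation over k, and for a <= C only after b + 1 - a of the classes (0,
    p^(-j-k)) have been assigned to a. *)

Lemma int_min (P : int -> Prop) K :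
  (exists n, P n) -> (forall n, P n -> K <= n) ->
  exists2 m, P m & forall n, P n -> m <= n.
Proof.
move=> [n0 Pn0] PK.
have ex : exists i : nat, `[< P (K + i%:Z) >].
  exists `|n0 - K|%N; apply/asboolP.
  by rewrite gez0_abs ?subrKC // subr_ge0 PK.
exists (K + (ex_minn ex)%:Z); first by case: ex_minnP => i /asboolP.
move=> n Pn; case: ex_minnP => i _ /(_ `|n - K|%N).
rewrite gez0_abs ?subr_ge0 ?PK// subrKC.
have := PK _ Pn; move=> h1 h2.
have : (i <= `|n - K|)%N by apply: h2; apply/asboolP.
lia.
Qed.

Lemma vM x y : x != 0 -> y != 0 -> v (x * y) = v x + v y.
Proof. by case: hv => h _ _; exact: h. Qed.

Lemma v1 : v 1 = 0.
Proof.
have := vM (oner_neq0 F) (oner_neq0 F).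
by rewrite mulr1 -[X in X = _]addr0 => /addrI.
Qed.

Lemma vN1 : v (-1) = 0.
Proof.
have n1 : -1 != 0 :> F by rewrite oppr_eq0 oner_neq0.
have := vM n1 n1; rewrite mulrNN mulr1 v1; lia.
Qed.

Lemma vV x : x != 0 -> v x^-1 = - v x.
Proof.
move=> x0; have := vM x0 (invr_neq0 x0); rewrite mulfV // v1; lia.
Qed.

Lemma vX x i : x != 0 -> v (x ^+ i) = v x * i%:Z.
Proof.
move=> x0; elim: i => [|i IH]; first by rewrite expr0 v1 mulr0.
rewrite exprS vM ?expf_neq0 // IH; lia.
Qed.

Lemma vZ x (i : int) : x != 0 -> v (x ^ i) = v x * i.
Proof.
move=> x0; case: i => i; first by rewrite -exprnP vX.
by rewrite NegzE -exprnN vV ?expf_neq0 // vX //; lia.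
Qed.

Lemma V0 m : V m 0. Proof. by left. Qed.

Lemma V_le m m' x : m' <= m -> V m x -> V m' x.
Proof. by move=> le_m [->|h]; [left|right; lia]. Qed.

Lemma VN m x : V m x -> V m (- x).
Proof.
have [->|x0] := eqVneq x 0; first by rewrite oppr0.
case=> [->|h]; first by rewrite oppr0; left.
have n1 : -1 != 0 :> F by rewrite oppr_eq0 oner_neq0.
by right; rewrite -mulN1r vM // vN1 add0r.
Qed.

Lemma VD m x y : V m x -> V m y -> V m (x + y).
Proof.
move=> hx hy.
have [xy0|xy0] := eqVneq (x + y) 0; first by left.
have [x0|x0] := eqVneq x 0; first by rewrite x0 add0r.
have [y0|y0] := eqVneq y 0; first by rewrite y0 addr0.
case: hx => [/eqP|hx]; first by rewrite (negPf x0).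
case: hy => [/eqP|hy]; first by rewrite (negPf y0).
case: hv => _ /(_ x y x0 y0 xy0) h _; right.
by apply: le_trans h; rewrite le_min hx.
Qed.

Lemma VB m x y : V m x -> V m y -> V m (x - y).
Proof. by move=> hx hy; apply: VD => //; exact: VN. Qed.

Lemma VM m m' x y : V m x -> V m' y -> V (m + m') (x * y).
Proof.
have [->|x0] := eqVneq x 0; first by rewrite mul0r; left.
have [->|y0] := eqVneq y 0; first by rewrite mulr0; left.
case=> [/eqP|hx]; first by rewrite (negPf x0).
case=> [/eqP|hy]; first by rewrite (negPf y0).
by right; rewrite vM //; lia.
Qed.

Lemma VMl m x y : V 0 x -> V m y -> V m (x * y).
Proof. by move=> hx hy; have := VM hx hy; rewrite add0r. Qed.

Lemma VMr m x y : V m x -> V 0 y -> V m (x * y).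
Proof. by move=> hx hy; have := VM hx hy; rewrite addr0. Qed.

Lemma V1 : V 0 1. Proof. by right; rewrite v1. Qed.

Lemma Vsum m (I : Type) (r : seq I) (P : pred I) (f : I -> F) :
  (forall i, P i -> V m (f i)) -> V m (\sum_(i <- r | P i) f i).
Proof. by move=> h; elim/big_rec: _ => [|i x Pi hx]; [exact: V0|exact: VD (h i Pi) hx]. Qed.

Lemma V_nat i : V 0 i%:R.
Proof. by elim: i => [|i IH]; [left|rewrite -natr1; apply: VD => //; exact: V1]. Qed.

(** The value of [v] at 0 is arbitrary, so the sphere is written as a difference of two balls; this
    excludes 0. *)
Definition exact_val (n : int) x := V n x /\ ~ V (n + 1) x.
Local Notation X := exact_val.

Lemma exactP n x : X n x <-> x != 0 /\ v x = n.
Proof.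
split=> [[[->|hx] nh]|[x0 vx]]; first by case: nh; left.
  have x0 : x != 0 by apply/eqP => x0; apply: nh; left.
  split=> //; have : ~ (n + 1 <= v x) by move=> ?; apply: nh; right.
  by lia.
split; first by right; rewrite vx.
by case=> [/eqP|]; [rewrite (negPf x0)|rewrite vx; lia].
Qed.

Lemma exact_neq0 n x : X n x -> x != 0. Proof. by case/exactP. Qed.

Lemma exact_V n m x : X n x -> V m x <-> m <= n.
Proof.
case/exactP=> x0 <-; split=> [[/eqP|//]|]; last by right.
by rewrite (negPf x0).
Qed.

Lemma exact_ex x : x != 0 -> X (v x) x. Proof. by move=> x0; apply/exactP. Qed.

Lemma exact_uniq n m x : X n x -> X m x -> n = m.
Proof. by case/exactP=> _ <- /exactP[_ <-]. Qed.

Lemma exactM n m x y : X n x -> X m y -> X (n + m) (x * y).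
Proof.
case/exactP=> x0 <- /exactP[y0 <-]; apply/exactP.
by rewrite mulf_neq0 // vM.
Qed.

Lemma exactV n x : X n x -> X (- n) x^-1.
Proof. by case/exactP=> x0 <-; apply/exactP; rewrite invr_neq0 // vV. Qed.

Lemma exactD n x y : X n x -> V (n + 1) y -> X n (x + y).
Proof.
move=> [h1 h2] h3; split; first by apply: VD => //; apply: V_le h3; lia.
by move=> h4; apply: h2; have := VB h4 h3; rewrite addrK.
Qed.

Lemma exact_eq l m m' y z : X m y -> X m' z -> V l (y - z) -> m < l -> m = m'.
Proof.
move=> Xy Xz Vyz ml; apply: (exact_uniq _ Xz).
have -> : z = y + (- (y - z)) by ring.
by apply: (exactD) => //; apply: V_le (VN Vyz); lia.
Qed.

Lemma exactN n x : X n x -> X n (- x).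
Proof. by move=> [h1 h2]; split; [exact: VN|move/VN; rewrite opprK]. Qed.

Lemma exact1 : X 0 1.
Proof. by apply/exactP; rewrite oner_neq0 v1. Qed.

(** A nonzero element of least valuation generates; the lower bound [K] makes the least valuation
    exist. *)
Lemma submodule_principal (S : set F) K y0 :
  (forall y z, S y -> S z -> S (y + z)) ->
  (forall a y, V 0 a -> S y -> S (a * y)) ->
  y0 != 0 -> S y0 -> (forall y, S y -> V K y) ->
  exists m, forall y, S y <-> V m y.
Proof.
move=> SD SM y00 Sy0 SK.
have [||m [y [Sy yy0 ym]] mmin] :=
    @int_min (fun n => exists y, [/\ S y, y != 0 & v y = n]) K.
- by exists (v y0), y0.
- by move=> n [y [/SK[-> /eqP//|? _ <-//]]].
exists m => z; split=> [Sz|Vz].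
  have [->|z0] := eqVneq z 0; first exact: V0.
  by right; apply: mmin; exists z.
have -> : z = z / y * y by rewrite divfK.
apply: SM => //; have /exactP/exactV Xy : y != 0 /\ v y = m by [].
by have := VM Vz Xy.1; rewrite subrr.
Qed.

Lemma V_bound (s : seq F) : exists K, forall y, y \in s -> V K y.
Proof.
elim: s => [|y s [K hK]]; first by exists 0.
exists (Num.min K (v y)) => z; rewrite inE => /orP[/eqP->|/hK].
  by right; rewrite ge_min lexx orbT.
by apply: V_le; rewrite ge_min lexx.
Qed.

Variable p : F.
Hypothesis hp : uniformizer (valuation_ring v) p.

(** An element [y] of valuation 1 is a nonunit, so y = p a with a integral and v(p) <= 1; as [p] is
    itself a nonunit, v(p) > 0. *)
Lemma uniformizer_val : p != 0 /\ v p = 1.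
Proof.
case: hv => _ _ [y y0 vy].
have : nonunits (valuation_ring v) y.
  split; first by right; rewrite vy.
  right; case=> [/eqP|]; first by rewrite invr_eq0 (negPf y0).
  by rewrite vV // vy.
rewrite hp => -[a ha ya].
have [p0 a0] : p != 0 /\ a != 0 by apply/andP; rewrite -negb_or -mulf_eq0 ya.
split=> //.
have : scale_set p (valuation_ring v) p by exists 1; [exact: V1|rewrite mulr1].
rewrite -hp => -[[/eqP|vp]]; first by rewrite (negPf p0).
case=> [/eqP|npV]; first by rewrite (negPf p0).
have vp0 : v p != 0.
  by apply: contra_not_neq npV => vp0; right; rewrite vV // vp0.
case: ha => [/eqP|va]; first by rewrite (negPf a0).
by have := vM p0 a0; rewrite ya vy; lia.
Qed.

Let p0 : p != 0. Proof. by case: uniformizer_val. Qed.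
Let vp : v p = 1. Proof. by case: uniformizer_val. Qed.

Lemma vpZ (i : int) : v (p ^ i) = i.
Proof. by rewrite vZ // vp mul1r. Qed.

Lemma V_pZ m (i : int) : V m (p ^ i) <-> m <= i.
Proof.
split=> [[/eqP|]|h]; first by rewrite (negPf (expfz_neq0 i p0)).
  by rewrite vpZ.
by right; rewrite vpZ.
Qed.

Lemma V_pZM m (i : int) x : V m (p ^ i * x) <-> V (m - i) x.
Proof.
have pZ : p ^ i != 0 by rewrite expfz_neq0.
split=> h.
  have h2 : V (- i) (p ^ (- i)) by apply/V_pZ.
  have := VM h2 h; rewrite mulrA -expfzDr // addNr expr0z mul1r addrC //.
have h2 : V i (p ^ i) by apply/V_pZ.
by have := VM h2 h; rewrite subrKC.
Qed.

Lemma V_Mp m x : V m (p * x) <-> V (m - 1) x.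
Proof. exact: (V_pZM m 1). Qed.

Lemma exact_pZ i : X i (p ^ i).
Proof. by apply/exactP; rewrite expfz_neq0 // vpZ. Qed.

Lemma V_clear y : exists D : nat, forall m : nat, (D <= m)%N -> V 0 (p ^ m%:Z * y).
Proof.
have [->|y0] := eqVneq y 0; first by exists 0%N => m _; rewrite mulr0; exact: V0.
exists `|v y|%N => m hm; apply/V_pZM; right; lia.
Qed.

End Valuation.

(** * Integrality through bounded powers *)

Section IntegralElements.
Variables (F : fieldType) (v : F -> int).
Hypothesis hv : normalized_discrete_valuation v.
Local Notation V := (val_geq v).

(** A negative valuation is multiplied by the exponent. Integrality is used through this criterion,
    because the powers of an integral element have bounded denominators. *)
Lemma pow_bounded K y : (forall k, V K (y ^+ k)) -> V 0 y.
Proof.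
move=> h; have [->|y0] := eqVneq y 0; first by left.
right; rewrite leNgt; apply/negP => vy.
case: (h (`|K|.+1)) => [/eqP|]; first by rewrite (negPf (expf_neq0 _ y0)).
by rewrite vX //; nia.
Qed.

(** The monic equation reduces every power of [z] to powers below the degree, with coefficients in
    the valuation ring. [phi] is kept general to serve for the identity of F and for both
    coordinates on L. *)
Lemma integral_pow_bounded (A : comNzRingType) (i : {rmorphism F -> A})
    (phi : {additive A -> F}) (z : A) (f : {poly F}) :
  (forall a w, phi (i a * w) = a * phi w) ->
  f \is monic -> (forall j, V 0 f`_j) -> root (map_poly i f) z ->
  exists K, forall k, V K (phi (z ^+ k)).
Proof.
move=> phiZ fm f0 rz.
have szf : size f = (size f).-1.+1 by rewrite prednK // size_poly_gt0 monic_neq0.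
set m := (size f).-1 in szf.
have zm : z ^+ m = - \sum_(j < m) i f`_j * z ^+ j.
  move/eqP: rz; rewrite horner_coef size_map_poly_id0 ?rmorph_eq0; last first.
    by rewrite (monicP fm) rmorph1 oner_neq0.
  rewrite szf big_ord_recr /= coef_map /=.
  have -> : f`_m = 1 by exact: (monicP fm).
  rewrite rmorph1 mul1r => /eqP; rewrite addrC addr_eq0 => /eqP ->.
  by congr (- _); apply: eq_bigr => j _; rewrite coef_map.
have [K hK] := V_bound v [seq phi (z ^+ j) | j <- iota 0 m].
exists K; elim/ltn_ind => k IH.
have [km|mk] := ltnP k m; first by apply/hK/map_f; rewrite mem_iota.
have -> : z ^+ k = z ^+ m * z ^+ (k - m) by rewrite -exprD subnKC.
rewrite zm mulNr raddfN mulr_suml raddf_sum; apply: VN => //.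
apply: Vsum => // j _; rewrite -mulrA phiZ -exprD; apply: VMl => //.
by apply: IH; have := ltn_ord j; lia.
Qed.

Lemma integral_closure_base (L : fieldExtType F) a :
  integral_closure (valuation_ring v) L a%:A -> V 0 a.
Proof.
case=> f [fm f0 rf]; have {}rf : root f a by rewrite -(fmorph_root (in_alg L)).
have [||K hK] := @integral_pow_bounded F idfun idfun a f _ fm f0.
- by [].
- by rewrite map_poly_id.
- exact: (@pow_bounded K).
Qed.

End IntegralElements.

(* cs and cu are the coordinates in the basis (1, x), where x^2 = t x + n *)
Record quadratic_coords (F : fieldType) (L : fieldExtType F) (x : L)
    (cs cu : {additive L -> F}) (t n : F) : Prop := QuadraticCoords {
  csA : forall a, cs a%:A = a;
  cuA : forall a, cu a%:A = 0;
  csx : cs x = 0;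
  cux : cu x = 1;
  csM : forall z w, cs (z * w) = cs z * cs w + n * (cu z * cu w);
  cuM : forall z w, cu (z * w) = cs z * cu w + cu z * cs w + t * (cu z * cu w);
  coordsE : forall z, z = (cs z)%:A + (cu z)%:A * x }.

Lemma quadratic_coords_exist (F : fieldType) (L : fieldExtType F) (x : L) :
  \dim {:L} = 2%N -> (forall a, x != a%:A) ->
  exists cs cu t n, quadratic_coords x cs cu t n.
Proof.
move=> dL xF; pose X := [tuple x; 1 : L].
have fX : free X.
  rewrite free_cons seq1_free oner_neq0 andbT span_seq1.
  by apply/negP => /vlineP[a xa]; have := xF a; rewrite xa eqxx.
have bX : basis_of {:L} X by rewrite basisEfree fX subvf dL /=.
pose cu := coord X 0; pose cs := coord X 1.
have E z : z = (cs z)%:A + (cu z)%:A * x.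
  rewrite [LHS](coord_basis bX) ?memvf // !big_ord_recl big_ord0 addr0 /=.
  rewrite -scalerAl mul1r addrC; congr (_ *: _ + _).
  by rewrite /cs; congr (coord X _ z); apply/val_inj.
have cs1 : cs 1 = 1 by rewrite /cs (coord_free 1 1 fX).
have cu1 : cu 1 = 0 by rewrite /cu (coord_free 1 0 fX).
have csx0 : cs x = 0 by rewrite /cs (coord_free 0 1 fX).
have cux1 : cu x = 1 by rewrite /cu (coord_free 0 0 fX).
have csZ a z : cs (a *: z) = a * cs z by rewrite /cs linearZ.
have cuZ a z : cu (a *: z) = a * cu z by rewrite /cu linearZ.
have csD z w : cs (z + w) = cs z + cs w by rewrite /cs linearD.
have cuD z w : cu (z + w) = cu z + cu w by rewrite /cu linearD.
have csA0 a : cs a%:A = a by rewrite csZ cs1 mulr1.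
have cuA0 a : cu a%:A = 0 by rewrite cuZ cu1 mulr0.
have ZE a z : a%:A * z = a *: z by rewrite -scalerAl mul1r.
have prodE z w : z * w = (cs z * cs w + cs (x ^+ 2) * (cu z * cu w))%:A +
    (cs z * cu w + cu z * cs w + cu (x ^+ 2) * (cu z * cu w))%:A * x.
  rewrite {1}(E z) {1}(E w); have := E (x ^+ 2).
  rewrite -!in_algE !rmorphD !rmorphM /=.
  move: (cs (x ^+ 2)) (cu (x ^+ 2)) => n t xx; ring: xx.
have csmk a b : cs (a%:A + b%:A * x) = a.
  by rewrite csD csA0 ZE csZ csx0 mulr0 addr0.
have cumk a b : cu (a%:A + b%:A * x) = b.
  by rewrite cuD cuA0 ZE cuZ cux1 mulr1 add0r.
exists cs, cu, (cu (x ^+ 2)), (cs (x ^+ 2)); split=> // z w.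
- exact: etrans (congr1 cs (prodE z w)) (csmk _ _).
- exact: etrans (congr1 cu (prodE z w)) (cumk _ _).
Qed.

(** * The ring of integers of a ramified quadratic extension *)

Section RamifiedQuadratic.
Variables (F : fieldType) (v : F -> int).
Hypothesis hv : normalized_discrete_valuation v.
Variables (L : fieldExtType F) (x : L).
Local Notation V := (val_geq v).
Local Notation X := (exact_val v).
Local Notation OL := (integral_closure (valuation_ring v) L).

Section Coordinates.
Variables (cs cu : {additive L -> F}) (t n : F).
Hypothesis hq : quadratic_coords x cs cu t n.

Lemma coords_inj z w : cs z = cs w -> cu z = cu w -> z = w.
Proof. by move=> h1 h2; rewrite (coordsE hq z) (coordsE hq w) h1 h2. Qed.

Lemma csAM a z : cs (a%:A * z) = a * cs z.
Proof. by rewrite (csM hq) (csA hq) (cuA hq) mul0r mulr0 addr0. Qed.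

Lemma cuAM a z : cu (a%:A * z) = a * cu z.
Proof. by rewrite (cuM hq) (csA hq) (cuA hq) !mul0r mulr0 !addr0. Qed.

Lemma cs1 : cs 1 = 1. Proof. by rewrite -[1]scale1r (csA hq). Qed.
Lemma cu1 : cu 1 = 0. Proof. by rewrite -[1]scale1r (cuA hq). Qed.

Lemma cs_mk a b : cs (a%:A + b%:A * x) = a.
Proof. by rewrite raddfD /= csAM (csA hq) (csx hq) mulr0 addr0. Qed.

Lemma cu_mk a b : cu (a%:A + b%:A * x) = b.
Proof. by rewrite raddfD /= cuAM (cuA hq) (cux hq) mulr1 add0r. Qed.

(** Norm and trace of L over F: the conjugate of [x] is t - x, and x (t - x) = - n. *)
Definition nm z := cs z ^+ 2 + t * (cs z * cu z) - n * cu z ^+ 2.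
Definition tr z := 2 * cs z + t * cu z.

Lemma nmM z w : nm (z * w) = nm z * nm w.
Proof. rewrite /nm (csM hq) (cuM hq); ring. Qed.

Lemma nm1 : nm 1 = 1.
Proof. by rewrite /nm cs1 cu1 !mulr0 expr0n /= mulr0 subr0 addr0 expr1n. Qed.

Lemma nmX z i : nm (z ^+ i) = nm z ^+ i.
Proof. by elim: i => [|i IH]; rewrite ?expr0 ?nm1 // !exprS nmM IH. Qed.

Lemma nm_neq0 z : z != 0 -> nm z != 0.
Proof.
move=> z0; apply/eqP => h; have := nmM z z^-1.
by rewrite mulfV // nm1 h mul0r => /eqP; rewrite oner_eq0.
Qed.

Lemma nmV z : z != 0 -> nm z^-1 = (nm z)^-1.
Proof.
move=> z0; have := nmM z z^-1; rewrite mulfV // nm1 => h.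
by rewrite -[RHS]mulr1 h mulKf ?nm_neq0.
Qed.

Lemma nmA a : nm a%:A = a ^+ 2.
Proof. by rewrite /nm (csA hq) (cuA hq) !mulr0 expr0n mulr0 subr0 addr0. Qed.

Lemma tr_sqr z : tr (z ^+ 2) = tr z ^+ 2 - 2 * nm z.
Proof. rewrite /tr /nm expr2 (csM hq) (cuM hq); ring. Qed.

Lemma sqr_tr_nm z : z ^+ 2 = (tr z)%:A * z - (nm z)%:A.
Proof.
apply: coords_inj.
  by rewrite raddfB /= csAM (csA hq) expr2 (csM hq) /tr /nm; ring.
by rewrite raddfB /= cuAM (cuA hq) expr2 (cuM hq) /tr /nm; ring.
Qed.

(** Squaring [z] doubles a negative valuation of the trace, because tr(z^2) = tr(z)^2 - 2 nm(z) and
    the norm is integral. The weak linear bound in [j] is enough. *)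
Lemma tr_unbounded z j : V 0 (nm z) -> ~ V 0 (tr z) ->
  ~ V (- j%:Z) (tr (z ^+ (2 ^ j))).
Proof.
move=> hn ht; elim: j => [|j IH] //.
rewrite expnSr exprM tr_sqr => h; apply: IH.
set y := tr _ in h *.
have hN : V 0 (nm (z ^+ (2 ^ j))).
  rewrite nmX; case: hn => [->|hn].
    by rewrite expr0n expn_eq0 /=; left.
  have [->|N0] := eqVneq (nm z) 0; first by rewrite expr0n expn_eq0 /=; left.
  by right; rewrite vX //; apply: mulr_ge0.
have h2 : V (- j.+1%:Z) (y ^+ 2).
  rewrite -[y ^+ 2](subrK (2 * nm (z ^+ (2 ^ j)))); apply: VD => //.
  apply: V_le (VMl hv (V_nat hv 2) hN); lia.
have [->|y0] := eqVneq y 0; first by left.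
case: h2 => [/eqP|]; first by rewrite (negPf (expf_neq0 _ y0)).
by rewrite vX // => h2; right; lia.
Qed.

Lemma pow_bounded_nm_tr K z :
  (forall k, V K (cs (z ^+ k)) /\ V K (cu (z ^+ k))) ->
  V 0 (nm z) /\ V 0 (tr z).
Proof.
move=> h; have [K1 hK1] := V_bound v [:: t; n].
have [ht hn] : V K1 t /\ V K1 n by split; apply: hK1; rewrite !inE eqxx ?orbT.
pose K' := - (`|K1| + 2 * `|K|).
have hN : V 0 (nm z).
  apply: (@pow_bounded _ _ hv K') => k; rewrite -nmX /nm.
  have [h1 h2] := h k.
  have h3 := VM hv ht (VM hv h1 h2).
  have h4 := VM hv hn (VM hv h2 h2).
  apply: (VB hv); first apply: (VD hv).
  - by apply: V_le (VM hv h1 h1); rewrite /K'; lia.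
  - by apply: V_le h3; rewrite /K'; lia.
  - by apply: V_le h4; rewrite /K'; lia.
split=> //; apply: contrapT => /(tr_unbounded hN) hT.
apply: (hT `|K'|%N); have [h1 h2] := h (2 ^ `|K'|)%N.
apply: (VD hv).
  by apply: V_le (VMl hv (V_nat hv 2) h1); rewrite /K'; lia.
by apply: V_le (VM hv ht h2); rewrite /K'; lia.
Qed.

Lemma integral_nm_tr z : OL z -> V 0 (nm z) /\ V 0 (tr z).
Proof.
case=> f [fm f0 rf].
have [K1 h1] := @integral_pow_bounded _ _ hv L (in_alg L) cs z f csAM fm f0 rf.
have [K2 h2] := @integral_pow_bounded _ _ hv L (in_alg L) cu z f cuAM fm f0 rf.
apply: (@pow_bounded_nm_tr (Num.min K1 K2)) => k.
by split; [apply: V_le (h1 k)|apply: V_le (h2 k)];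
  rewrite ge_min lexx ?orbT.
Qed.

Lemma integral_of_nm_tr z : V 0 (nm z) -> V 0 (tr z) -> OL z.
Proof.
move=> hn ht; pose r := - (tr z)%:P * 'X + (nm z)%:P.
have szr : (size r < 3)%N.
  by rewrite /r -polyCN mul_polyC -[_ *: _]addr0 -addrA add0r (leq_ltn_trans (size_polyD _ _)) //
     gtn_max (leq_ltn_trans (size_scale_leq _ _)) ?size_polyX //
     (leq_ltn_trans (size_polyC_leq1 _)).
exists ('X^2 + r); split.
- by rewrite monicE lead_coefDl ?size_polyXn // lead_coefXn.
- move=> j; rewrite coefD coefXn /r coefD -polyCN coefCM coefX coefC.
  have b01 (b : bool) : V 0 b%:R by exact: V_nat.
  by apply: (VD hv) => //; apply: (VD hv);
    [apply: (VMl hv) => //; exact: VN|case: ifP => // _; exact: V0].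
- apply/rootP; rewrite rmorphD /= map_polyXn /r rmorphD rmorphM rmorphN /=.
  rewrite !map_polyC map_polyX /= !hornerE /= sqr_tr_nm; ring.
Qed.

(** In s^2 + t s u - n u^2 the first term has even and the last has odd valuation, so they cannot
    cancel, and the middle term is smaller than the dominant one. This lemma and the next treat the
    two possible dominant terms. *)
Lemma exact_nm_s m z : X 1 n -> V 1 t ->
  X m (cs z) -> V m (cu z) -> X (2 * m) (nm z).
Proof.
move=> hn ht hs hu; rewrite /nm -addrA; apply: exactD => //.
  by have := exactM hv hs hs; rewrite -expr2; congr X; lia.
apply: (VB hv).
  by apply: V_le (VM hv ht (VM hv hs.1 hu)); lia.
by apply: V_le (VM hv hn.1 (VM hv hu hu)); lia.
Qed.

Lemma exact_nm_u m z : X 1 n -> V 1 t ->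
  X m (cu z) -> V (m + 1) (cs z) -> X (2 * m + 1) (nm z).
Proof.
move=> hn ht hu hs; rewrite /nm [_ - _]addrC; apply: exactD => //.
  by apply: exactN => //; have := exactM hv hn (exactM hv hu hu);
    rewrite -expr2; congr X; lia.
apply: (VD hv).
  by apply: V_le (VM hv hs hs); lia.
by apply: V_le (VM hv ht (VM hv hs hu.1)); lia.
Qed.

Lemma V_nm z : X 1 n -> V 1 t -> V 0 (nm z) <-> V 0 (cs z) /\ V 0 (cu z).
Proof.
move=> hn ht; split=> [h|[hs hu]]; last first.
  apply: (VB hv); first apply: (VD hv).
  - exact: (VMl hv).
  - by apply: (VMl hv); [apply: V_le ht|exact: (VMl hv)].
  - by apply: (VMl hv); [apply: V_le hn.1|exact: (VMl hv)].
have main : forall m, V m (cs z) -> V m (cu z) ->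
    ~ (V (m + 1) (cs z) /\ V (m + 1) (cu z)) -> 0 <= m.
  move=> m hs hu no.
  have [hs1|hs1] := pselect (V (m + 1) (cs z)); last first.
    by have /(exact_V 0)[/(_ h)+ _] := exact_nm_s hn ht (conj hs hs1) hu; lia.
  have hu1 : ~ V (m + 1) (cu z) by move=> ?; apply: no.
  by have /(exact_V 0)[/(_ h)+ _] := exact_nm_u hn ht (conj hu hu1) hs1; lia.
have [z0|z0] := pselect (cs z = 0 /\ cu z = 0).
  by case: z0 => -> ->; split; left.
have [K hK] := V_bound v [:: cs z; cu z].
(* [m] is the largest integer for which both coordinates lie in [V m]. *)
have [||m nom hm] := @int_min (fun k => ~ (V (k + 1) (cs z) /\ V (k + 1) (cu z))) (K - 1).
- apply: contrapT => no; apply: z0.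
  have al k : V (k + 1) (cs z) /\ V (k + 1) (cu z).
    by apply: contrapT => h1; apply: no; exists k.
  split; apply/eqP; apply/negPn/negP => y0.
    by have [[/eqP|]] := al (v (cs z)); [rewrite (negPf y0)|lia].
  by have [_ [/eqP|]] := al (v (cu z)); [rewrite (negPf y0)|lia].
- move=> k hk; rewrite leNgt; apply/negP => lek; apply: hk.
  have leK : k + 1 <= K by lia.
  by split; apply: V_le leK _; apply: hK; rewrite !inE eqxx ?orbT.
have [hs1 hu1] : V m (cs z) /\ V m (cu z).
  apply: contrapT => no; have : m <= m - 1 by apply: hm; rewrite subrK.
  lia.
have m0 : 0 <= m by exact: main.
by split; apply: V_le m0 _.
Qed.

End Coordinates.

Variable p : F.
Hypothesis hp : uniformizer (valuation_ring v) p.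
Let p0 : p != 0. Proof. by case: (uniformizer_val hv hp). Qed.
Let vp : v p = 1. Proof. by case: (uniformizer_val hv hp). Qed.

(** By [rc_n] and [rc_t] the polynomial X^2 - t X - n of [x] is Eisenstein. *)
Record ramified_coords (cs cu : {additive L -> F}) (t n : F) : Prop :=
  RamifiedCoords {
    rc_coords : quadratic_coords x cs cu t n;
    rc_n : X 1 n;
    rc_t : V 1 t;
    rc_OL : forall z, OL z <-> V 0 (cs z) /\ V 0 (cu z);
    rc_sqr : scale_set p%:A OL = scale_set (x ^+ 2) OL }.

(** Taking norms in p = x^e s with s a unit gives v(n) e = 2, and 1 < e leaves only e = 2 and v(n) =
    1. *)
Lemma ramified_coords_exist :
  \dim {:L} = 2%N -> uniformizer OL x -> ramified (valuation_ring v) p x ->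
  exists cs cu t n, ramified_coords cs cu t n.
Proof.
move=> dL ux [e e1 pxe].
have OL1 : OL 1.
  exists ('X - 1%:P); split; first exact: monicXsubC.
    move=> i; rewrite coefB coefX coefC; apply: (VB hv); first exact: V_nat.
    by case: ifP => _; [exact: V1|exact: V0].
  by rewrite rmorphB /= map_polyX map_polyC /= scale1r root_XsubC.
have OLx : OL x.
  have : scale_set x OL x by exists 1 => //; rewrite mulr1.
  by rewrite -ux => -[].
have [s OLs xs] : scale_set (x ^+ e) OL p%:A.
  by rewrite -pxe; exists 1; rewrite ?mulr1.
have [s' OLs' ps'] : scale_set p%:A OL (x ^+ e).
  by rewrite pxe; exists 1; rewrite ?mulr1.
have pA0 : p%:A != 0 :> L by rewrite scaler_eq0 oner_eq0 orbF.
have xe0 : x ^+ e != 0 by apply: contra_eq_neq xs => ->; rewrite mul0r eq_sym.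
have ss' : s * s' = 1.
  by apply: (mulfI xe0); rewrite mulrA xs ps' mulr1.
have x0 : x != 0 by apply: contraNneq xe0 => ->; rewrite expr0n; case: (e) e1.
(* If [x] were in F, so would be the units s and s', and v(x) e = 1 would contradict 1 < e. *)
have xF a : x != a%:A.
  apply/eqP => xa; have a0 : a != 0.
    by apply: contra_eq_neq xa => ->; rewrite scale0r.
  have ae0 : a ^+ e != 0 by rewrite expf_neq0.
  have xeA : x ^+ e = (a ^+ e)%:A by rewrite xa -!in_algE rmorphXn.
  have sA : s = (p / a ^+ e)%:A.
    apply: (mulfI xe0); rewrite xs xeA -!in_algE -rmorphM /=.
    by rewrite mulrC divfK.
  have sA' : s' = (a ^+ e / p)%:A.
    by apply: (mulfI pA0); rewrite ps' xeA -!in_algE -rmorphM /= mulrC divfK.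
  rewrite sA in OLs; rewrite sA' in OLs'.
  have := integral_closure_base hv OLs; have := integral_closure_base hv OLs'.
  case=> [/eqP|]; first by rewrite mulf_eq0 invr_eq0 (negPf ae0) (negPf p0).
  rewrite vM ?invr_neq0 // vX // vV // vp => h1.
  case=> [/eqP|]; first by rewrite mulf_eq0 invr_eq0 (negPf ae0) (negPf p0).
  rewrite vM ?invr_neq0 // vV // vX // vp => h2.
  have : v a * e%:Z = 1 by lia.
  by case: (lerP (v a) 0) => va; move: e1; clear -va; nia.
have [cs [cu [t [n hq]]]] := quadratic_coords_exist dL xF.
have nmx : nm cs cu t n x = - n.
  by rewrite /nm (csx hq) (cux hq) expr0n /= mul0r mulr0 !add0r expr1n mulr1.
have n0 : n != 0 by have := nm_neq0 hq x0; rewrite nmx oppr_eq0.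
have [Nx Tx] := integral_nm_tr hq OLx.
have [Ns Ts] := integral_nm_tr hq OLs.
have [Ns' Ts'] := integral_nm_tr hq OLs'.
have s0 : s != 0 by apply: contra_eq_neq ss' => ->; rewrite mul0r eq_sym oner_eq0.
have vs : v (nm cs cu t n s) = 0.
  have s'0 : s' != 0 by apply: contra_eq_neq ss' => ->; rewrite mulr0 eq_sym oner_eq0.
  have := nmM hq s s'; rewrite ss' (nm1 hq) => h.
  have [N0 N0'] := (nm_neq0 hq s0, nm_neq0 hq s'0).
  have := vM hv N0 N0'; rewrite -h v1 //.
  case: Ns => [/eqP|]; first by rewrite (negPf N0).
  case: Ns' => [/eqP|]; first by rewrite (negPf N0').
  lia.
have vxe : (v n) * e%:Z = 2.
  have := nmA hq p; rewrite -xs (nmM hq) (nmX hq) nmx => h.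
  have Nx0 : (- n) ^+ e != 0 by rewrite expf_neq0 // oppr_eq0.
  have := vM hv Nx0 (nm_neq0 hq s0); rewrite h vX // vX ?oppr_eq0 // vs vp.
  by rewrite -mulN1r vM ?oppr_eq0 ?oner_eq0 // vN1 // add0r addr0 mul1r => <-.
have vn : v n = 1.
  have : 0 <= v n.
    move: Nx; rewrite nmx => -[/eqP|]; first by rewrite oppr_eq0 (negPf n0).
    by rewrite -mulN1r vM ?oppr_eq0 ?oner_eq0 // vN1 // add0r.
  by nia.
have e2 : e = 2%N by move: vxe; rewrite vn; lia.
have Xn : X 1 n by apply/exactP.
(* Now x^2 = p s', so t^2 + 2 n = tr(x^2) = p tr(s') lies in the maximal ideal, and with it t^2. *)
have Vt : V 1 t.
  have trx : tr cs cu t x = t by rewrite /tr (csx hq) (cux hq) mulr0 mulr1 add0r.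
  rewrite e2 in ps'; have := tr_sqr hq x; rewrite trx nmx -ps' {1}/tr (csAM hq) (cuAM hq).
  rewrite [_ * (p * _)]mulrCA [t * (p * _)]mulrCA -mulrDr -/(tr cs cu t s').
  move=> h; have V1t2 : V 1 (t ^+ 2).
    rewrite -[t ^+ 2](subrK (2 * - n)) -h; apply: (VD hv).
      by have := VM hv (_ : V 1 p) Ts'; rewrite addr0; apply; right; rewrite vp.
    by apply: (VMl hv); [exact: V_nat|apply: VN => //; case: Xn].
  have [->|t0] := eqVneq t 0; first exact: V0.
  case: V1t2 => [/eqP|]; first by rewrite (negPf (expf_neq0 _ t0)).
  by rewrite vX // => ?; right; lia.
exists cs, cu, t, n; split=> //; last by rewrite -e2.
move=> z; rewrite -(V_nm _ _ _ Xn Vt); split; first by case/(integral_nm_tr hq).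
move=> Nz; apply: (integral_of_nm_tr hq) => //.
have [hs hu] := (V_nm _ _ z Xn Vt).1 Nz.
apply: (VD hv); apply: (VMl hv) => //; first exact: V_nat.
by apply: V_le Vt.
Qed.
End RamifiedQuadratic.

(** * Lattices in E over the base ring *)

Section Lattices.
Variables (F : fieldType) (v : F -> int) (p : F).
Hypothesis hv : normalized_discrete_valuation v.
Hypothesis hp : uniformizer (valuation_ring v) p.
Variables (L : fieldExtType F) (x : L) (cs cu : {additive L -> F}) (t n : F).
Hypothesis hr : ramified_coords v x p cs cu t n.
Local Notation V := (val_geq v).
Local Notation o := (valuation_ring v).
Local Notation E := (F * L)%type.
Local Notation OE := (@maximal_order F L o).
Local Notation d := (@diag F L).
Let hq := rc_coords hr.

Lemma mem_maximal_order (e : E) :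
  OE e <-> [/\ V 0 e.1, V 0 (cs e.2) & V 0 (cu e.2)].
Proof.
split=> [[h1 /(rc_OL hr)[h2 h3]]|[h1 h2 h3]] //.
by split=> //; apply/(rc_OL hr).
Qed.

Lemma maximal_orderD (e f : E) : OE e -> OE f -> OE (e + f).
Proof.
move=> /mem_maximal_order[h1 h2 h3] /mem_maximal_order[k1 k2 k3].
by apply/mem_maximal_order; rewrite /= !raddfD /=; split; apply: (VD hv).
Qed.

Lemma maximal_orderM (e f : E) : OE e -> OE f -> OE (e * f).
Proof.
move=> /mem_maximal_order[h1 h2 h3] /mem_maximal_order[k1 k2 k3].
apply/mem_maximal_order; rewrite /= (csM hq) (cuM hq).
have Vn : V 0 n by apply: V_le (rc_n hr).1.
have Vt : V 0 t by apply: V_le (rc_t hr).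
by split; repeat (apply: (VD hv) || apply: (VMl hv)).
Qed.

Lemma maximal_order_diag a : V 0 a -> OE (d a).
Proof.
move=> h; apply/mem_maximal_order; rewrite /= (csA hq) (cuA hq).
by split=> //; left.
Qed.

Lemma maximal_order0 : OE 0.
Proof. by apply/mem_maximal_order; rewrite /= !raddf0; split; left. Qed.

Lemma algM a b : (a * b)%:A = a%:A * b%:A :> L.
Proof. by rewrite -!in_algE rmorphM. Qed.

Lemma diagM a b : d a * d b = d (a * b).
Proof. by rewrite /diag; congr pair => /=; rewrite -!in_algE rmorphM. Qed.

Lemma diag1 : d 1 = 1.
Proof. by rewrite /diag scale1r. Qed.

Lemma submodule_closed (A M : set E) : submodule A M ->
  [/\ M 0, forall e f, M e -> M f -> M (e + f), forall e, M e -> M (- e)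
    & forall a e, A a -> M e -> M (a * e)].
Proof.
move=> [[/set_mem M0 MB] MZ].
have {}MB e f : M e -> M f -> M (e - f).
  by move=> /mem_set he /mem_set hf; apply/set_mem/MB.
have MN e : M e -> M (- e) by move=> he; rewrite -sub0r; exact: MB.
by split=> // e f he hf; rewrite -[f]opprK; apply/MB/MN.
Qed.

Lemma submodule_sum (A M : set E) (I : Type) (r : seq I) (f : I -> E) :
  submodule A M -> (forall i, M (f i)) -> M (\sum_(i <- r) f i).
Proof.
case/submodule_closed=> M0 MD _ _ h.
by elim/big_rec: _ => // i y _ hy; exact: MD.
Qed.

Lemma submodule_restrict (A B M : set E) :
  B `<=` A -> submodule A M -> submodule B M.
Proof. by move=> BA [h1 h2]; split=> // a m /BA; exact: h2. Qed.

Lemma clear_denominators (s : seq F) :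
  exists D : nat, forall y, y \in s -> V 0 (p ^ D%:Z * y).
Proof.
elim: s => [|y s [D hD]]; first by exists 0%N.
have [D' hD'] := V_clear hv hp y.
exists (maxn D D') => z; rewrite inE => /orP[/eqP->|/hD].
  by apply: hD'; exact: leq_maxr.
rewrite !(V_pZM hv hp); apply: V_le; lia.
Qed.

Lemma finitely_generated_bounded (A M : set E) :
  A `<=` OE -> finitely_generated A M ->
  exists D : nat, forall e, M e -> OE (d (p ^ D%:Z) * e).
Proof.
move=> AO [s ->].
have [D hD] := clear_denominators
  ([seq m.1 | m <- s] ++ [seq cs m.2 | m <- s] ++ [seq cu m.2 | m <- s]).
exists D => e [k [a [m [Aa sm ->]]]]; rewrite mulr_sumr.
elim/big_rec: _ => [|i y _ hy]; first exact: maximal_order0.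
apply: maximal_orderD => //; rewrite mulrCA; apply: maximal_orderM; first exact: AO.
have mi : m i \in s by exact: sm.
apply/mem_maximal_order; rewrite /= (csAM hq) (cuAM hq).
split; apply: hD; rewrite !mem_cat.
- by rewrite map_f.
- by rewrite (map_f (fun e : E => cs e.2)) ?orbT.
- by rewrite (map_f (fun e : E => cu e.2)) ?orbT.
Qed.

(** Every element of E is an F-combination of elements of [M], and one power of [p] clears its
    finitely many denominators. *)
Lemma spanning_denominator (M : set E) (e : E) :
  submodule (d @` o) M -> span_set (range d) M = setT ->
  exists D : nat, M (d (p ^ D%:Z) * e).
Proof.
move=> sM spM; have : span_set (range d) M e by rewrite spM.
move=> [k [a [m [ra Mm ->]]]].
have ra' i : exists y, d y = a i by have [y _ yE] := ra i; exists y.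
have [g hg] := choice ra'.
have [D hD] := clear_denominators (codom g).
exists D; rewrite mulr_sumr; apply: submodule_sum (sM) _ => i.
have [_ _ _ MZ] := submodule_closed sM.
by rewrite mulrA -hg diagM; apply: MZ => //; exists (p ^ D%:Z * g i) => //;
  apply/hD/codom_f.
Qed.

(** The kernel is that of the projection of [M] to L. Together with the image under [cu], treated
    next, it supplies the outer two generators of orders and ideals. *)
Lemma kernel_principal (M : set E) (D : nat) :
  submodule (d @` o) M -> (forall e, M e -> OE (d (p ^ D%:Z) * e)) ->
  (exists2 a, a != 0 & M (a, 0)) ->
  exists m, forall a, M (a, 0) <-> V m a.
Proof.
move=> /submodule_closed[_ MD _ MZ] hD [a0 a00 Ma0].
apply: (@submodule_principal _ _ hv [set a | M (a, 0)] (- D%:Z) a0) => //=.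
- by move=> y z hy hz; have := MD _ _ hy hz; rewrite /GRing.add /= /add_pair /= addr0.
- move=> a y ha hy; have := MZ (d a) _ (ex_intro2 _ _ a ha erefl) hy.
  by rewrite /GRing.mul /= /mul_pair /= mulr0.
- by move=> y /hD /mem_maximal_order[/= /(V_pZM hv hp)]; rewrite sub0r.
Qed.

Lemma image_principal (M : set E) (D : nat) :
  submodule (d @` o) M -> (forall e, M e -> OE (d (p ^ D%:Z) * e)) ->
  (exists2 e, cu e.2 != 0 & M e) ->
  exists m, forall y, (exists2 e, M e & cu e.2 = y) <-> V m y.
Proof.
move=> /submodule_closed[_ MD _ MZ] hD [e0 e00 Me0].
apply: (@submodule_principal _ _ hv
  [set y | exists2 e, M e & cu e.2 = y] (- D%:Z) (cu e0.2)) => //=.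
- move=> y z [e he <-] [f hf <-]; exists (e + f); first exact: MD.
  by rewrite /= raddfD.
- move=> a y ha [e he <-]; exists (d a * e); last by rewrite /= (cuAM hq).
  by apply: MZ => //; exists a.
- by exists e0.
- move=> y [e /hD /mem_maximal_order[_ _ /=]]; rewrite (cuAM hq).
  by move=> /(V_pZM hv hp); rewrite sub0r => h <-.
Qed.

End Lattices.

(** * Explicit generators of an order *)

Section Orders.
Variables (F : fieldType) (v : F -> int) (p : F).
Hypothesis hv : normalized_discrete_valuation v.
Hypothesis hp : uniformizer (valuation_ring v) p.
Variables (L : fieldExtType F) (x : L) (cs cu : {additive L -> F}) (t n : F).
Hypothesis hr : ramified_coords v x p cs cu t n.
Local Notation V := (val_geq v).
Local Notation X := (exact_val v).
Local Notation o := (valuation_ring v).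
Local Notation E := (F * L)%type.
Local Notation OE := (@maximal_order F L o).
Local Notation d := (@diag F L).
Let hq := rc_coords hr.

Let p0 : p != 0. Proof. by case: (uniformizer_val hv hp). Qed.

(** All powers of an element of [R] lie in the finitely generated module [R], so their coordinates
    have bounded denominators. *)
Lemma order_subset (R : set E) : is_order o R -> R `<=` OE.
Proof.
move=> [/[dup] hsub [_ _ RM] _ fg _] e Re.
have R1 : R 1 by apply: set_mem; case: hsub.
have RX k : R (e ^+ k).
  elim: k => [|k IH]; first by rewrite expr0.
  by rewrite exprS; apply/set_mem/RM; apply/mem_set.
have dO : d @` o `<=` OE by move=> _ [a ha <-]; exact: (maximal_order_diag hr).
have [D hD] := finitely_generated_bounded hv hp hr dO fg.
have hk k : [/\ V (- D%:Z) (e.1 ^+ k), V (- D%:Z) (cs (e.2 ^+ k))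
              & V (- D%:Z) (cu (e.2 ^+ k))].
  have eX : e ^+ k = (e.1 ^+ k, e.2 ^+ k).
    elim: k => [|k IH]; first by rewrite !expr0.
    by rewrite !exprS IH.
  have := hD _ (RX k); rewrite eX => /(mem_maximal_order hr)[/=].
  by rewrite (csAM hq) (cuAM hq) !(V_pZM hv hp) !sub0r.
apply/(mem_maximal_order hr).
have h1 : V 0 e.1 by apply: (pow_bounded hv (K := - D%:Z)) => k; case: (hk k).
have [h2 h3] := pow_bounded_nm_tr hv hq (K := - D%:Z) (z := e.2)
  (fun k => let: And3 _ a b := hk k in conj a b).
by have /(rc_OL hr)[h4 h5] := integral_of_nm_tr hv hq h2 h3.
Qed.

Lemma order_submodule (R : set E) : is_order o R -> submodule (d @` o) R.
Proof.
move=> [[R1 RB RM] dR _ _]; split; last first.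
  by move=> a m /dR Ra Rm; apply/set_mem/RM; apply/mem_set.
by split=> //; rewrite -(subrr 1); apply: RB.
Qed.

Definition order_of (b f1 : nat) (k : F) : set E :=
  [set e | [/\ V 0 (cs e.2), V b (cu e.2) & V f1 (e.1 - cs e.2 - cu e.2 * k)]].

(** p^b generates the image of [cu]; a lift of it, diminished by the diagonal element of its
    coordinate [cs], is the generator p^b (k, x). *)
Lemma order_ofP (R : set E) (f1 : nat) :
  is_order o R -> (forall a, R (a, 0) <-> V f1 a) ->
  exists b k, [/\ R = order_of b f1 k, V (- b%:Z) k
    & V (f1%:Z - 2 * b%:Z) (k ^+ 2 - t * k - n)].
Proof.
move=> hR kerR; have RO := order_subset hR; have sR := order_submodule hR.
have [[/set_mem R1 _ RM] dR _ spR] := hR.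
have [_ RD RN RZ] := submodule_closed sR.
have RO0 e : R e -> OE (d (p ^ 0%N) * e).
  by move=> /RO; rewrite expr0z diag1 mul1r.
have [|b hb] := image_principal hv hp hr sR RO0.
  have [D hD] := spanning_denominator hv hp (0, x) sR spR.
  exists (d (p ^ D%:Z) * (0, x)) => //=.
  by rewrite (cuAM hq) (cux hq) mulr1 expfz_neq0.
have b0 : 0 <= b.
  have [] := (hb (p ^ b)).2; first exact/(V_pZ hv hp).
  by move=> e /RO/(mem_maximal_order hr)[_ _ h3] h; move: h3; rewrite h => /(V_pZ hv hp).
have [b' bb'] : exists b' : nat, b = b' by exists `|b|%N; lia.
subst b; rename b' into b; move: b0 => _.
have [|e Re eb] := (hb (p ^ b%:Z)).2; first exact/(V_pZ hv hp).
have [he1 he2 _] := (mem_maximal_order hr e).1 (RO _ Re).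
pose k := p ^ (- b%:Z) * (e.1 - cs e.2).
have kE : p ^ b%:Z * k = e.1 - cs e.2.
  by rewrite /k mulrA -expfzDr // subrr expr0z mul1r.
have Rk : R (p ^ b%:Z * k, (p ^ b%:Z)%:A * x).
  have := RD _ _ Re (RN _ (RZ (d (cs e.2)) _ (ex_intro2 _ _ _ he2 erefl) R1)).
  congr R; rewrite kE mulr1 /diag; congr pair => /=.
  by rewrite {1}(coordsE hq e.2) eb addrAC subrr add0r.
exists b, k; have Vk : V (- b%:Z) k.
  by rewrite /k; apply/(V_pZM hv hp); rewrite subrr; apply: (VB hv).
have pE y : p ^ (- b%:Z) * y * p ^ b%:Z = y.
  by rewrite mulrAC -expfzDr // addNr expr0z mul1r.
split=> //.
  apply/seteqP; split=> [[a z] Rz|[a z] [/= h1 h2 h3]].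
    have [/= h1 h2 _] := (mem_maximal_order hr _).1 (RO _ Rz).
    have h3 : V b (cu z) by apply/hb; exists (a, z).
    split=> //=; apply/kerR.
    have h4 : V 0 (p ^ (- b%:Z) * cu z) by apply/(V_pZM hv hp); rewrite sub0r opprK.
    have := RD _ _ (RD _ _ Rz (RN _ (RZ _ _ (ex_intro2 _ _ _ h2 erefl) R1)))
      (RN _ (RZ _ _ (ex_intro2 _ _ _ h4 erefl) Rk)).
    congr R; rewrite mulr1 /diag; congr pair => /=.
      by rewrite [_ * (_ * k)]mulrA pE.
    rewrite {1}(coordsE hq z) mulrA -algM pE.
    by rewrite -addrA -opprD subrr.
  have h4 : V 0 (p ^ (- b%:Z) * cu z) by apply/(V_pZM hv hp); rewrite sub0r opprK.
  have := RD _ _ ((kerR _).2 h3) (RD _ _ (RZ _ _ (ex_intro2 _ _ _ h1 erefl) R1)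
    (RZ _ _ (ex_intro2 _ _ _ h4 erefl) Rk)).
  congr R; rewrite mulr1 /diag; congr pair => /=.
    by rewrite [X in _ + (_ + X)]mulrA pE; ring.
  by rewrite add0r mulrA -algM pE -(coordsE hq).
(* The square of p^b (k, x), reduced by the relation x^2 = t x + n, has second component 0. *)
have /kerR : R (p ^ (2 * b%:Z) * (k ^+ 2 - t * k - n), 0).
  have h1 : V 0 (p ^ b%:Z * t) by apply/(V_pZM hv hp); apply: V_le (rc_t hr); lia.
  have h2 : V 0 (p ^ (2 * b%:Z) * n) by apply/(V_pZM hv hp); apply: V_le (rc_n hr).1; lia.
  have RR : R ((p ^ b%:Z * k, (p ^ b%:Z)%:A * x) * (p ^ b%:Z * k, (p ^ b%:Z)%:A * x)).
    by apply/set_mem/RM; apply/mem_set.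
  have p2 : p ^ (2 * b%:Z) = p ^ b%:Z * p ^ b%:Z by rewrite -expfzDr //; congr (_ ^ _); lia.
  have := RD _ _ RR (RN _ (RD _ _ (RZ _ _ (ex_intro2 _ _ _ h1 erefl) Rk)
    (RZ _ _ (ex_intro2 _ _ _ h2 erefl) R1))).
  congr R; rewrite mulr1 /diag; congr pair => /=.
    by rewrite p2; ring.
  apply: (coords_inj hq).
    by rewrite raddf0 raddfB raddfD /= !(csM hq, cuM hq, csA hq, cuA hq, csx hq, cux hq) p2; ring.
  by rewrite raddf0 raddfB raddfD /= !(csM hq, cuM hq, csA hq, cuA hq, csx hq, cux hq); ring.
by move/(V_pZM hv hp).
Qed.

End Orders.

(** * The conductor of an order *)

Section Conductor.
Variables (F : fieldType) (v : F -> int) (p : F).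
Hypothesis hv : normalized_discrete_valuation v.
Hypothesis hp : uniformizer (valuation_ring v) p.
Variables (L : fieldExtType F) (x : L) (cs cu : {additive L -> F}) (t n : F).
Hypothesis hr : ramified_coords v x p cs cu t n.
Local Notation V := (val_geq v).
Local Notation X := (exact_val v).
Local Notation o := (valuation_ring v).
Local Notation OL := (integral_closure o L).
Local Notation E := (F * L)%type.
Let hq := rc_coords hr.

Let p0 : p != 0. Proof. by case: (uniformizer_val hv hp). Qed.

Local Notation Rof := (order_of v cs cu).

(** On F x 0 an element e of the maximal order acts like the diagonal element of e.1, which lies in
    [R]; so the intersection of [R] with F x 0 is already an ideal of the maximal order. *)
Lemma conductor_kernel (R : set E) (f1 f2 : nat) : is_order o R ->
  conductor o R = scale_set (p ^+ f1) o `*` scale_set (x ^+ f2) OL ->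
  forall a, R (a, 0) <-> V f1 a.
Proof.
move=> hR hC a; have [_ dR _ _] := hR.
have [R0 _ _ RZ] := submodule_closed (order_submodule hR).
have VP y : scale_set (p ^+ f1) o y <-> V f1 y.
  split=> [[w ow <-]|h].
    by rewrite exprnP; apply/(V_pZM hv hp); rewrite subrr.
  exists (p ^ (- f1%:Z) * y); first by apply/(V_pZM hv hp); rewrite sub0r opprK.
  by rewrite mulrA (exprnP p f1) -expfzDr // subrr expr0z mul1r.
rewrite -VP; split=> [Ra|h].
  suff : conductor o R (a, 0) by rewrite hC => -[].
  have Oa := order_subset hv hp hr hR Ra; split=> // _ [e [oe _] <-].
  have := RZ _ _ (ex_intro2 _ _ e.1 oe erefl) Ra; congr R.
  by rewrite /diag; congr pair => /=; rewrite ?mul0r ?mulr0 // mulrC.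
have : conductor o R (a, 0).
  rewrite hC; split=> //=; exists 0; last by rewrite mulr0.
  by apply/(rc_OL hr); rewrite !raddf0; split; left.
case=> _; apply; exists 1; last by rewrite mulr1.
by rewrite -(diag1 L); apply: (maximal_order_diag hr); exact: V1.
Qed.

(** The norm stands in for the valuation of L: p^j x / x^f2 has a norm of valuation 2 j + 1 - f2. *)
Lemma mem_pZx (j f2 : nat) :
  scale_set (x ^+ f2) OL ((p ^ j%:Z)%:A * x) <-> (f2 <= 2 * j + 1)%N.
Proof.
have x0 : x != 0.
  by apply: contra_eq_neq (cux hq) => ->; rewrite raddf0 eq_sym oner_eq0.
have nmx : nm cs cu t n x = - n.
  by rewrite /nm (csx hq) (cux hq) expr0n /= mul0r mulr0 !add0r expr1n mulr1.
pose w := (p ^ j%:Z)%:A * x / x ^+ f2.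
have Xw : X (2 * j%:Z + 1 - f2%:Z) (nm cs cu t n w).
  rewrite /w !(nmM hq) (nmV hq) ?expf_neq0 // (nmX hq) (nmA hq) nmx.
  apply: (exactM hv); first apply: (exactM hv).
  - have := exactM hv (exact_pZ hv hp j) (exact_pZ hv hp j).
    by rewrite -expr2; congr X; lia.
  - exact/(exactN hv)/(rc_n hr).
  - apply: (exactV hv); elim: f2 {w} => [|k IH]; first by rewrite expr0; exact: exact1.
    have := exactM hv (exactN hv (rc_n hr)) IH.
    by rewrite -exprS; congr X; lia.
have OLw : OL w <-> (f2 <= 2 * j + 1)%N.
  have -> : OL w <-> V 0 (nm cs cu t n w).
    by rewrite (V_nm hv _ _ _ (rc_n hr) (rc_t hr)); exact: (rc_OL hr).
  rewrite (exact_V 0 Xw); lia.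
rewrite -OLw; split=> [[y Oy yE]|Ow].
  by rewrite /w -yE mulrC mulKf ?expf_neq0.
by exists w => //; rewrite mulrC divfK ?expf_neq0.
Qed.

(** The constant C depends on f2 only through [f2./2], so it is enough to test the elements p^j x,
    of odd valuation 2 j + 1 in L. *)
Lemma conductor_order_of (b f1 f2 : nat) (k : F) :
  conductor o (Rof b f1 k) =
    scale_set (p ^+ f1) o `*` scale_set (x ^+ f2) OL ->
  forall j : nat, (f2./2 <= j)%N <->
    [/\ (b <= j)%N, (f1 <= j.+1)%N & V f1 (p ^ j%:Z * k)].
Proof.
move=> hC j; have -> : (f2./2 <= j)%N <-> (f2 <= 2 * j + 1)%N by lia.
have Vn : V 0 n by apply: V_le (rc_n hr).1.
have Vt : V 0 t by apply: V_le (rc_t hr).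
rewrite -mem_pZx.
have -> : scale_set (x ^+ f2) OL ((p ^ j%:Z)%:A * x) <->
    conductor o (Rof b f1 k) (0, (p ^ j%:Z)%:A * x).
  rewrite hC; split=> [h|[]//]; split=> //=.
  by exists 0; [left|rewrite mulr0].
split=> [[_ h]|[h1 h2 h3]].
  have [_] : Rof b f1 k ((0, (p ^ j%:Z)%:A * x) * 1).
    apply: h; exists 1 => //; rewrite -(diag1 L).
    by apply: (maximal_order_diag hr); exact: V1.
  rewrite mulr1 /= (csAM hq) (cuAM hq) (csx hq) (cux hq) mulr1 mulr0 subr0 sub0r.
  move=> /(V_pZ hv hp) bj /(VN hv); rewrite opprK => Vk.
  (* Since x (x - t) = n, this product is (0, p^j n), whose second component is in F and has
     valuation j + 1 there; membership forces f1 <= j + 1. *)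
  have : Rof b f1 k ((0, (p ^ j%:Z)%:A * x) * (0, x - t%:A)).
    apply: h; exists (0, x - t%:A) => //; apply/(mem_maximal_order hr).
    rewrite /= !raddfB /= (csA hq) (cuA hq) (csx hq) (cux hq) sub0r subr0.
    by split; [left|exact: VN|exact: V1].
  case=> _ _ /=; have -> : (p ^ j%:Z)%:A * x * (x - t%:A) = (p ^ j%:Z * n)%:A.
    apply: (coords_inj hq); rewrite !(csM hq, cuM hq, csA hq, cuA hq, raddfB) /=
      !(csA hq, cuA hq, csx hq, cux hq); ring.
  rewrite (csA hq) (cuA hq) !mul0r subr0 sub0r => /(VN hv).
  rewrite opprK => /(V_pZM hv hp)/(exact_V _ (rc_n hr)) h2.
  by split=> //; lia.
split.
  apply/(mem_maximal_order hr); rewrite /= (csAM hq) (cuAM hq) (csx hq) (cux hq).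
  by rewrite mulr0 mulr1; split; [left|left|apply/(V_pZ hv hp)].
move=> _ [e /(mem_maximal_order hr)[_ hs hu] <-].
have csE : cs ((p ^ j%:Z)%:A * x * e.2) = p ^ j%:Z * (n * cu e.2).
  by rewrite !(csM hq, cuM hq, csA hq, cuA hq, csx hq, cux hq); ring.
have cuE : cu ((p ^ j%:Z)%:A * x * e.2) = p ^ j%:Z * (cs e.2 + t * cu e.2).
  by rewrite !(csM hq, cuM hq, csA hq, cuA hq, csx hq, cux hq); ring.
rewrite /order_of /= csE cuE mul0r sub0r.
have Vw : V 0 (cs e.2 + t * cu e.2) by apply: (VD hv) => //; exact: (VMl hv).
split.
- by apply/(V_pZM hv hp); apply: V_le (VMl hv Vn hu); lia.
- by apply/(V_pZM hv hp); apply: V_le Vw; lia.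
- apply: (VB hv).
    apply/(VN hv)/(V_pZM hv hp); apply: V_le (VMr hv (rc_n hr).1 hu); lia.
  by rewrite mulrAC; apply: (VMr hv).
Qed.

End Conductor.

(** * The colength of an order *)

Section Length.
Variables (F : fieldType) (v : F -> int) (p : F).
Hypothesis hv : normalized_discrete_valuation v.
Hypothesis hp : uniformizer (valuation_ring v) p.
Variables (L : fieldExtType F) (x : L) (cs cu : {additive L -> F}) (t n : F).
Hypothesis hr : ramified_coords v x p cs cu t n.
Local Notation V := (val_geq v).
Local Notation X := (exact_val v).
Local Notation o := (valuation_ring v).
Local Notation E := (F * L)%type.
Local Notation OE := (@maximal_order F L o).
Local Notation d := (@diag F L).
Let hq := rc_coords hr.

Let p0 : p != 0. Proof. by case: (uniformizer_val hv hp). Qed.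

Local Notation Rof := (order_of v cs cu).

(** For [M] between an order and the maximal order, i + j is the colength of [M]: as [M] contains 1,
    the coordinate [cs] contributes nothing. *)
Definition lattice_invariants (M : set E) (i j : int) : Prop :=
  (forall a, M (a, 0) <-> V i a) /\
  (forall y, (exists2 e, M e & cu e.2 = y) <-> V j y).

Lemma lattice_invariants_exist (M : set E) (b f1 : nat) (k : F) :
  submodule (d @` o) M -> Rof b f1 k `<=` M -> M `<=` OE ->
  exists i j, lattice_invariants M i j /\ [/\ 0 <= i, 0 <= j & i + j <= f1%:Z + b%:Z].
Proof.
move=> sM RM MO.
have MO0 e : M e -> OE (d (p ^ 0%N) * e).
  by move=> /MO; rewrite expr0z diag1 mul1r.
have Mf1 : M (p ^ f1%:Z, 0).
  apply: RM; split; rewrite /= ?(raddf0 cs) ?(raddf0 cu); try by left.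
  by rewrite mul0r !subr0; apply/(V_pZ hv hp).
have Mb : M (p ^ b%:Z * k, (p ^ b%:Z)%:A * x).
  apply: RM; split; rewrite /= ?(csAM hq) ?(cuAM hq) ?(csx hq) ?(cux hq) ?mulr0 ?mulr1 //.
  - by left.
  - exact/(V_pZ hv hp).
  - by rewrite subr0 subrr; left.
have [|i hi] := kernel_principal hv hp hr sM MO0.
  by exists (p ^ f1%:Z) => //; rewrite expfz_neq0.
have [|j hj] := image_principal hv hp hr sM MO0.
  exists (p ^ b%:Z * k, (p ^ b%:Z)%:A * x) => //=.
  by rewrite (cuAM hq) (cux hq) mulr1 expfz_neq0.
exists i, j; split=> //.
have i0 : 0 <= i.
  have /MO/(mem_maximal_order hr)[/= + _ _] := (hi (p ^ i)).2 ((V_pZ hv hp _ _).2 (lexx i)).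
  by move/(V_pZ hv hp).
have j0 : 0 <= j.
  have [e /MO/(mem_maximal_order hr)[_ _ he] eE] := (hj (p ^ j)).2 ((V_pZ hv hp _ _).2 (lexx j)).
  by move: he; rewrite eE => /(V_pZ hv hp).
have if1 : i <= f1%:Z by apply/(V_pZ hv hp)/hi.
have jb : j <= b%:Z.
  apply/(V_pZ hv hp)/hj; exists (p ^ b%:Z * k, (p ^ b%:Z)%:A * x) => //=.
  by rewrite (cuAM hq) (cux hq) mulr1.
by split=> //; lia.
Qed.

(** If neither invariant dropped, an element of M' could be changed by an element of M to kill [cu]
    and by a diagonal element to kill its L-component; the remainder would lie in the common kernel,
    and M' would equal M. *)
Lemma lattice_invariants_mono (M M' : set E) (i j i' j' : int) (b f1 : nat) k :
  submodule (d @` o) M -> submodule (d @` o) M' ->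
  Rof b f1 k `<=` M -> M' `<=` OE -> M `<` M' ->
  lattice_invariants M i j -> lattice_invariants M' i' j' -> i' + j' < i + j.
Proof.
move=> sM sM' RM M'O [MM' nM'M] [hi hj] [hi' hj'].
have le_i : i' <= i by apply/(V_pZ hv hp)/hi'/MM'/hi/(V_pZ hv hp).
have le_j : j' <= j.
  apply/(V_pZ hv hp)/hj'.
  by have [e Me <-] := (hj (p ^ j)).2 ((V_pZ hv hp _ _).2 (lexx j)); exists e => //; exact: MM'.
suff : ~ (i' = i /\ j' = j) by lia.
case=> ei ej; subst i' j'; apply: nM'M => e M'e.
have [|f Mf cuE] := (hj (cu e.2)).2; first by apply/hj'; exists e.
have [_ MD MN MZ] := submodule_closed sM.
have [_ M'D M'N M'Z] := submodule_closed sM'.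
have M1 : M 1.
  by apply: RM; split; rewrite /= ?(cs1 hq) ?(cu1 hq) ?mul0r ?subr0 ?subrr; [exact: V1|left|left].
have Me' : M' (e - f) by apply: M'D => //; apply/M'N/MM'.
have /(mem_maximal_order hr)[_ hs _] := M'O _ Me'.
have E1 : (e - f) + (- (d (cs (e - f).2) * 1)) = ((e - f).1 - cs (e - f).2, 0).
  rewrite mulr1 /diag; congr pair => /=.
  by apply: (coords_inj hq); rewrite raddfB ?(csA hq) ?(cuA hq) /= ?(raddf0 cs)
    ?(raddf0 cu) ?subrr // subr0 raddfB /= cuE subrr.
have dh : (d @` o) (d (cs (e - f).2)) by exists (cs (e - f).2).
have : M' ((e - f).1 - cs (e - f).2, 0).
  by rewrite -E1; apply: M'D => //; apply/M'N/M'Z => //; exact: MM'.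
move/hi'/hi; rewrite -E1 => h.
have := MD _ _ Mf (MD _ _ h (MZ _ _ dh M1)); rewrite subrK.
by rewrite addrC subrK.
Qed.

Lemma strict_chain_bound (b f1 : nat) (k : F) (m : nat) :
  has_strict_chain (d @` o) (Rof b f1 k) OE m -> (m <= f1 + b)%N.
Proof.
move=> [c [hc hlt]].
(* Each strict inclusion lowers i + j, which starts at no more than f1 + b and never becomes
   negative. *)
suff main : forall l, (l <= m)%N -> forall i j, lattice_invariants (c l) i j ->
    i + j + l%:Z <= f1%:Z + b%:Z.
  have [sM RM MO] := hc m (leqnn m).
  have [i [j [hij [i0 j0 _]]]] := lattice_invariants_exist sM RM MO.
  by have := main m (leqnn m) _ _ hij; lia.
elim=> [|l IH] lm i j hij.
  have [sM RM MO] := hc 0%N lm.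
  have [i' [j' [[hi' hj'] [_ _ h]]]] := lattice_invariants_exist sM RM MO.
  have Vinj i1 i2 : (forall y, V i1 y <-> V i2 y) -> i1 = i2.
    move=> h12; apply/eqP; rewrite eq_le; apply/andP; split.
      by apply/(V_pZ hv hp)/h12/(V_pZ hv hp).
    by apply/(V_pZ hv hp)/h12/(V_pZ hv hp).
  have -> : i = i' by apply: Vinj => y; rewrite -hi' hij.1.
  have -> : j = j' by apply: Vinj => y; rewrite -hj' hij.2.
  by lia.
have [sM RM MO] := hc l (ltnW lm).
have [sM' RM' MO'] := hc l.+1 lm.
have [i' [j' [hij' _]]] := lattice_invariants_exist sM RM MO.
have := lattice_invariants_mono sM sM' RM MO' (hlt l lm) hij' hij.
by have := IH (ltnW lm) _ _ hij'; lia.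
Qed.

Lemma order_of_submodule (b i : nat) (k : F) : submodule (d @` o) (Rof b i k).
Proof.
split; last first.
  move=> _ e [a ha <-] [h1 h2 h3].
  split; rewrite /= ?(csAM hq) ?(cuAM hq); try exact: (VMl hv).
  by rewrite -mulrA -!mulrBr; apply: (VMl hv).
split; first by apply/mem_set; split; rewrite /= ?(raddf0 cs) ?(raddf0 cu) ?mul0r ?subrr; left.
move=> e f /set_mem[h1 h2 h3] /set_mem[k1 k2 k3]; apply/mem_set.
split; rewrite /= ?raddfB; try exact: (VB hv).
by have := VB hv h3 k3; congr V; rewrite /=; ring.
Qed.

Lemma has_strict_chain_order_of (b f1 : nat) (k : F) :
  V (- b%:Z) k -> has_strict_chain (d @` o) (Rof b f1 k) OE (f1 + b).
Proof.
move=> Vk; pose B (j : nat) : set E := [set e | [/\ V 0 e.1, V 0 (cs e.2) & V j (cu e.2)]].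
have sB j : submodule (d @` o) (B j).
  split; last first.
    move=> _ e [a ha <-] [h1 h2 h3].
    by split; rewrite /= ?(csAM hq) ?(cuAM hq); apply: (VMl hv).
  split; first by apply/mem_set; split; rewrite /= ?(raddf0 cs) ?(raddf0 cu); left.
  move=> e f /set_mem[h1 h2 h3] /set_mem[k1 k2 k3]; apply/mem_set.
  by split; rewrite /= ?raddfB; apply: (VB hv).
have RB i : Rof b i k `<=` B b.
  move=> e [h1 h2 h3]; split=> //.
  rewrite -[e.1](subrK (cs e.2)) -[X in V 0 (X + _)](subrK (cu e.2 * k)).
  apply: (VD hv) => //; apply: (VD hv); first by apply: V_le h3.
  by have := VM hv h2 Vk; rewrite subrr.
have BB i j : (j <= i)%N -> B i `<=` B j.
  by move=> ji e [h1 h2 h3]; split=> //; apply: V_le h3; rewrite lez_nat.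
have RR i j : (j <= i)%N -> Rof b i k `<=` Rof b j k.
  by move=> ji e [h1 h2 h3]; split=> //; apply: V_le h3; rewrite lez_nat.
(* The chain first lowers the exponent f1 of the congruence, which at exponent 0 holds automatically
   as u k is integral and leaves [B b]; then it lowers b. *)
exists (fun l => if (l < f1)%N then Rof b (f1 - l) k else B (b - (l - f1))%N); split.
  move=> l lm; case: ltnP => lf; split.
  - exact: order_of_submodule.
  - by apply: RR; exact: leq_subr.
  - by move=> e /RB /(BB _ _ (leq0n b))[h1 h2 h3]; apply/(mem_maximal_order hr).
  - exact: sB.
  - by move=> e /RB; apply: BB; exact: leq_subr.
  - by move=> e /(BB _ _ (leq0n _))[h1 h2 h3]; apply/(mem_maximal_order hr).
move=> l lm.
have memR (i : nat) a : V i a -> Rof b i k (a, 0).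
  by split; rewrite /= ?(raddf0 cs) ?(raddf0 cu) ?mul0r ?subr0 //; left.
have notR i j : (j < i)%N -> ~ Rof b i k (p ^ j%:Z, 0).
  by move=> ji [_ _ /=]; rewrite (raddf0 cs) (raddf0 cu) mul0r !subr0 => /(V_pZ hv hp); lia.
case: (ltnP l.+1 f1) => l1.
  rewrite (ltnW l1); split; first by apply: RR; lia.
  move=> /(_ (p ^ (f1 - l.+1)%:Z, 0)) h.
  by apply: (@notR (f1 - l)%N (f1 - l.+1)%N); [lia|apply/h/memR/(V_pZ hv hp)].
case: (ltnP l f1) => l2.
  have -> : (l.+1 - f1 = 0)%N by lia.
  rewrite subn0; split; first exact: RB.
  move=> /(_ (p ^ 0%N, 0)) h; apply: (@notR (f1 - l)%N 0%N); first lia.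
  by apply: h; split; rewrite /= ?(raddf0 cs) ?(raddf0 cu); [exact/(V_pZ hv hp)|left|left].
split; first by apply: BB; lia.
move=> /(_ (0, (p ^ (b - (l.+1 - f1))%:Z)%:A * x)) h.
have : B (b - (l - f1))%N (0, (p ^ (b - (l.+1 - f1))%:Z)%:A * x).
  by apply: h; split; rewrite /= ?(csAM hq) ?(cuAM hq) ?(csx hq) ?(cux hq) ?mulr0 ?mulr1;
    [left|left|exact/(V_pZ hv hp)].
case=> _ _ /=; rewrite (cuAM hq) (cux hq) mulr1 => /(V_pZ hv hp); lia.
Qed.

Lemma quotient_length_order_of (b f1 : nat) (k : F) (S : nat) :
  V (- b%:Z) k -> quotient_length (d @` o) (Rof b f1 k) OE S -> S = (f1 + b)%N.
Proof.
move=> Vk [h1 h2]; apply/eqP; rewrite eqn_leq (strict_chain_bound h1) /=.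
exact/h2/has_strict_chain_order_of.
Qed.

End Length.

(** * The constants b, f1 and C of an order *)

Section OrderInvariants.
Variables (F : fieldType) (v : F -> int) (p : F).
Hypothesis hv : normalized_discrete_valuation v.
Hypothesis hp : uniformizer (valuation_ring v) p.
Variables (L : fieldExtType F) (x : L) (cs cu : {additive L -> F}) (t n : F).
Hypothesis hr : ramified_coords v x p cs cu t n.
Local Notation V := (val_geq v).
Local Notation X := (exact_val v).
Local Notation o := (valuation_ring v).
Local Notation OL := (integral_closure o L).
Local Notation E := (F * L)%type.
Local Notation OE := (@maximal_order F L o).
Local Notation d := (@diag F L).

(* the value at y of the minimal polynomial of x *)
Definition minpoly_at y := y ^+ 2 - t * y - n.

(** The Newton polygon of an Eisenstein polynomial: y^2 dominates for v(y) <= 0 and the constant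
    term for v(y) >= 1, the case of the next lemma. This dichotomy controls the size of all slope
    classes. *)
Lemma exact_minpoly_npos g y : g <= 0 -> X g y -> X (2 * g) (minpoly_at y).
Proof.
rewrite /minpoly_at.
move=> g0 Xy; rewrite -addrA; apply: (exactD hv).
  by have := exactM hv Xy Xy; rewrite -expr2; congr X; lia.
apply: (VB hv); last by apply: V_le (rc_n hr).1; lia.
by apply: (VN hv); apply: V_le (VM hv (rc_t hr) Xy.1); lia.
Qed.

Lemma exact_minpoly_pos y : V 1 y -> X 1 (minpoly_at y).
Proof.
rewrite /minpoly_at.
move=> Vy; rewrite addrC; apply: (exactD hv); first exact/(exactN hv)/(rc_n hr).
apply: (VB hv); last by apply: V_le (VM hv (rc_t hr) Vy); lia.
by apply: V_le (VM hv Vy Vy); lia.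
Qed.

(* R is generated over o by 1, p^b (k, x) and (p^f1, 0); C = min(f1, b + 1, b + v(k))
   is the constant of the theorem *)
Record order_params (R : set E) (b f1 C : nat) (k : F) : Prop := OrderParams {
  op_def : R = order_of v cs cu b f1 k;
  op_k : V (- b%:Z) k;
  op_Cf1 : (C <= f1)%N;
  op_Cb : (C <= b.+1)%N;
  op_VC : V (C%:Z - b%:Z) k;
  op_XC : (C < f1)%N -> (C < b.+1)%N -> X (C%:Z - b%:Z) k;
  op_f1b : (f1 <= 2 * b + 1)%N;
  op_f1C : (f1 <= 2 * C)%N }.

(** By [conductor_order_of], [f2./2] is the largest of b, f1 - 1 and f1 - v(k), and C is f1 + b
    minus this number. The two bounds on f1 come from v(minpoly k) >= f1 - 2 b, which expresses that
    [R] is closed under multiplication. *)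
Lemma order_params_exist (R : set E) (S f1 f2 : nat) : is_order o R ->
  conductor o R = scale_set (p ^+ f1) o `*` scale_set (x ^+ f2) OL ->
  quotient_length (d @` o) R OE S ->
  exists b C k, [/\ order_params R b f1 C k, S = (f1 + b)%N & (f2./2 + C = f1 + b)%N].
Proof.
move=> hR hC hS.
have [b [k [RE Vk Vmin]]] := order_ofP hv hp hr hR (conductor_kernel hv hp hr hR hC).
have SE : S = (f1 + b)%N by apply: (quotient_length_order_of hv hp hr Vk); rewrite -RE.
have hf2 := conductor_order_of hv hp hr (f1 := f1) (b := b) (k := k) (f2 := f2).
rewrite -RE in hf2; move: {hf2}(hf2 hC) => hf2.
have f2le : (f2./2 <= f1 + b)%N.
  apply/hf2; split; [lia|lia|].
  by apply/(V_pZM hv hp); apply: V_le Vk; lia.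
have [h1 h2 h3] := (hf2 _).1 (leqnn f2./2).
exists b, (f1 + b - f2./2)%N, k; split=> //; last by lia.
set C := (f1 + b - f2./2)%N.
have VC : V (C%:Z - b%:Z) k.
  by move/(V_pZM hv hp): h3; congr V; rewrite /C; lia.
have XC : (C < f1)%N -> (C < b.+1)%N -> X (C%:Z - b%:Z) k.
  move=> Cf Cb; split=> // VC1.
  (* If v(k) exceeded C - b, then [f2./2 - 1] would also satisfy the three conditions of the
     conductor. *)
  have : (f2./2 <= f2./2.-1)%N.
    apply/hf2; split; [rewrite /C in Cf; lia|rewrite /C in Cb; lia|].
    by apply/(V_pZM hv hp); apply: V_le VC1; rewrite /C in Cf *; lia.
  by rewrite /C in Cf; lia.
have f1b : (f1 <= 2 * b + 1)%N.
  have [V1k|nV1k] := pselect (V 1 k).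
    by have := (exact_V _ (exact_minpoly_pos V1k)).1 Vmin; lia.
  have k0 : k != 0 by apply: contra_not_neq nV1k => ->; left.
  have vk : v k <= 0.
    by rewrite leNgt; apply/negP => vk; apply: nV1k; right; lia.
  have := (exact_V _ (exact_minpoly_npos vk (exact_ex v k0))).1 Vmin.
  by lia.
have Cf1 : (C <= f1)%N by rewrite /C; lia.
have Cb : (C <= b.+1)%N by rewrite /C; lia.
split=> //.
have [Cf|] := ltnP C f1; last by lia.
have [Cb'|] := ltnP C b.+1; last by lia.
have g0 : C%:Z - b%:Z <= 0 by lia.
by have := (exact_V _ (exact_minpoly_npos g0 (XC Cf Cb'))).1 Vmin; lia.
Qed.

End OrderInvariants.

(** * Generators of a fractional ideal *)

Section Ideals.
Variables (F : fieldType) (v : F -> int) (p : F).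
Hypothesis hv : normalized_discrete_valuation v.
Hypothesis hp : uniformizer (valuation_ring v) p.
Variables (L : fieldExtType F) (x : L) (cs cu : {additive L -> F}) (t n : F).
Hypothesis hr : ramified_coords v x p cs cu t n.
Local Notation V := (val_geq v).
Local Notation o := (valuation_ring v).
Local Notation OL := (integral_closure o L).
Local Notation E := (F * L)%type.
Local Notation OE := (@maximal_order F L o).
Local Notation d := (@diag F L).
Let hq := rc_coords hr.

Let p0 : p != 0. Proof. by case: (uniformizer_val hv hp). Qed.

Definition ideal_equiv (I J : set E) : Prop :=
  exists2 u : E, u \is a GRing.unit & J = scale_set u I.

Lemma unit_pairP (u : E) : u \is a GRing.unit <-> u.1 != 0 /\ u.2 != 0.
Proof.
change (((u.1 \is a GRing.unit) && (u.2 \is a GRing.unit)) <-> u.1 != 0 /\ u.2 != 0).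
by rewrite !unitfE; split=> [/andP|h] //; exact/andP.
Qed.

Lemma scale_setP (u : E) (I : set E) e :
  u \is a GRing.unit -> scale_set u I e <-> I (u^-1 * e).
Proof.
move=> uu; split=> [[f If <-]|h]; first by rewrite mulKr.
by exists (u^-1 * e) => //; rewrite mulVKr.
Qed.

Lemma scale_setM (u w : E) (I : set E) :
  scale_set u (scale_set w I) = scale_set (u * w) I.
Proof.
apply/seteqP; split=> e.
  by move=> [f [g Ig <-] <-]; exists g => //; rewrite mulrA.
by move=> [g Ig <-]; exists (w * g); [exists g|rewrite mulrA].
Qed.

Lemma scale_set1 (I : set E) : scale_set 1 I = I.
Proof.
apply/seteqP; split=> e; first by move=> [f If <-]; rewrite mul1r.
by move=> Ie; exists e => //; rewrite mul1r.
Qed.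

Lemma ideal_equiv_refl I : ideal_equiv I I.
Proof. by exists 1; rewrite ?unitr1 // scale_set1. Qed.

Lemma ideal_equiv_sym I J : ideal_equiv I J -> ideal_equiv J I.
Proof.
by move=> [u uu ->]; exists u^-1; rewrite ?unitrV // scale_setM mulVr // scale_set1.
Qed.

Lemma ideal_equiv_trans I J K : ideal_equiv I J -> ideal_equiv J K -> ideal_equiv I K.
Proof.
move=> [u uu ->] [w wu ->]; exists (w * u); last by rewrite scale_setM.
by rewrite unitrM_comm ?wu //; exact: mulrC.
Qed.

Lemma scale_submodule (A I : set E) u : submodule A I -> submodule A (scale_set u I).
Proof.
move=> sI; have [I0 ID IN IZ] := submodule_closed sI; split; last first.
  by move=> a _ Aa [f If <-]; exists (a * f); [exact: IZ|rewrite mulrCA].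
split; first by apply/mem_set; exists 0; rewrite ?mulr0.
move=> _ _ /set_mem[e Ie <-] /set_mem[f If <-]; apply/mem_set.
by exists (e - f); [exact/ID/IN|rewrite mulrBr].
Qed.

(* the o-module generated by (1, 0), (al, 1) and p^k (be, x) *)
Definition lat (k : nat) (al be : F) : set E :=
  [set e | [/\ V 0 (cs e.2), V k (cu e.2)
    & V 0 (e.1 - cs e.2 * al - cu e.2 * be)]].

(** Division by an element whose L-component has least norm valuation makes the projection to L
    contain 1 and consist of integral elements, since integrality is decided by the norm. The factor
    p^(-l) makes the kernel equal to o, and a lift of p^k in the coordinate [cu], cleared of its
    constant part, defines [be]. *)
Lemma lat_normal_form (R I : set E) : is_order o R -> fractional_ideal R I ->
  exists k al be, ideal_equiv I (lat k al be).
Proof.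
move=> hR [sI fI spI]; have [_ dR _ _] := hR.
have RO := order_subset hv hp hr hR.
have sIo := submodule_restrict dR sI.
have [D hD] := finitely_generated_bounded hv hp hr RO fI.
have [||m [e0 [Ie0 e00 me0]] hm] := @int_min (fun m => exists e,
    [/\ I e, e.2 != 0 & v (nm cs cu t n e.2) = m]) (- 2 * D%:Z).
- have [D' hD'] := spanning_denominator hv hp (0, 1) sIo spI.
  exists (v (nm cs cu t n (d (p ^ D'%:Z) * (0, 1)).2)), (d (p ^ D'%:Z) * (0, 1)).
  by split=> //=; rewrite mulr1 scaler_eq0 oner_eq0 orbF expfz_neq0.
- move=> m [e [/hD/(mem_maximal_order hr)[/= _ h1 h2] e0 <-]].
  have := (V_nm hv _ _ _ (rc_n hr) (rc_t hr)).2 (conj h1 h2).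
  rewrite (nmM hq) (nmA hq) => -[/eqP|].
    by rewrite mulf_eq0 expf_eq0 /= (negPf (expfz_neq0 _ p0)) (negPf (nm_neq0 hq e0)).
  rewrite (vM hv) ?expf_neq0 ?expfz_neq0 ?(nm_neq0 hq) // (vX hv) ?expfz_neq0 //.
  by rewrite (vpZ hv hp); lia.
have [|l hl] := kernel_principal hv hp hr sIo hD.
  have [D' hD'] := spanning_denominator hv hp (1, 0) sIo spI.
  exists (p ^ D'%:Z); first by rewrite expfz_neq0.
  by move: hD'; congr I; rewrite /diag; congr pair => /=; rewrite ?mulr1 ?mulr0.
pose u : E := (p ^ (- l), e0.2^-1).
have uu : u \is a GRing.unit by apply/unit_pairP; rewrite expfz_neq0 //= invr_eq0.
pose J := scale_set u I.
have sJ : submodule (d @` o) J by apply: scale_submodule.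
have [_ JD JN JZ] := submodule_closed sJ.
have kerJ a : J (a, 0) <-> V 0 a.
  have -> : J (a, 0) <-> I (p ^ l * a, 0).
    split=> [[[f1 f2] If [<-]]|h].
      move=> /eqP; rewrite mulf_eq0 invr_eq0 (negPf e00) /= => /eqP f20.
      by rewrite mulrA -expfzDr // subrr expr0z mul1r -f20.
    exists (p ^ l * a, 0) => //; rewrite /u; congr pair => /=; last by rewrite mulr0.
    by rewrite mulrA -expfzDr // addNr expr0z mul1r.
  by rewrite hl (V_pZM hv hp) subrr.
have JO e : J e -> OL e.2.
  move=> [f If <-] /=; apply/(rc_OL hr)/(V_nm hv _ _ _ (rc_n hr) (rc_t hr)).
  have [->|f0] := eqVneq f.2 0.
    by rewrite mulr0 /nm !raddf0 !mulr0 expr0n mulr0 subr0 addr0; left.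
  right; rewrite (nmM hq) (nmV hq) // (vM hv) ?invr_neq0 ?(nm_neq0 hq) //.
  rewrite (vV hv) ?(nm_neq0 hq) // me0 addrC subr_ge0.
  by apply: hm; exists f.
have hDJ e : J e -> OE (d (p ^ (D + `|l|)%:Z) * e).
  move=> Je; have /(rc_OL hr)[h1 h2] := JO _ Je; apply/(mem_maximal_order hr).
  rewrite /= (csAM hq) (cuAM hq); split; last 2 first.
  - by apply/(V_pZM hv hp); apply: V_le h1; lia.
  - by apply/(V_pZM hv hp); apply: V_le h2; lia.
  move: Je => [f /hD/(mem_maximal_order hr)[/= /(V_pZM hv hp) h _ _] <-] /=.
  by do 2 apply/(V_pZM hv hp); apply: V_le h; lia.
have Je1 : J (u * e0) by exists e0.
have e12 : (u * e0).2 = 1 by rewrite /= mulVf.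
move: (u * e0) Je1 e12 => [al w] /= Je1 e12; subst w.
have [|k hk] := image_principal hv hp hr sJ hDJ.
  have [D' hD'] := spanning_denominator hv hp (e0 * (0, x)) sIo spI.
  exists (u * (d (p ^ D'%:Z) * (e0 * (0, x)))); last by exists (d (p ^ D'%:Z) * (e0 * (0, x))).
  rewrite /= mulrCA mulKf // (cuAM hq) (cux hq) mulr1.
  by rewrite expfz_neq0.
have k0 : 0 <= k.
  have [e /JO/(rc_OL hr)[_ h] eE] := (hk (p ^ k)).2 ((V_pZ hv hp _ _).2 (lexx k)).
  by move: h; rewrite eE => /(V_pZ hv hp).
have [k' kk'] : exists k' : nat, k = k' by exists `|k|%N; lia.
subst k; rename k' into k; move: k0 => _.
have [e Je eE] := (hk (p ^ k)).2 ((V_pZ hv hp _ _).2 (lexx k%:Z)).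
have /(rc_OL hr)[he _] := JO _ Je.
pose be := p ^ (- k%:Z) * (e.1 - cs e.2 * al).
have beE : p ^ k%:Z * be = e.1 - cs e.2 * al.
  by rewrite /be mulrA -expfzDr // subrr expr0z mul1r.
have Jbe : J (p ^ k%:Z * be, (p ^ k%:Z)%:A * x).
  have := JD _ _ Je (JN _ (JZ (d (cs e.2)) _ (ex_intro2 _ _ _ he erefl) Je1)).
  congr J; rewrite beE /diag; congr pair => /=.
  by rewrite mulr1 {1}(coordsE hq e.2) eE addrAC subrr add0r.
have pE y : p ^ (- k%:Z) * y * p ^ k%:Z = y.
  by rewrite mulrAC -expfzDr // addNr expr0z mul1r.
exists k, al, be; exists u => //; rewrite -/J.
apply/seteqP; split=> [[a z] [/= h1 h2 h3]|[a z] Jz].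
  have h4 : V 0 (p ^ (- k%:Z) * cu z) by apply/(V_pZM hv hp); rewrite sub0r opprK.
  have := JD _ _ ((kerJ _).2 h3) (JD _ _ (JZ _ _ (ex_intro2 _ _ _ h1 erefl) Je1)
    (JZ _ _ (ex_intro2 _ _ _ h4 erefl) Jbe)).
  congr J; rewrite /diag; congr pair => /=.
    by rewrite [_ * (_ * be)]mulrA pE; ring.
  by rewrite mulr1 add0r mulrA -algM pE -(coordsE hq).
have /(rc_OL hr)[/= h1 h2] := JO _ Jz.
have h3 : V k (cu z) by apply/hk; exists (a, z).
split=> //=; apply/kerJ.
have h4 : V 0 (p ^ (- k%:Z) * cu z) by apply/(V_pZM hv hp); rewrite sub0r opprK.
have := JD _ _ (JD _ _ Jz (JN _ (JZ _ _ (ex_intro2 _ _ _ h1 erefl) Je1)))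
  (JN _ (JZ _ _ (ex_intro2 _ _ _ h4 erefl) Jbe)).
congr J; rewrite /diag; congr pair => /=.
  by rewrite [_ * (_ * be)]mulrA pE.
by rewrite mulr1 {1}(coordsE hq z) mulrA -algM pE -addrA -opprD subrr.
Qed.

End Ideals.

(** * Stability and equivalence of the lattices *)

Section LatticeClasses.
Variables (F : fieldType) (v : F -> int) (p : F).
Hypothesis hv : normalized_discrete_valuation v.
Hypothesis hp : uniformizer (valuation_ring v) p.
Variables (L : fieldExtType F) (x : L) (cs cu : {additive L -> F}) (t n : F).
Hypothesis hr : ramified_coords v x p cs cu t n.
Local Notation V := (val_geq v).
Local Notation X := (exact_val v).
Local Notation o := (valuation_ring v).
Local Notation E := (F * L)%type.
Local Notation d := (@diag F L).
Let hq := rc_coords hr.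

Let p0 : p != 0. Proof. by case: (uniformizer_val hv hp). Qed.

Local Notation lat := (lat v cs cu).

Lemma lat_kernel k al be a : V 0 a -> lat k al be (a, 0).
Proof.
by move=> ha; split; rewrite /= ?(raddf0 cs) ?(raddf0 cu) ?mul0r ?subr0 //; left.
Qed.

Lemma lat_gen1 k al be : lat k al be (al, 1).
Proof.
split; rewrite /= ?(cs1 hq) ?(cu1 hq); [exact: V1|by left|].
by rewrite mul1r mul0r subr0 subrr; left.
Qed.

Lemma lat_gen2 k al be : lat k al be (p ^ k%:Z * be, (p ^ k%:Z)%:A * x).
Proof.
split; rewrite /= ?(csAM hq) ?(cuAM hq) (csx hq, cux hq) ?(cux hq) ?mulr0 ?mulr1.
- by left.
- exact/(V_pZ hv hp).
- by rewrite mul0r subr0 subrr; left.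
Qed.

Lemma lat_decomposition (k : nat) (al be : F) (e : E) :
  e = d (e.1 - cs e.2 * al - cu e.2 * be) * (1, 0) + d (cs e.2) * (al, 1)
      + d (p ^ (- k%:Z) * cu e.2) * (p ^ k%:Z * be, (p ^ k%:Z)%:A * x).
Proof.
have pE y : p ^ (- k%:Z) * y * p ^ k%:Z = y.
  by rewrite mulrAC -expfzDr // addNr expr0z mul1r.
case: e => a z; rewrite /diag; congr pair => /=.
  by rewrite [_ * (_ * be)]mulrA pE; ring.
by rewrite mulr0 add0r mulr1 mulrA -algM pE -(coordsE hq).
Qed.

Section Order.
Variables (R : set E) (b f1 C : nat) (kap : F).
Hypothesis hR : is_order o R.
Hypothesis hop : order_params v cs cu R b f1 C kap.

(** These conditions say that (p^f1, 0) and p^b (kap, x) map the generators (al, 1) and p^k (be, x)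
    into the lattice. *)
Definition lat_condition (k : nat) (al be : F) : Prop :=
  [/\ (k <= b)%N, V (- f1%:Z) al, V (- f1%:Z - k%:Z) be, V (- b%:Z) (kap * al - be)
    & V (- b%:Z - k%:Z) (kap * be - n * al - t * be)].

Lemma submodule_lat k al be : submodule R (lat k al be) -> lat_condition k al be.
Proof.
move=> /submodule_closed[_ _ _ MZ].
have Rf : R (p ^ f1%:Z, 0).
  rewrite (op_def hop); split; rewrite /= ?(raddf0 cs) ?(raddf0 cu); [by left|by left|].
  by rewrite mul0r !subr0; exact/(V_pZ hv hp).
have Rb : R (p ^ b%:Z * kap, (p ^ b%:Z)%:A * x).
  rewrite (op_def hop); split; rewrite /= ?(csAM hq) ?(cuAM hq) ?(csx hq) ?(cux hq) ?mulr0 ?mulr1.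
  - by left.
  - exact/(V_pZ hv hp).
  - by rewrite subr0 subrr; left.
have g1 := lat_gen1 k al be; have g2 := lat_gen2 k al be.
have [_ _ /=] := MZ _ _ Rf g1.
rewrite mul0r (raddf0 cs) (raddf0 cu) !mul0r !subr0 => /(V_pZM hv hp) h1.
have [_ _ /=] := MZ _ _ Rf g2.
rewrite mul0r (raddf0 cs) (raddf0 cu) !mul0r !subr0.
move=> /(V_pZM hv hp)/(V_pZM hv hp) h2.
have [_ /=] := MZ _ _ Rb g1.
rewrite mulr1 (csAM hq) (cuAM hq) (csx hq) (cux hq) mulr1 mulr0 mul0r subr0.
move=> /(V_pZ hv hp) kb; rewrite -mulrA -mulrBr => /(V_pZM hv hp) h3.
have [_ _] := MZ _ _ Rb g2; rewrite /=.
have -> : p ^ b%:Z * kap * (p ^ k%:Z * be) - cs ((p ^ b%:Z)%:A * x * ((p ^ k%:Z)%:A * x)) * al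
    - cu ((p ^ b%:Z)%:A * x * ((p ^ k%:Z)%:A * x)) * be
    = p ^ b%:Z * (p ^ k%:Z * (kap * be - n * al - t * be)).
  rewrite !(csM hq, cuM hq, csA hq, cuA hq, csx hq, cux hq); ring.
move=> /(V_pZM hv hp)/(V_pZM hv hp) h4.
split.
- by rewrite -lez_nat.
- by move: h1; rewrite sub0r.
- by move: h2; rewrite sub0r.
- by move: h3; rewrite sub0r.
- by move: h4; rewrite sub0r.
Qed.

Lemma lat_submodule k al be : lat_condition k al be -> submodule R (lat k al be).
Proof.
move=> [kb hal hbe h3 h4]; split.
  split; first by apply/mem_set; split; rewrite /= ?(raddf0 cs) ?(raddf0 cu) ?mul0r ?subr0 //; left.
  move=> e f /set_mem[h1 h2 h5] /set_mem[k1 k2 k3]; apply/mem_set.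
  split; rewrite /= ?raddfB; try exact: (VB hv).
  by have := VB hv h5 k3; congr V; rewrite /=; ring.
move=> r e Rr [s' u' de].
have /(mem_maximal_order hr)[Vr _ _] := order_subset hv hp hr hR Rr.
move: Rr; rewrite (op_def hop) => -[s u ep].
have Vn := (rc_n hr).1; have Vt := rc_t hr.
split; rewrite /= ?(csM hq) ?(cuM hq).
- apply: (VD hv); first exact: (VMl hv).
  by apply: V_le (VM hv Vn (VM hv u u')); lia.
- apply: (VD hv); first apply: (VD hv).
  + exact: (VMl hv).
  + by apply: V_le (VM hv u s'); lia.
  + by apply: V_le (VM hv Vt (VM hv u u')); lia.
set a := r.1 in Vr ep *; set a' := e.1 in de *.
set S := cs r.2 in s ep *; set S' := cs e.2 in s' de *.
set U := cu r.2 in u ep *; set U' := cu e.2 in u' de *.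
(* The product is expanded around the defining congruences of [e] and [r]; the two remaining terms
   are those of the last two conditions. *)
have -> : a * a' - (S * S' + n * (U * U')) * al - (S * U' + U * S' + t * (U * U')) * be
  = a * (a' - S' * al - U' * be) + (a - S - U * kap) * (S' * al + U' * be)
    + U * S' * (kap * al - be) + U * U' * (kap * be - n * al - t * be) by ring.
apply: (VD hv); first apply: (VD hv); first apply: (VD hv).
- exact: (VMl hv).
- rewrite mulrDr; apply: (VD hv).
    by apply: V_le (VM hv ep (VM hv s' hal)); lia.
  by apply: V_le (VM hv ep (VM hv u' hbe)); lia.
- by apply: V_le (VM hv (VM hv u s') h3); lia.
- by apply: V_le (VM hv (VM hv u u') h4); lia.
Qed.

Lemma lat_fractional k al be : lat_condition k al be -> fractional_ideal R (lat k al be).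
Proof.
move=> /lat_submodule sM; have [_ dR _ _] := hR; split=> //; last first.
  apply/seteqP; split=> // e _.
  exists 3%N, (fun i : 'I_3 => nth 0 [:: d (e.1 - cs e.2 * al - cu e.2 * be); d (cs e.2);
    d (p ^ (- k%:Z) * cu e.2)] i),
    (fun i : 'I_3 => nth 0 [:: (1, 0); (al, 1); (p ^ k%:Z * be, (p ^ k%:Z)%:A * x)] i).
  split.
  - by case=> [[|[|[|]]] //= _]; [exists (e.1 - cs e.2 * al - cu e.2 * be)
      |exists (cs e.2)|exists (p ^ (- k%:Z) * cu e.2)].
  - case=> [[|[|[|]]] //= _]; [exact/lat_kernel/V1|exact: lat_gen1|exact: lat_gen2].
  - by rewrite !big_ord_recl big_ord0 /= addr0 addrA -lat_decomposition.
exists [:: (1, 0); (al, 1); (p ^ k%:Z * be, (p ^ k%:Z)%:A * x)].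
apply/seteqP; split=> [e [h1 h2 h3]|e [m [r [g [Rr hg ->]]]]]; last first.
  have sMo := submodule_restrict dR sM.
  apply: submodule_sum sMo _ => i; have [_ _ _ MZ] := submodule_closed sM.
  apply: MZ => //; move: (hg i) => /=; rewrite !inE => /or3P[/eqP->|/eqP->|/eqP->].
  - exact/lat_kernel/V1.
  - exact: lat_gen1.
  - exact: lat_gen2.
exists 3%N, (fun i : 'I_3 => nth 0 [:: d (e.1 - cs e.2 * al - cu e.2 * be); d (cs e.2);
    d (p ^ (- k%:Z) * cu e.2)] i),
    (fun i : 'I_3 => nth 0 [:: (1, 0); (al, 1); (p ^ k%:Z * be, (p ^ k%:Z)%:A * x)] i).
split.
- case=> [[|[|[|]]] //= _]; apply: dR.
  + by exists (e.1 - cs e.2 * al - cu e.2 * be).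
  + by exists (cs e.2).
  + by exists (p ^ (- k%:Z) * cu e.2) => //; apply/(V_pZM hv hp); rewrite sub0r opprK.
- by case=> [[|[|[|]]] //= _]; rewrite !inE eqxx ?orbT.
- by rewrite !big_ord_recl big_ord0 /= addr0 addrA -lat_decomposition.
Qed.

End Order.

(** The multiplier is (u, s + w x); the last two conditions place the images of (al, 1) and p^k (be,
    x) in the target lattice. *)
Definition lat_rel_by (k : nat) (u s w al be al' be' : F) : Prop :=
  [/\ X 0 u, X 0 s, V k w, V 0 (u * al - (s * al' + w * be'))
    & V (- k%:Z) (u * be - (n * w * al' + (s + t * w) * be'))].

Lemma exact_norm_form s w : X 0 s -> V 0 w -> X 0 (s ^+ 2 + s * t * w - n * w ^+ 2).
Proof.
move=> hs hw; rewrite -addrA; apply: (exactD hv).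
  by have := exactM hv hs hs; rewrite -expr2.
apply: (VB hv).
  by rewrite mulrAC; apply: V_le (VM hv (VM hv hs.1 hw) (rc_t hr)); lia.
by apply: V_le (VM hv (rc_n hr).1 (VM hv hw hw)); lia.
Qed.

Lemma lat_rel_sym k u s w al be al' be' : lat_rel_by k u s w al be al' be' ->
  let N := s ^+ 2 + s * t * w - n * w ^+ 2 in
  lat_rel_by k u^-1 ((s + t * w) / N) (- w / N) al' be' al be.
Proof.
move=> [hu hs hw h1 h2] N.
have w0 : V 0 w by apply: V_le hw; lia.
have XN : X 0 N by exact: exact_norm_form.
have N0 := exact_neq0 XN; have u0 := exact_neq0 hu.
have Xst : X 0 (s + t * w).
  by apply: (exactD hv) => //; apply: V_le (VM hv (rc_t hr) w0); lia.
have NV := exactV hv XN; have uV := exactV hv hu; rewrite oppr0 in NV uV.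
have VuN : V 0 (u^-1 / N) by exact: (VMl hv uV.1 NV.1).
split=> //.
- by have := exactM hv Xst NV; rewrite addr0.
- by rewrite mulNr; apply: (VN hv); apply: (VMr hv) => //; exact: NV.1.
- have -> : u^-1 * al' - ((s + t * w) / N * al + - w / N * be) =
    - (u^-1 / N) * ((s + t * w) * (u * al - (s * al' + w * be'))
      - w * (u * be - (n * w * al' + (s + t * w) * be'))).
    by rewrite /N; field; rewrite -/N N0 u0.
  apply: (VMl hv); first exact: (VN hv).
  apply: (VB hv); first by apply: (VMl hv) => //; case: Xst.
  by have := VM hv hw h2; rewrite subrr.
- have -> : u^-1 * be' - (n * (- w / N) * al + ((s + t * w) / N + t * (- w / N)) * be) =
    - (u^-1 / N) * (s * (u * be - (n * w * al' + (s + t * w) * be'))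
      - n * w * (u * al - (s * al' + w * be'))).
    by rewrite /N; field; rewrite -/N N0 u0.
  apply: (VMl hv); first exact: (VN hv).
  apply: (VB hv); first by apply: (VMl hv) => //; case: hs.
  by apply: V_le (VM hv (VM hv (rc_n hr).1 hw) h1); lia.
Qed.

Lemma lat_rel_subset k u s w al be al' be' e : lat_rel_by k u s w al be al' be' ->
  lat k al be e -> lat k al' be' ((u, s%:A + w%:A * x) * e).
Proof.
move=> [hu hs hw h1 h2] [Vs Vu he].
have Vn := (rc_n hr).1; have Vt := rc_t hr.
split; rewrite /= ?(csM hq) ?(cuM hq) (cs_mk hq) (cu_mk hq).
- apply: (VD hv); first exact: (VMl hv hs.1).
  by apply: V_le (VM hv Vn (VM hv hw Vu)); lia.
- apply: (VD hv); first apply: (VD hv).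
  + exact: (VMl hv hs.1).
  + exact: (VMr hv).
  + by apply: V_le (VM hv Vt (VM hv hw Vu)); lia.
set a := e.1 in he *; set S := cs e.2 in Vs he *; set U := cu e.2 in Vu he *.
have -> : u * a - (s * S + n * (w * U)) * al' - (s * U + w * S + t * (w * U)) * be'
  = u * (a - S * al - U * be) + S * (u * al - (s * al' + w * be'))
   + U * (u * be - (n * w * al' + (s + t * w) * be')) by ring.
apply: (VD hv); first apply: (VD hv).
- exact: (VMl hv hu.1).
- exact: (VMl hv).
- by have := VM hv Vu h2; rewrite subrr.
Qed.

Lemma lat_rel_equiv k u s w al be al' be' : lat_rel_by k u s w al be al' be' ->
  ideal_equiv (lat k al be) (lat k al' be').
Proof.
move=> h; have [hu hs hw _ _] := h.
have w0 : V 0 w by apply: V_le hw; lia.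
have N0 := exact_neq0 (exact_norm_form hs w0).
pose U : E := (u, s%:A + w%:A * x).
have UU : U \is a GRing.unit.
  apply/unit_pairP; split; first exact: exact_neq0 hu.
  apply/eqP => /(congr1 cs); rewrite (cs_mk hq) raddf0 => s0.
  by move: (exact_neq0 hs); rewrite s0 eqxx.
exists U => //; apply/seteqP; split=> e; last first.
  by move=> [f /(lat_rel_subset h) ? <-].
move=> /(lat_rel_subset (lat_rel_sym h)) h'; apply/(scale_setP _ _ UU).
congr lat: h'; congr (_ * _); apply: (mulrI UU); rewrite mulrV //.
congr pair; rewrite /= ?mulfV ?(exact_neq0 hu) //.
apply: (coords_inj hq).
  by rewrite (csM hq) !(cs_mk hq) !(cu_mk hq) (cs1 hq); field.
by rewrite (cuM hq) !(cs_mk hq) !(cu_mk hq) (cu1 hq); field.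
Qed.

Lemma lat_equiv_rel k k' al be al' be' :
  ideal_equiv (lat k al be) (lat k' al' be') ->
  k = k' /\ exists u s w, lat_rel_by k u s w al be al' be'.
Proof.
move=> hE.
(* The inclusion is evaluated on the generators (1, 0), (A, 1) and p^j (B, x); this is applied to
   the multiplier and to its inverse. *)
have half j j' A B A' B' (U : E) : U \is a GRing.unit ->
    scale_set U (lat j A B) `<=` lat j' A' B' ->
  [/\ V 0 U.1, V 0 (cs U.2), V j' (cu U.2), V 0 (U.1 * A - (cs U.2 * A' + cu U.2 * B'))
   & V (j'%:Z - j%:Z) (cs U.2 + t * cu U.2)
     /\ V (- j%:Z) (U.1 * B - (n * cu U.2 * A' + (cs U.2 + t * cu U.2) * B'))].
  move=> UU sub.
  have [_ _] : lat j' A' B' (U * (1, 0)).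
    by apply: sub; exists (1, 0) => //; apply/lat_kernel/V1.
  rewrite /= mulr0 (raddf0 cs) (raddf0 cu) !mul0r !subr0 mulr1 => h1.
  have [] : lat j' A' B' (U * (A, 1)).
    by apply: sub; exists (A, 1) => //; apply: lat_gen1.
  rewrite /= mulr1 => h2 h3; rewrite -addrA -opprD => h4.
  have [_] : lat j' A' B' (U * (p ^ j%:Z * B, (p ^ j%:Z)%:A * x)).
    by apply: sub; exists (p ^ j%:Z * B, (p ^ j%:Z)%:A * x) => //; apply: lat_gen2.
  rewrite /=.
  have -> : cs (U.2 * ((p ^ j%:Z)%:A * x)) = p ^ j%:Z * (n * cu U.2).
    by rewrite !(csM hq, cuM hq, csA hq, cuA hq, csx hq, cux hq); ring.
  have -> : cu (U.2 * ((p ^ j%:Z)%:A * x)) = p ^ j%:Z * (cs U.2 + t * cu U.2).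
    by rewrite !(csM hq, cuM hq, csA hq, cuA hq, csx hq, cux hq); ring.
  move=> /(V_pZM hv hp) h5.
  have -> : U.1 * (p ^ j%:Z * B) - p ^ j%:Z * (n * cu U.2) * A' -
    p ^ j%:Z * (cs U.2 + t * cu U.2) * B' =
    p ^ j%:Z * (U.1 * B - (n * cu U.2 * A' + (cs U.2 + t * cu U.2) * B')) by ring.
  by move=> /(V_pZM hv hp); rewrite sub0r.
(* If [cs U.2] were in the maximal ideal, so would be the norm of [U.2]; but the norm of the inverse
   is integral and the product of the two is 1. *)
have unit_s (U : E) : U \is a GRing.unit -> V 0 (cs U.2) -> V 0 (cu U.2) ->
    V 0 (cs U^-1.2) -> V 0 (cu U^-1.2) -> X 0 (cs U.2).
  move=> UU a1 a2 a3 a4; split=> // a5; have [_ U20] := (unit_pairP U).1 UU.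
  have NV : V 0 (nm cs cu t n U^-1.2) by apply/(V_nm hv _ _ _ (rc_n hr) (rc_t hr)).
  have NU : V 1 (nm cs cu t n U.2).
    apply: (VB hv); first apply: (VD hv).
    - by apply: V_le (VM hv a5 a5).
    - by apply: V_le (VM hv (rc_t hr) (VM hv a1 a2)).
    - by apply: V_le (VM hv (rc_n hr).1 (VM hv a2 a2)).
  have : U * U^-1 = 1 by rewrite mulrV.
  move=> /(congr1 snd) /= U1; have := VM hv NU NV.
  rewrite -(nmM hq) U1 (nm1 hq) => /(exact_V _ (exact1 hv)); lia.
have [U UU UE] := hE; have UU' : U^-1 \is a GRing.unit by rewrite unitrV.
have sub1 : scale_set U (lat k al be) `<=` lat k' al' be' by rewrite UE.
have sub2 : scale_set U^-1 (lat k' al' be') `<=` lat k al be.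
  by rewrite UE scale_setM mulVr // scale_set1.
have [a1 a2 a3 a4 [a5 a6]] := half _ _ _ _ _ _ _ UU sub1.
have [c1 c2 c3 c4 [c5 c6]] := half _ _ _ _ _ _ _ UU' sub2.
have a30 : V 0 (cu U.2) by apply: V_le a3; lia.
have c30 : V 0 (cu U^-1.2) by apply: V_le c3; lia.
have Xs := unit_s _ UU a2 a30 c2 c30.
have Xs' : X 0 (cs U^-1.2) by apply: unit_s; rewrite ?invrK.
have Xst z : X 0 (cs z) -> V 0 (cu z) -> X 0 (cs z + t * cu z).
  by move=> h1 h2; apply: (exactD hv) => //; apply: V_le (VM hv (rc_t hr) h2); lia.
(* The unit s + t w lies in p^(k'-k) o, and its analogue for the inverse lies in p^(k-k') o. *)
have kk' : k = k'.
  have := (exact_V _ (Xst _ Xs a30)).1 a5.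
  by have := (exact_V _ (Xst _ Xs' c30)).1 c5; lia.
subst k'; split=> //; exists U.1, (cs U.2), (cu U.2); split=> //.
split=> // a7; have := VM hv a7 c1.
have : U * U^-1 = 1 by rewrite mulrV.
move=> /(congr1 fst) /= ->; move/(exact_V _ (exact1 hv)); lia.
Qed.

End LatticeClasses.

(** * Reduction to vertical lattices and slopes *)

Section NormalForms.
Variables (F : fieldType) (v : F -> int) (p : F).
Hypothesis hv : normalized_discrete_valuation v.
Hypothesis hp : uniformizer (valuation_ring v) p.
Variables (L : fieldExtType F) (x : L) (cs cu : {additive L -> F}) (t n : F).
Hypothesis hr : ramified_coords v x p cs cu t n.
Local Notation V := (val_geq v).
Local Notation X := (exact_val v).
Local Notation o := (valuation_ring v).
Local Notation E := (F * L)%type.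

Let p0 : p != 0. Proof. by case: (uniformizer_val hv hp). Qed.

Local Notation lat := (lat v cs cu).
Local Notation lat_rel_by := (lat_rel_by v t n).
Local Notation minpoly := (minpoly_at t n).

(** An integral [al] can be replaced by 0. Otherwise the slope be / al is kept when it lies in
    p^(1-k) o; when it does not, p^k be divides al and a unit s + w x with w in p^k o removes
    [al]. *)
Lemma lat_reduce (k : nat) al be :
  (exists j : nat, ideal_equiv (lat k al be) (lat k 0 (p ^ (- j%:Z - k%:Z)))) \/
  (exists a g, [/\ (0 < a)%N, V (1 - k%:Z) g &
     ideal_equiv (lat k al be) (lat k (p ^ (- a%:Z)) (p ^ (- a%:Z) * g))]).
Proof.
have X1 := exact1 hv.
have divX m y : X m y -> X 0 (p ^ m / y).
  by move=> h; have := exactM hv (exact_pZ hv hp m) (exactV hv h); rewrite subrr.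
have [Val|nVal] := pselect (V 0 al).
  left; have [Vbe|nVbe] := pselect (V (- k%:Z) be).
    (* As [be] matters only modulo p^(-k) o, the value j = 0 stands for every [be] in p^(-k) o. *)
    exists 0%N; apply: (lat_rel_equiv hv hp hr (u := 1) (s := 1) (w := 0)).
    split=> //; [by left|by rewrite mul1r mulr0 mul0r addr0 subr0|].
    rewrite mul1r !mulr0 ?mul0r add0r addr0 mul1r; apply: (VB hv) => //.
    by apply/(V_pZ hv hp); lia.
  have be0 : be != 0 by apply: contra_not_neq nVbe => ->; left.
  have vbe : v be < - k%:Z by rewrite ltNge; apply/negP => h; apply: nVbe; right.
  exists (absz (v be + k%:Z)).
  have -> : - (absz (v be + k%:Z))%:Z - k%:Z = v be by lia.
  have Xbe := exact_ex v be0.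
  apply: (lat_rel_equiv hv hp hr (u := p ^ v be / be) (s := 1) (w := 0)).
  split=> //; [exact: divX|by left| |].
    by rewrite mulr0 mul0r addr0 subr0; apply: (VMl hv) => //; case: (divX _ _ Xbe).
  by rewrite divfK // !mulr0 ?mul0r add0r addr0 mul1r subrr; left.
have al0 : al != 0 by apply: contra_not_neq nVal => ->; left.
have val : v al < 0 by rewrite ltNge; apply/negP => h; apply: nVal; right.
have Xal := exact_ex v al0.
have [Vbe|nVbe] := pselect (V (1 - k%:Z + v al) be).
  right; exists (absz (v al)), (be / al); split; first by lia.
    rewrite mulrC; apply: V_le (VM hv (exactV hv Xal).1 Vbe); lia.
  have -> : - (absz (v al))%:Z = v al by lia.
  apply: (lat_rel_equiv hv hp hr (u := p ^ v al / al) (s := 1) (w := 0)).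
  split=> //; [exact: divX|by left| |].
    by rewrite divfK // mul1r mul0r addr0 subrr; left.
  rewrite mulr0 !mul0r add0r mulr0 addr0 mul1r.
  by rewrite (_ : _ - _ = 0); [left|field].
(* Now v(be) <= v(al) - k, so w = al / p^(v be) lies in p^k o; with it w be' equals al for be' =
   p^(v be), and s is chosen so that s + t w = be / be'. *)
left; have be0 : be != 0 by apply: contra_not_neq nVbe => ->; left.
have vbe : v be < 1 - k%:Z + v al by rewrite ltNge; apply/negP => h; apply: nVbe; right.
have Xbe := exact_ex v be0.
exists (absz (v be + k%:Z)).
have -> : - (absz (v be + k%:Z))%:Z - k%:Z = v be by lia.
have pZ0 : p ^ v be != 0 by rewrite expfz_neq0.
have pV := exactV hv (exact_pZ hv hp (v be)).
have Vw : V k (al / p ^ v be).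
  by apply: V_le (VM hv Xal.1 pV.1); lia.
apply: (lat_rel_equiv hv hp hr (u := 1) (s := be / p ^ v be - t * (al / p ^ v be))
  (w := al / p ^ v be)).
split=> //.
- apply: (exactD hv).
    by have := exactM hv Xbe pV; rewrite subrr.
  by apply: (VN hv); apply: V_le (VM hv (rc_t hr) Vw); lia.
- by rewrite mul1r mulr0 add0r divfK // subrr; left.
- by rewrite mul1r mulr0 add0r subrK divfK // subrr; left.
Qed.

Section Order.
Variables (R : set E) (b f1 C : nat) (kap : F).
Hypothesis hop : order_params v cs cu R b f1 C kap.
Local Notation cond := (lat_condition v t n b f1 kap).

Lemma lat_condition1 (k j : nat) : cond k 0 (p ^ (- j%:Z - k%:Z)) <->
  [/\ (k <= b)%N, (j <= b - k)%N & (j <= C)%N].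
Proof.
rewrite /lat_condition !mulr0 subr0 sub0r.
have kt : kap * p ^ (- j%:Z - k%:Z) - t * p ^ (- j%:Z - k%:Z) =
  p ^ (- j%:Z - k%:Z) * (kap - t) by ring.
rewrite kt; split=> [[kb _ /(V_pZ hv hp) h1 /(VN hv)]|[kb jb jC]].
  rewrite opprK => /(V_pZ hv hp) h2 /(V_pZM hv hp) h3.
  split=> //; first by lia.
  rewrite leqNgt; apply/negP => Cj.
  have Cf : (C < f1)%N by lia.
  have Cb : (C < b.+1)%N by lia.
  have : V (j%:Z - b%:Z) kap.
    rewrite -[kap](subrK t); apply: (VD hv); first by apply: V_le h3; lia.
    by apply: V_le (rc_t hr); lia.
  by move=> /(exact_V _ (op_XC hop Cf Cb)); lia.
have Cf1 := op_Cf1 hop.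
split=> //; first by left.
- by apply/(V_pZ hv hp); lia.
- by apply/(VN hv)/(V_pZ hv hp); lia.
- apply/(V_pZM hv hp); apply: (VB hv); first by apply: V_le (op_VC hop); lia.
  by apply: V_le (rc_t hr); lia.
Qed.

Lemma lat_condition2 (k a : nat) g : V (1 - k%:Z) g ->
  cond k (p ^ (- a%:Z)) (p ^ (- a%:Z) * g) <->
  [/\ (k <= b)%N, (a <= f1)%N, V (a%:Z - b%:Z) (kap - g)
    & V (a%:Z - b%:Z - k%:Z) (minpoly g)].
Proof.
move=> Vg; rewrite /lat_condition /minpoly_at.
have -> : kap * p ^ (- a%:Z) - p ^ (- a%:Z) * g = p ^ (- a%:Z) * (kap - g) by ring.
(* This isolates [minpoly g]: the product (kap - g) g is already controlled by the previous
   condition and the bound on g. *)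
have -> : kap * (p ^ (- a%:Z) * g) - n * p ^ (- a%:Z) - t * (p ^ (- a%:Z) * g)
  = p ^ (- a%:Z) * ((kap - g) * g + minpoly g) by rewrite /minpoly_at; ring.
rewrite -/(minpoly_at t n g).
have Vgk : V (a%:Z - b%:Z) (kap - g) -> V (a%:Z - b%:Z - k%:Z) ((kap - g) * g).
  by move=> h; apply: V_le (VM hv h Vg); lia.
split=> [[kb /(V_pZ hv hp) h1 _ /(V_pZM hv hp) h3 /(V_pZM hv hp) h4]|[kb h1 h2 h3]].
  have h5 : V (a%:Z - b%:Z) (kap - g) by apply: V_le h3; lia.
  split=> //; first by lia.
  have -> : minpoly g = ((kap - g) * g + minpoly g) - (kap - g) * g by ring.
  by apply: (VB hv); [apply: V_le h4; lia|exact: Vgk].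
split=> //.
- by apply/(V_pZ hv hp); lia.
- by apply/(V_pZM hv hp); apply: V_le Vg; lia.
- by apply/(V_pZM hv hp); apply: V_le h2; lia.
- apply/(V_pZM hv hp); apply: (VD hv).
    by apply: V_le (Vgk h2); lia.
  by apply: V_le h3; lia.
Qed.

End Order.

Lemma lat_rel11 (k j j' : nat) u s w :
  lat_rel_by k u s w 0 (p ^ (- j%:Z - k%:Z)) 0 (p ^ (- j'%:Z - k%:Z)) -> j = j'.
Proof.
move=> [hu hs hw _]; rewrite mulr0 add0r => h.
have w0 : V 0 w by apply: V_le hw; lia.
have Xst : X 0 (s + t * w).
  by apply: (exactD hv) => //; apply: V_le (VM hv (rc_t hr) w0); lia.
have X1 := exactM hv hu (exact_pZ hv hp (- j%:Z - k%:Z)).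
have X2 := exactM hv Xst (exact_pZ hv hp (- j'%:Z - k%:Z)).
case: (ltnP 0 j) => j0; first by have := exact_eq hv X1 X2 h; lia.
case: (ltnP 0 j') => j0'; last by lia.
by have := exact_eq hv X2 X1 (l := - k%:Z); rewrite -opprB; move=> /(_ (VN hv h)); lia.
Qed.

(** The bound on [g] makes w g an element of the maximal ideal, so s + w g is a unit and the pole of
    order a cannot disappear. *)
Lemma lat_rel12 (k j a : nat) g u s w : (0 < a)%N -> V (1 - k%:Z) g ->
  ~ lat_rel_by k u s w 0 (p ^ (- j%:Z - k%:Z)) (p ^ (- a%:Z)) (p ^ (- a%:Z) * g).
Proof.
move=> a0 Vg [hu hs hw h _].
have : X (0 + - a%:Z) ((s + w * g) * p ^ (- a%:Z)).
  apply: (exactM hv); last exact: exact_pZ.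
  by apply: (exactD hv) => //; apply: V_le (VM hv hw Vg); lia.
move=> /(exact_V 0)[+ _].
have -> : (s + w * g) * p ^ (- a%:Z) = - (u * 0 - (s * p ^ (- a%:Z) + w * (p ^ (- a%:Z) * g))).
  by ring.
by move/(_ (VN hv h)); lia.
Qed.

(** The unit s + w x relates slopes by g = (n w + (s + t w) g') / (s + w g') = g' - w / (s + w g') *
    minpoly g'; the unit denominator is absorbed into [w]. As be = p^(-a) g counts modulo p^(-k) o,
    g counts modulo p^(a-k) o. *)
Definition slope_rel (k a : nat) g g' :=
  exists2 w, V k w & V (a%:Z - k%:Z) (g - g' + w * minpoly g').

Lemma lat_rel22 (k a a' : nat) g g' u s w : (0 < a)%N -> (0 < a')%N ->
  V (1 - k%:Z) g -> V (1 - k%:Z) g' ->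
  lat_rel_by k u s w (p ^ (- a%:Z)) (p ^ (- a%:Z) * g)
     (p ^ (- a'%:Z)) (p ^ (- a'%:Z) * g') ->
  a = a' /\ slope_rel k a g g'.
Proof.
move=> a0 a0' Vg Vg' [hu hs hw h1 h2].
have XS : X 0 (s + w * g').
  by apply: (exactD hv) => //; apply: V_le (VM hv hw Vg'); lia.
have aa : a = a'.
  have := exact_eq hv (exactM hv hu (exact_pZ hv hp (- a%:Z)))
    (exactM hv XS (exact_pZ hv hp (- a'%:Z))) (l := 0).
  have -> : u * p ^ (- a%:Z) - (s + w * g') * p ^ (- a'%:Z) =
    u * p ^ (- a%:Z) - (s * p ^ (- a'%:Z) + w * (p ^ (- a'%:Z) * g')) by ring.
  by move/(_ h1); lia.
subst a'; split=> //.
have {}h1 : V a (u - (s + w * g')).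
  move: h1; have -> : u * p ^ (- a%:Z) - (s * p ^ (- a%:Z) + w * (p ^ (- a%:Z) * g'))
    = p ^ (- a%:Z) * (u - (s + w * g')) by ring.
  by move/(V_pZM hv hp); congr V; lia.
have {}h2 : V (a%:Z - k%:Z) (u * g - (n * w + (s + t * w) * g')).
  move: h2; have -> : u * (p ^ (- a%:Z) * g) -
      (n * w * p ^ (- a%:Z) + (s + t * w) * (p ^ (- a%:Z) * g'))
    = p ^ (- a%:Z) * (u * g - (n * w + (s + t * w) * g')) by ring.
  by move/(V_pZM hv hp); congr V; lia.
have SV := exactV hv XS; rewrite oppr0 in SV.
exists (w / (s + w * g')); first by apply: (VMr hv) => //; case: SV.
have -> : g - g' + w / (s + w * g') * minpoly g' =
   (s + w * g')^-1 * ((u * g - (n * w + (s + t * w) * g')) - (u - (s + w * g')) * g).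
  by rewrite /minpoly_at; field; exact: (exact_neq0 XS).
apply: (VMl hv); first by case: SV.
by apply: (VB hv) => //; apply: V_le (VM hv h1 Vg); lia.
Qed.

Lemma slope_rel_equiv (k a : nat) g g' : V (1 - k%:Z) g' -> slope_rel k a g g' ->
  ideal_equiv (lat k (p ^ (- a%:Z)) (p ^ (- a%:Z) * g))
    (lat k (p ^ (- a%:Z)) (p ^ (- a%:Z) * g')).
Proof.
move=> Vg' [w hw h].
(* This [s] normalizes the denominator s + w g' to 1. *)
apply: (lat_rel_equiv hv hp hr (u := 1) (s := 1 - w * g') (w := w)); split=> //.
- exact: exact1.
- apply: (exactD hv); first exact: exact1.
  by apply: (VN hv); apply: V_le (VM hv hw Vg'); lia.
- by rewrite (_ : _ - _ = 0); [left|ring].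
- have -> : 1 * (p ^ (- a%:Z) * g) -
      (n * w * p ^ (- a%:Z) + (1 - w * g' + t * w) * (p ^ (- a%:Z) * g'))
    = p ^ (- a%:Z) * (g - g' + w * minpoly g') by rewrite /minpoly_at; ring.
  by apply/(V_pZM hv hp); apply: V_le h; lia.
Qed.

End NormalForms.

(** * Systems of representatives *)

Section NumClasses.

(** Counting by representatives allows a relation such as [slope_rel] to be treated without first
    showing that it is an equivalence. *)
Definition num_classes (T : Type) (P : T -> Prop) (E : T -> T -> Prop) (m : nat) : Prop :=
  exists r : 'I_m -> T, [/\ forall i, P (r i), forall i j, E (r i) (r j) -> i = j
    & forall x, P x -> exists i, E x (r i)].

Lemma num_classes_map (T T' : Type) (P : T -> Prop) E (P' : T' -> Prop) E' m (f : T -> T') :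
  num_classes P E m -> (forall x, P x -> P' (f x)) ->
  (forall x y, P x -> P y -> E' (f x) (f y) -> E x y) ->
  (forall x', P' x' -> exists2 x, P x & forall y, P y -> E x y -> E' x' (f y)) ->
  num_classes P' E' m.
Proof.
move=> [r [rP rE rC]] fP fE fC; exists (f \o r); split=> /=.
- by move=> i; exact: fP.
- by move=> i j /fE h; apply: rE; exact: h.
- by move=> x' /fC[x /rC[i xi] h]; exists i; exact: h.
Qed.

Lemma num_classes_iff (T : Type) (P P' : T -> Prop) (E E' : T -> T -> Prop) m :
  (forall x, P x <-> P' x) -> (forall x y, P x -> P y -> (E x y <-> E' x y)) ->
  num_classes P E m -> num_classes P' E' m.
Proof.
move=> PP EE h; apply: (@num_classes_map _ _ _ _ _ _ _ id h).
- by move=> x /PP.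
- by move=> x y Px Py /EE; exact.
- by move=> x /PP Px; exists x => // y Py /EE; exact.
Qed.

Lemma num_classes0 (T : Type) (P : T -> Prop) E :
  (forall x, ~ P x) -> num_classes P E 0.
Proof.
move=> h; exists (fun i : 'I_0 => match notF (ltn_ord i) with end).
by split=> [[]|[]|x /h].
Qed.

Lemma num_classes1 (T : Type) (P : T -> Prop) E x0 :
  P x0 -> (forall x, P x -> E x x0) -> num_classes P E 1.
Proof.
move=> h1 h2; exists (fun=> x0); split=> // [i j _|x Px]; first by rewrite !ord1.
by exists ord0; exact: h2.
Qed.

Lemma num_classesU (T : Type) (P1 P2 : T -> Prop) E m1 m2 :
  num_classes P1 E m1 -> num_classes P2 E m2 ->
  (forall x y, P1 x -> P2 y -> ~ E x y /\ ~ E y x) ->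
  num_classes (fun x => P1 x \/ P2 x) E (m1 + m2).
Proof.
move=> [r1 [P1r E1 C1]] [r2 [P2r E2 C2]] dis.
exists (fun i => match fintype.split i with inl i => r1 i | inr i => r2 i end); split.
- by move=> i; case: fintype.split => j; [left|right].
- move=> i j; rewrite -[i]splitK -[j]splitK.
  case: (fintype.split i) (fintype.split j) => i' [] j'; rewrite !unsplitK.
  + by move=> /E1 ->.
  + by have [] := dis (r1 i') (r2 j').
  + by have [] := dis (r1 j') (r2 i').
  + by move=> /E2 ->.
- move=> x [/C1[i xi]|/C2[i xi]].
    by exists (unsplit (inl i)); rewrite unsplitK.
  by exists (unsplit (inr i)); rewrite unsplitK.
Qed.

Lemma num_classes_sum (T : Type) (P : nat -> T -> Prop) E (m : nat -> nat) (l h : nat) :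
  (forall i, (l <= i < h)%N -> num_classes (P i) E (m i)) ->
  (forall i j x y, (l <= i < h)%N -> (l <= j < h)%N -> P i x -> P j y -> E x y -> i = j) ->
  num_classes (fun x => exists2 i, (l <= i < h)%N & P i x) E (\sum_(l <= i < h) m i).
Proof.
elim: h => [|h IH] hm dis.
  by rewrite big_geq //; apply: num_classes0 => x [i]; lia.
have [lh|hl] := leqP l h; last first.
  by rewrite big_geq //; apply: num_classes0 => x [i]; lia.
rewrite big_nat_recr //=.
have := num_classesU (IH _ _) (hm h _).
set Q := fun x => _ \/ _; move=> hQ.
apply: (num_classes_iff (P := Q) (E := E)) => //.
  move=> x; split=> [[[i hi Pi]|Ph]|[i hi Pi]].
  - by exists i => //; lia.
  - by exists h => //; lia.
  - move: Pi; have [->|ih] := eqVneq i h => Pi; first by right.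
    by left; exists i => //; lia.
apply: hQ; [|by move=> i j x y hi hj; apply: dis; lia|by lia|].
  by move=> i hi; apply: hm; lia.
move=> x y [i hi Px] Py; split=> hE.
  by have := dis i h x y _ _ Px Py hE; lia.
by have := dis h i y x _ _ Py Px hE; lia.
Qed.

Lemma num_classes_card (F : fieldType) (L : fieldExtType F) (R : set (F * L)) m :
  num_classes (fractional_ideal R) (@ideal_equiv F L) m -> Cl_bar R #= `I_m.
Proof.
move=> [r [rP rE rC]].
pose f i : set (set (F * L)) :=
  if insub i is Some j then ideal_class R (r j) else set0.
have fE (i : 'I_m) : f i = ideal_class R (r i) by rewrite /f valK.
have self I : fractional_ideal R I -> ideal_class R I I.
  by move=> hI; split=> //; exact: ideal_equiv_refl.
have clE I J : fractional_ideal R J ->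
    ideal_class R I = ideal_class R J <-> ideal_equiv I J.
  move=> hJ; split=> [e|e].
    by have [] : ideal_class R I J by rewrite e; exact: self.
  apply/seteqP; split=> K [hK hIK]; split=> //.
    exact: (ideal_equiv_trans (ideal_equiv_sym e)).
  exact: (ideal_equiv_trans e).
have -> : Cl_bar R = f @` `I_m.
  apply/seteqP; split=> [_ [I hI <-]|_ [i im <-]].
    have [i Ii] := rC I hI; exists (i : nat); first exact: ltn_ord.
    by rewrite fE; apply/esym/clE.
  rewrite (fE (Ordinal im)); exists (r (Ordinal im)) => //.
apply: inj_card_eq => i j /set_mem im /set_mem jm.
rewrite (fE (Ordinal im)) (fE (Ordinal jm)) => /clE h.
by have /(congr1 val) := rE _ _ (h (rP _)).
Qed.

End NumClasses.

(** * Residue classes in balls and spheres *)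

Section Residues.
Variables (F : fieldType) (v : F -> int) (p : F) (q : nat).
Hypothesis hv : normalized_discrete_valuation v.
Hypothesis hp : uniformizer (valuation_ring v) p.
Hypothesis hF : residue_field (valuation_ring v) #= `I_q.
Local Notation V := (val_geq v).
Local Notation X := (exact_val v).
Local Notation o := (valuation_ring v).

Lemma residue_reps : exists rho : nat -> F,
  [/\ forall i, (i < q)%N -> V 0 (rho i),
      forall i j, (i < q)%N -> (j < q)%N -> V 1 (rho i - rho j) -> i = j
    & forall y, V 0 y -> exists2 i, (i < q)%N & V 1 (y - rho i)].
Proof.
have nonE y : nonunits o y <-> V 1 y.
  rewrite hp; split=> [[a oa <-]|Vy]; first by apply/(V_Mp hv hp).
  have p0 : p != 0 by case: (uniformizer_val hv hp).
  have e : p * (y / p) = y by rewrite mulrC divfK.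
  by exists (y / p) => //; move: Vy; rewrite -{1}e => /(V_Mp hv hp); rewrite subrr.
pose cos a := [set a + m | m in nonunits o].
have cosE a y : cos a y <-> V 1 (y - a).
  split=> [[m /nonE hm <-]|/nonE hm]; first by rewrite addrC addKr.
  by exists (y - a) => //; rewrite subrKC.
have /card_set_bijP[f [fI finj fsurj]] := hF.
have ex (i : nat) : exists a, (i < q)%N -> V 0 a /\ f (cos a) = i.
  have [iq|_] := ltnP i q; last by exists 0.
  by have [_ [a oa <-] fa] := fsurj i iq; exists a.
have [rho hrho] := choice ex.
exists rho; split=> [i /hrho[]//|i j iq jq Vij|y Vy].
  have [Vi fi] := hrho i iq; have [Vj fj] := hrho j jq.
  rewrite -fi -fj; congr f; apply/seteqP; split=> y /cosE h; apply/cosE.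
    by have := VD hv h Vij; rewrite addrA subrK.
  by have := VB hv h Vij; rewrite opprB addrA subrK.
have yR : residue_field o (cos y) by exists y.
have iq := fI _ yR; exists (f (cos y)) => //.
have [Vr fr] := hrho _ iq.
have : cos (rho (f (cos y))) = cos y.
  by apply: finj => //; apply/mem_set => //; exists (rho (f (cos y))).
move=> e; apply/cosE; rewrite e; apply/cosE; rewrite subrr; exact: V0.
Qed.

(** Induction on the number of digits: y = rho i + p z, with q choices for the leading digit. *)
Lemma num_classes_mod (m : nat) :
  num_classes (V 0) (fun y z => V m%:Z (y - z)) (q ^ m).
Proof.
have [rho [rho0 rhoI rhoC]] := residue_reps.
elim: m => [|m IH].
  apply: (num_classes1 (x0 := 0)) => [|y Vy]; [by left|by rewrite subr0].
have -> : (q ^ m.+1 = \sum_(0 <= i < q) q ^ m)%N by rewrite sum_nat_const_nat subn0 expnS.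
have S := @num_classes_sum _ (fun i y => V 0 y /\ V 1 (y - rho i))
  (fun y z => V m.+1%:Z (y - z)) (fun=> q ^ m)%N 0 q.
apply: (num_classes_iff _ _ (S _ _)) => //.
- move=> y; split=> [[i _ []]//|Vy]; have [i iq h] := rhoC y Vy.
  by exists i.
- move=> i /= iq; apply: (num_classes_map (f := fun z => rho i + p * z) IH).
  + move=> z Vz; split; last by rewrite addrC addKr; exact/(V_Mp hv hp).
    apply: (VD hv); first exact: rho0.
    by apply: (@V_le _ _ 1) => //; exact/(V_Mp hv hp).
  + move=> y z _ _; rewrite opprD addrACA subrr add0r -mulrBr => /(V_Mp hv hp).
    by congr V; lia.
  + move=> y [Vy hy]; have p0 : p != 0 by case: (uniformizer_val hv hp).
    have e : y - rho i = p * ((y - rho i) / p) by rewrite mulrC divfK.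
    exists ((y - rho i) / p).
      by move: hy; rewrite {1}e => /(V_Mp hv hp); rewrite subrr.
    move=> z Vz h; rewrite opprD addrA {1}e -mulrBr; apply/(V_Mp hv hp).
    by move: h; congr V; lia.
- move=> i j y z /= iq jq [Vy hy] [Vz hz] hyz.
  apply: rhoI => //; have h : V 1 (y - z) by apply: V_le hyz; lia.
  have -> : rho i - rho j = (y - z) + (z - rho j) - (y - rho i) by ring.
  by apply: (VB hv) => //; apply: (VD hv).
Qed.

Lemma num_classes_units (m : nat) : (0 < m)%N ->
  num_classes (X 0) (fun y z => V m%:Z (y - z)) (q ^ m - q ^ m.-1).
Proof.
case: m => // m _; have [rho [rho0 rhoI rhoC]] := residue_reps.
(* The digit [i0] represents the residue class 0; the units are the elements with another leading
   digit. *)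
have [i0 i0q hi0] := rhoC 0 (V0 v 0).
have -> : (q ^ m.+1 - q ^ m.+1.-1 = \sum_(0 <= i < q) if i == i0 then 0 else q ^ m)%N.
  rewrite big_mkord (bigD1 (Ordinal i0q)) //= eqxx add0n.
  rewrite (eq_bigr (fun=> q ^ m)%N); last first.
    by move=> i; rewrite -val_eqE /= => /negPf ->.
  by rewrite sum_nat_const cardC1 card_ord expnS -{2}[(q ^ m)%N]mul1n -mulnBl subn1.
have S := @num_classes_sum _ (fun i y => X 0 y /\ V 1 (y - rho i))
  (fun y z => V m.+1%:Z (y - z)) (fun i => if i == i0 then 0 else q ^ m)%N 0 q.
have Vri0 : V 1 (rho i0) by move: (VN hv hi0); rewrite sub0r opprK.
apply: (num_classes_iff _ _ (S _ _)) => //.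
- move=> y; split=> [[i _ []]//|Vy]; have [i iq h] := rhoC y Vy.1.
  by exists i.
- move=> i /= iq; case: eqVneq => [->|ii0].
    apply: num_classes0 => y [[_ h] hy]; apply: h.
    by rewrite -[y](subrK (rho i0)); apply: (VD hv).
  have Xr : X 0 (rho i).
    split; first exact: rho0.
    move=> h; move/negP: ii0; apply; apply/eqP; apply: rhoI => //.
    by apply: (VB hv).
  apply: (num_classes_map (f := fun z => rho i + p * z) (num_classes_mod m)).
  + move=> z Vz; split; last by rewrite addrC addKr; exact/(V_Mp hv hp).
    by apply: (exactD hv) => //; exact/(V_Mp hv hp).
  + move=> y z _ _; rewrite opprD addrACA subrr add0r -mulrBr => /(V_Mp hv hp).
    by congr V; lia.
  + move=> y [Vy hy]; have p0 : p != 0 by case: (uniformizer_val hv hp).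
    have e : y - rho i = p * ((y - rho i) / p) by rewrite mulrC divfK.
    exists ((y - rho i) / p).
      by move: hy; rewrite {1}e => /(V_Mp hv hp); rewrite subrr.
    move=> z Vz h; rewrite opprD addrA {1}e -mulrBr; apply/(V_Mp hv hp).
    by move: h; congr V; lia.
- move=> i j y z /= iq jq [Vy hy] [Vz hz] hyz.
  apply: rhoI => //; have h : V 1 (y - z) by apply: V_le hyz; lia.
  have -> : rho i - rho j = (y - z) + (z - rho j) - (y - rho i) by ring.
  by apply: (VB hv) => //; apply: (VD hv).
Qed.

Lemma num_classes_ball (c : F) (A M : int) (e : nat) : A + e%:Z = M ->
  num_classes (fun y => V A (y - c)) (fun y z => V M (y - z)) (q ^ e).
Proof.
move=> AM; have p0 : p != 0 by case: (uniformizer_val hv hp).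
have eq y : c + p ^ A * (p ^ (- A) * (y - c)) = y.
  by rewrite mulrA -expfzDr // subrr expr0z mul1r subrKC.
have sub y z : c + p ^ A * y - (c + p ^ A * z) = p ^ A * (y - z) by ring.
apply: (num_classes_map (f := fun z => c + p ^ A * z) (num_classes_mod e)).
- by move=> y Vy; rewrite addrC addKr; apply/(V_pZM hv hp); rewrite subrr.
- by move=> y z _ _; rewrite sub => /(V_pZM hv hp); congr V; lia.
- move=> y Vy; exists (p ^ (- A) * (y - c)).
    by apply/(V_pZM hv hp); rewrite sub0r opprK.
  move=> z _ h; rewrite -{1}(eq y) sub; apply/(V_pZM hv hp).
  by move: h; congr V; lia.
Qed.

Lemma num_classes_sphere (A M : int) (e : nat) : (0 < e)%N -> A + e%:Z = M ->
  num_classes (X A) (fun y z => V M (y - z)) (q ^ e - q ^ e.-1).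
Proof.
move=> e0 AM; have p0 : p != 0 by case: (uniformizer_val hv hp).
have eq y : p ^ A * (p ^ (- A) * y) = y.
  by rewrite mulrA -expfzDr // subrr expr0z mul1r.
apply: (num_classes_map (f := fun z => p ^ A * z) (num_classes_units e0)).
- by move=> y Xy; have := exactM hv (exact_pZ hv hp A) Xy; rewrite addr0.
- by move=> y z _ _; rewrite -mulrBr => /(V_pZM hv hp); congr V; lia.
- move=> y Xy; exists (p ^ (- A) * y).
    by have := exactM hv (exact_pZ hv hp (- A)) Xy; rewrite addNr.
  move=> z _ h; rewrite -{1}(eq y) -mulrBr; apply/(V_pZM hv hp).
  by move: h; congr V; lia.
Qed.

End Residues.

(** * The number of slope classes for given k and a *)

Section SlopeClasses.
Variables (F : fieldType) (v : F -> int) (p : F).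
Hypothesis hv : normalized_discrete_valuation v.
Hypothesis hp : uniformizer (valuation_ring v) p.
Variables (L : fieldExtType F) (x : L) (cs cu : {additive L -> F}) (t n : F).
Hypothesis hr : ramified_coords v x p cs cu t n.
Local Notation V := (val_geq v).
Local Notation X := (exact_val v).
Local Notation o := (valuation_ring v).
Local Notation E := (F * L)%type.
Local Notation d := (@diag F L).

Let p0 : p != 0. Proof. by case: (uniformizer_val hv hp). Qed.

Variable q : nat.
Hypothesis hF : residue_field o #= `I_q.
Variables (R : set E) (b f1 C : nat) (kap : F).
Hypothesis hop : order_params v cs cu R b f1 C kap.
Local Notation minpoly := (minpoly_at t n).
Local Notation slope_rel := (slope_rel v t n).

(** The class of g' is a ball, because p^k minpoly(g') o + p^(a-k) o is the larger of the two
    ideals. If the first prevails, the valuation of [minpoly g'] must be known exactly; if the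
    second does, the lower bound [M0] is enough. *)
Lemma slope_rel_iff (k a : nat) (M0 M : int) g g' : V M0 (minpoly g') ->
  (M = k%:Z + M0 /\ M <= a%:Z - k%:Z /\ ~ V (M0 + 1) (minpoly g')) \/
  (M = a%:Z - k%:Z /\ M <= k%:Z + M0) ->
  slope_rel k a g g' <-> V M (g - g').
Proof.
move=> VP h; split=> [[w hw hg]|hg].
  have -> : g - g' = (g - g' + w * minpoly g') - w * minpoly g' by ring.
  by apply: (VB hv); [apply: V_le hg|apply: V_le (VM hv hw VP)]; lia.
case: h => [[ME [Ma nP]]|[ME Ma]]; last first.
  by exists 0; [left|rewrite mul0r addr0 -ME].
have P0 : minpoly g' != 0 by apply: contra_not_neq nP => ->; left.
exists (- (g - g') / minpoly g'); last by rewrite divfK // subrr; left.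
have := VM hv (VN hv hg) (exactV hv (conj VP nP)).1.
by congr V; lia.
Qed.

Definition valid_slope (k a : nat) g : Prop :=
  [/\ V (1 - k%:Z) g, V (a%:Z - b%:Z) (kap - g)
    & V (a%:Z - b%:Z - k%:Z) (minpoly g)].

(* with d = b - k; the classes are balls whose radius depends on v(g) as long
   as 2 (v(g) + k) < min(a, 2 k + 1) *)
Definition slope_count_le (k a : nat) : nat :=
  let g0 := maxn 1 (a - (b - k)) in
  let T := minn (2 * k + 1) a in
  let h := uphalf T in
  ((\sum_(g0 <= g < h) (q ^ g - q ^ g.-1)) + q ^ (T - maxn h g0))%N.

(** m - 2 k is the common valuation of [minpoly] on the admissible slopes, so the classes are balls
    of exponent min(m, a) - k inside a ball of exponent a - b around kap. The two tests say that
    these slopes lie in p^(1-k) o and meet the condition on [minpoly]. *)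
Definition slope_count_gt (k a : nat) : nat :=
  let d := (b - k)%N in
  let m := minn (2 * (C - d)) (2 * k + 1) in
  if (d < C)%N && (a <= d + m)%N then (q ^ (minn m a - (a - d)))%N else 0%N.

(** For a <= C also kap lies in p^(a-b) o, so the admissible slopes form a ball around 0. The index
    of the sum is the valuation of the slope plus k: a sphere of index g < h has classes of exponent
    2 g - k, while on the inner ball the exponent is T - k throughout. *)
Lemma num_classes_slope_le (k a : nat) : (k <= b)%N -> (0 < a <= C)%N ->
  num_classes (valid_slope k a) (slope_rel k a) (slope_count_le k a).
Proof.
move=> kb /andP[a0 aC]; have aCb := op_Cb hop.
rewrite /slope_count_le.
set g0 := maxn _ _; set T := minn _ _; set h := uphalf T; set G := maxn h g0.
have hT : (h = T./2 + odd T)%N by rewrite /h uphalf_half addnC.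
have TE : (2 * T./2 + odd T = T)%N by have := odd_double_half T; lia.
have g01 : (0 < g0)%N by rewrite /g0; lia.
have g0T : (g0 <= T)%N by rewrite /g0 /T; lia.
have Vkap : V (a%:Z - b%:Z) kap by apply: V_le (op_VC hop); lia.
have validE g : valid_slope k a g <-> V (g0%:Z - k%:Z) g.
  split=> [[h1 h2 _]|hg].
    have h3 : V (a%:Z - b%:Z) g.
      have -> : g = kap - (kap - g) by ring.
      exact: (VB hv).
    case: (leqP (a - (b - k)) 1) => hh.
      by apply: V_le h1; rewrite /g0; lia.
    by apply: V_le h3; rewrite /g0; lia.
  have h1 : V (1 - k%:Z) g by apply: V_le hg; rewrite /g0; lia.
  have h3 : V (a%:Z - b%:Z) g by apply: V_le hg; rewrite /g0; lia.
  split=> //; first exact: (VB hv).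
  (* The condition on [minpoly g] is automatic: its valuation is 1 and a <= b + 1, or it is 2 v(g),
     at least (a - b) + (1 - k). *)
  have [g1|ng1] := pselect (V 1 g).
    by apply: V_le (exact_minpoly_pos hv hr g1).1; lia.
  have gn0 : g != 0 by apply: contra_not_neq ng1 => ->; left.
  have vg : v g <= 0 by rewrite leNgt; apply/negP => vg; apply: ng1; right; lia.
  apply: V_le (exact_minpoly_npos hv hr vg (exact_ex v gn0)).1.
  have := (exact_V _ (exact_ex v gn0)).1 h3.
  have := (exact_V _ (exact_ex v gn0)).1 h1.
  lia.
(* On this sphere v(minpoly) = 2 (g - k), and 2 g < T makes k + v(minpoly) the smaller exponent. *)
have relS (g : nat) y z : (g < h)%N -> X (g%:Z - k%:Z) z ->
    slope_rel k a y z <-> V (2 * g%:Z - k%:Z) (y - z).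
  move=> gh Xz; have gT : (2 * g < T)%N by lia.
  have XP := exact_minpoly_npos hv hr (_ : g%:Z - k%:Z <= 0) Xz.
  have {}XP := XP ltac:(rewrite /T in gT; lia).
  apply: (slope_rel_iff (M0 := 2 * (g%:Z - k%:Z))); first exact: XP.1.
  left; split; first lia.
  by split; [rewrite /T in gT; lia|exact: XP.2].
(* Either T = a and the precision p^(a-k) prevails, or T = 2 k + 1, the slopes lie in p o and
   v(minpoly) = 1. *)
have relI y z : V (G%:Z - k%:Z) z ->
    slope_rel k a y z <-> V (T%:Z - k%:Z) (y - z).
  move=> Vz; have hz : V (h%:Z - k%:Z) z by apply: V_le Vz; rewrite /G; lia.
  case: (leqP a (2 * k + 1)) => ak.
    have Ta : T = a by rewrite /T; lia.
    have hP : V (a%:Z - 2 * k%:Z) (minpoly z).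
      apply: (VB hv); first apply: (VB hv).
      - by apply: V_le (VM hv hz hz); lia.
      - by apply: V_le (VM hv (rc_t hr) hz); lia.
      - by apply: V_le (rc_n hr).1; lia.
    by apply: (slope_rel_iff _ hP); right; lia.
  have TE' : T = (2 * k + 1)%N by rewrite /T; lia.
  have hk : h = k.+1 by lia.
  have z1 : V 1 z by apply: V_le hz; lia.
  have [P1 P2] := exact_minpoly_pos hv hr z1.
  by apply: (slope_rel_iff _ P1); left; split; [lia|split; [lia|exact: P2]].
have S1 := @num_classes_sum _ (fun g y => X (g%:Z - k%:Z) y) (slope_rel k a)
  (fun g => q ^ g - q ^ g.-1)%N g0 h.
have S2 : num_classes (fun y => V (G%:Z - k%:Z) (y - 0)) (slope_rel k a) (q ^ (T - G)).
  apply: num_classes_iff (num_classes_ball hv hp hF 0 (A := G%:Z - k%:Z)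
    (M := T%:Z - k%:Z) (e := (T - G)%N) _) => //.
    by move=> y z _; rewrite subr0 => /relI ->.
  by rewrite /G; lia.
have S12 := num_classesU (S1 _ _) S2.
apply: num_classes_iff (S12 _ _ _).
- move=> y; rewrite validE subr0; split=> [[[g gh Xg]|Vy]|Vy].
  + by apply: V_le Xg.1; lia.
  + by apply: V_le Vy; rewrite /G; lia.
  have [Vy'|nVy] := pselect (V (G%:Z - k%:Z) y); [by right|left].
  have y0 : y != 0 by apply: contra_not_neq nVy => ->; left.
  have Xy := exact_ex v y0.
  have h1 : g0%:Z - k%:Z <= v y by apply/(exact_V _ Xy).
  have h2 : v y < G%:Z - k%:Z.
    by rewrite ltNge; apply/negP => hy; apply: nVy; apply/(exact_V _ Xy).
  exists (absz (v y + k%:Z)); last by move: Xy; congr X; lia.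
  rewrite /G in h2; lia.
- by [].
- move=> g /andP[g0g gh].
  apply: num_classes_iff (num_classes_sphere hv hp hF (A := g%:Z - k%:Z)
    (M := 2 * g%:Z - k%:Z) (e := g) _ _) => //; [|lia|lia].
  by move=> y z _ Xz; rewrite (relS g).
- move=> i j y z _ /andP[gj jh] Xy Xz /(relS _ _ _ jh Xz) Vyz.
  have Vzy : V (2 * j%:Z - k%:Z) (z - y) by rewrite -[z - y]opprB; exact: (VN hv).
  by have := exact_eq hv Xz Xy Vzy; lia.
- move=> y z [g /andP[gl gh] Xy]; rewrite subr0 => Vz; split.
    move=> /(relI _ _ Vz) Vyz; have : V (h%:Z - k%:Z) y.
      rewrite -[y](subrK z); apply: (VD hv).
        by apply: V_le Vyz; lia.
      by apply: V_le Vz; rewrite /G; lia.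
    by move=> /(exact_V _ Xy); lia.
  move=> /(relS _ _ _ gh Xy) Vzy.
  have : V (g%:Z - k%:Z + 1) y.
    have -> : y = z - (z - y) by ring.
    by apply: (VB hv); [apply: V_le Vz; rewrite /G; lia|apply: V_le Vzy; lia].
  by move/(exact_V _ Xy); lia.
Qed.

(** For a > C the congruence of g with kap modulo p^(a-b) fixes v(g) = C - b if C <= b, and puts g
    in p o if C = b + 1; in both cases v(minpoly) is constant. *)
Lemma num_classes_slope_gt (k a : nat) : (k <= b)%N -> (C < a <= f1)%N ->
  num_classes (valid_slope k a) (slope_rel k a) (slope_count_gt k a).
Proof.
move=> kb /andP[Ca af]; have Cb := op_Cb hop.
rewrite /slope_count_gt; set d0 := (b - k)%N; set m := minn _ _.
have slopeP g : V (a%:Z - b%:Z) (kap - g) ->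
    [/\ V (C%:Z - b%:Z) g, (C <= b)%N -> X (C%:Z - b%:Z) g
      & (d0 < C)%N -> X (m%:Z - 2 * k%:Z) (minpoly g)].
  move=> h; have gE : g = kap + (- (kap - g)) by ring.
  have Vg : V (C%:Z - b%:Z) g.
    rewrite gE; apply: (VD hv); first exact: (op_VC hop).
    by apply: (VN hv); apply: V_le h; lia.
  have Xg : (C <= b)%N -> X (C%:Z - b%:Z) g.
    move=> Cb'; have Xk : X (C%:Z - b%:Z) kap by apply: (op_XC hop); lia.
    by rewrite gE; apply: (exactD hv) => //; apply: (VN hv); apply: V_le h; lia.
  split=> // dC; case: (leqP C b) => Cb'.
    have := exact_minpoly_npos hv hr (_ : C%:Z - b%:Z <= 0) (Xg Cb').
    by move=> /(_ ltac:(lia)); congr X; rewrite /m /d0; rewrite /d0 in dC; lia.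
  have g1 : V 1 g by apply: V_le Vg; lia.
  by have := exact_minpoly_pos hv hr g1; congr X; rewrite /m /d0; lia.
case: ifP => [/andP[dC am]|no]; last first.
  apply: num_classes0 => g [h1 h2 h3].
  have [Vg Xg XP] := slopeP g h2.
  have dC : (d0 < C)%N.
    case: (leqP C b) => Cb'; last by rewrite /d0; lia.
    by have := (exact_V _ (Xg Cb')).1 h1; rewrite /d0; lia.
  move/negP: no; apply; rewrite dC /=.
  by have := (exact_V _ (XP dC)).1 h3; rewrite /d0; lia.
apply: num_classes_iff (num_classes_ball hv hp hF kap (A := a%:Z - b%:Z)
  (M := (minn m a)%:Z - k%:Z) _).
- have VE g : V (a%:Z - b%:Z) (g - kap) <-> V (a%:Z - b%:Z) (kap - g).
    by split=> /(VN hv); rewrite opprB.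
  move=> g; rewrite VE; split=> [h|[]//]; have [Vg Xg XP] := slopeP g h; split=> //.
    by apply: V_le Vg; rewrite /d0 in dC; lia.
  by apply: V_le (XP dC).1; rewrite /d0 in am; lia.
- move=> y z _ Vz; have h : V (a%:Z - b%:Z) (kap - z) by rewrite -[kap - z]opprB; exact: (VN hv).
  have [Vg Xg /(_ dC)[P1 P2]] := slopeP z h.
  apply: iff_sym; apply: (slope_rel_iff _ P1).
  case: (leqP m a) => ma; [left|right]; last by lia.
  by split; [lia|split=> //; lia].
- by rewrite /d0; rewrite /d0 in am dC; rewrite /m /d0 in am *; lia.
Qed.

End SlopeClasses.

(** * The number of ideal classes *)

Section IdealCount.
Variables (F : fieldType) (v : F -> int) (p : F).
Hypothesis hv : normalized_discrete_valuation v.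
Hypothesis hp : uniformizer (valuation_ring v) p.
Variables (L : fieldExtType F) (x : L) (cs cu : {additive L -> F}) (t n : F).
Hypothesis hr : ramified_coords v x p cs cu t n.
Local Notation o := (valuation_ring v).
Local Notation E := (F * L)%type.

Variable q : nat.
Hypothesis hF : residue_field o #= `I_q.
Variables (R : set E) (b f1 C : nat) (kap : F).
Hypothesis hR : is_order o R.
Hypothesis hop : order_params v cs cu R b f1 C kap.
Local Notation lat := (lat v cs cu).

Definition ideal_count : nat :=
  (\sum_(0 <= k < b.+1) ((minn (b - k) C).+1
    + (\sum_(1 <= a < C.+1) slope_count_le q b k a
       + \sum_(C.+1 <= a < f1.+1) slope_count_gt q b C k a)))%N.

Local Notation code := (nat * (nat + nat * F))%type.

(** A code keeps k, the shape and the parameters of a normal form readable, which the bare set does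
    not: [inl] is the vertical case al = 0, [inr] the case of a slope. *)
Definition code_lat (c : code) : set E :=
  match c with
  | (k, inl j) => lat k 0 (p ^ (- j%:Z - k%:Z))
  | (k, inr (a, g)) => lat k (p ^ (- a%:Z)) (p ^ (- a%:Z) * g)
  end.

Let code_equiv (c c' : code) := ideal_equiv (code_lat c) (code_lat c').

Let vertical (k : nat) (c : code) : Prop :=
  exists2 j, (0 <= j < (minn (b - k) C).+1)%N & c = (k, inl j).

Let sloped (k a : nat) (c : code) : Prop :=
  exists2 g, valid_slope v t n b kap k a g & c = (k, inr (a, g)).

Lemma num_classes_vertical k : num_classes (vertical k) code_equiv (minn (b - k) C).+1.
Proof.
have -> : (minn (b - k) C).+1 = (\sum_(0 <= j < (minn (b - k) C).+1) 1)%N.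
  by rewrite sum_nat_const_nat subn0 muln1.
apply: (@num_classes_sum _ (fun j c => c = (k, inl j)) code_equiv (fun=> 1%N)).
  move=> j _; apply: (num_classes1 (x0 := (k, inl j))) => // _ ->.
  exact: ideal_equiv_refl.
move=> i j _ _ _ _ -> -> /(lat_equiv_rel hv hp hr)[_ [u [s [w]]]].
exact: (lat_rel11 hv hp hr).
Qed.

Lemma sloped_equiv k a a' c c' : (0 < a)%N -> (0 < a')%N ->
  sloped k a c -> sloped k a' c' -> code_equiv c c' -> a = a'.
Proof.
move=> a0 a0' [g [hg _ _] ->] [g' [hg' _ _] ->] /(lat_equiv_rel hv hp hr)[_ [u [s [w h]]]].
by have [] := lat_rel22 hv hp a0 a0' hg hg' h.
Qed.

Lemma num_classes_sloped k a m : (0 < a)%N ->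
  num_classes (valid_slope v t n b kap k a) (slope_rel v t n k a) m ->
  num_classes (sloped k a) code_equiv m.
Proof.
move=> a0 h; apply: (num_classes_map (f := fun g => (k, inr (a, g))) h).
- by move=> g hg; exists g.
- move=> g g' [hg _ _] [hg' _ _] /(lat_equiv_rel hv hp hr)[_ [u [s [w]]]].
  by move=> /(lat_rel22 hv hp a0 a0 hg hg')[].
- move=> _ [g hg ->]; exists g => // g' [hg' _ _].
  exact: (slope_rel_equiv hv hp hr).
Qed.

Lemma num_classes_ideals : num_classes (fractional_ideal R) (@ideal_equiv F L) ideal_count.
Proof.
have Cf1 := op_Cf1 hop.
pose Pk k c := vertical k c \/
  ((exists2 a, (1 <= a < C.+1)%N & sloped k a c) \/
   (exists2 a, (C.+1 <= a < f1.+1)%N & sloped k a c)).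
have Hk k : (k <= b)%N -> num_classes (Pk k) code_equiv ((minn (b - k) C).+1
    + (\sum_(1 <= a < C.+1) slope_count_le q b k a
       + \sum_(C.+1 <= a < f1.+1) slope_count_gt q b C k a))%N.
  move=> kb; apply: num_classesU; first exact: num_classes_vertical.
    apply: num_classesU.
    - apply: num_classes_sum.
        move=> a /andP[a1 aC]; apply: num_classes_sloped => //.
        by apply: (num_classes_slope_le hv hp hr hF hop) => //; lia.
      by move=> i j c1 c2 /andP[hi _] /andP[hj _]; apply: sloped_equiv; lia.
    - apply: num_classes_sum.
        move=> a /andP[a1 aC]; apply: num_classes_sloped; first lia.
        by apply: (num_classes_slope_gt hv hp hr hF hop) => //; lia.
      by move=> i j c1 c2 /andP[hi _] /andP[hj _]; apply: sloped_equiv; lia.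
    - move=> c1 c2 [a ha hx] [a' ha' hy]; split=> h.
        by have := sloped_equiv _ _ hx hy h; lia.
      by have := sloped_equiv _ _ hy hx h; lia.
  have excl c1 c2 a : vertical k c1 -> (0 < a)%N -> sloped k a c2 -> ~ code_equiv c1 c2.
    move=> [j _ ->] a0 [g [hg _ _] ->] /(lat_equiv_rel hv hp hr)[_ [u [s [w]]]].
    exact: (lat_rel12 hv hp).
  move=> c1 c2 hx hy.
  have [a [a0 hy']] : exists a, (0 < a)%N /\ sloped k a c2.
    by case: hy => -[a ha hy]; exists a; split=> //; lia.
  split; first exact: excl hy'.
  by move=> /ideal_equiv_sym; exact: excl hy'.
have first c k : Pk k c -> c.1 = k.
  by case=> [[j _ ->]//|[[a _ [g _ ->]]//|[a _ [g _ ->]]//]].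
have H : num_classes (fun c => exists2 k, (0 <= k < b.+1)%N & Pk k c) code_equiv ideal_count.
  apply: num_classes_sum => [k /andP[_ kb]|k k' c c' _ _]; first exact: Hk.
  move=> /first <- /first <-; case: c => k1 [j|[a g]]; case: c' => k2 [j'|[a' g']];
    by move=> /(lat_equiv_rel hv hp hr)[].
apply: (num_classes_map (f := code_lat) H).
- move=> c [k /andP[_ kb]] Pc; case: Pc => [[j hj ->]|Pc] /=.
    apply: (lat_fractional hv hp hr hR hop).
    by apply/(lat_condition1 hv hp hr hop); split=> //; lia.
  have [a ha [g [h1 h2 h3] ->]] : exists2 a, (0 < a <= f1)%N & sloped k a c.
    by case: Pc => -[a ha Pc]; exists a => //; lia.
  apply: (lat_fractional hv hp hr hR hop).
  by apply/(lat_condition2 hv hp) => //; split=> //; lia.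
- by [].
move=> I hI; have [k [al [be h]]] := lat_normal_form hv hp hr hR hI.
have sI : submodule R I by case: hI.
have sub J : ideal_equiv I J -> submodule R J by case=> u _ ->; exact: scale_submodule.
have [[j hj]|[a [g [a0 hg hag]]]] := lat_reduce hv hp hr k al be.
  have hIj := ideal_equiv_trans h hj.
  have /(lat_condition1 hv hp hr hop)[kb jb jC] := submodule_lat hv hp hr hop (sub _ hIj).
  exists (k, inl j); last by move=> c _; exact: ideal_equiv_trans.
  by exists k => //; left; exists j => //; lia.
have hIg := ideal_equiv_trans h hag.
have := submodule_lat hv hp hr hop (sub _ hIg).
move=> /(lat_condition2 hv hp _ _ _ _ _ _ hg)[kb af h1 h2].
exists (k, inr (a, g)); last by move=> c _; exact: ideal_equiv_trans.
exists k => //; right; have sl : sloped k a (k, inr (a, g)) by exists g.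
by case: (leqP a C) => aC; [left|right]; exists a => //; lia.
Qed.

End IdealCount.

(** * Sums over k for fixed a *)

Section CountIdentity.
Variables (q b C : nat).
Local Notation Q := (q%:R : rat).
Lemma sum_int_range (P : pred int) (f : int -> rat) (m l : nat) :
  \sum_(i <- int_range m l | P i) f i = \sum_(m <= i < l.+1 | P i%:Z) f i%:Z.
Proof.
rewrite /int_range lez_nat; case: leqP => ml; last by rewrite big_nil big_geq.
have -> : (`|l - m|.+1 = l.+1 - m)%N by lia.
rewrite big_map /index_iota -[in RHS](addn0 m) iotaDl big_map addn0.
by apply: eq_big => i; rewrite PoszD.
Qed.

Lemma floor_half_nat (i : nat) : floor_half i = i./2.
Proof.
apply: Num.Theory.floor_def; have i2 := odd_double_half i.
rewrite ler_pdivlMr ?ltr_pdivrMr // -(intrM _ _ 2) -(intrM _ _ 2) ler_int ltr_int.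
lia.
Qed.

Lemma ceil_half_nat (i : nat) : ceil_half i = uphalf i.
Proof.
apply: Num.Theory.ceil_def; have i2 := odd_double_half i; rewrite uphalf_half.
rewrite ler_pdivrMr ?ltr_pdivlMr // -(intrM _ _ 2) -(intrM _ _ 2) ler_int ltr_int.
lia.
Qed.

Definition geom (m : nat) : rat := \sum_(0 <= j < m) Q ^+ j.

Lemma geomS m : geom m.+1 = geom m + Q ^+ m.
Proof. by rewrite /geom big_nat_recr. Qed.

Lemma geom0 : geom 0 = 0. Proof. by rewrite /geom big_geq. Qed.

Lemma sum_rev_geom (m i : nat) : (i <= m.+1)%N ->
  \sum_(m.+1 - i <= k < m.+1) Q ^+ (m - k) = geom i.
Proof.
elim: i => [|i IH] im; first by rewrite subn0 big_geq // geom0.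
rewrite subSS big_ltn; last by lia.
have -> : ((m - i).+1 = m.+1 - i)%N by lia.
by rewrite IH ?geomS 1?addrC; [congr (_ + _ ^+ _)|]; lia.
Qed.

Lemma sum_trunc_geom (e m : nat) : (e <= m)%N ->
  \sum_(0 <= k < m) Q ^+ (k - e) = e%:R + geom (m - e).
Proof.
move=> em; rewrite -{1}(subnKC em); elim: (m - e)%N => [|r IH].
  rewrite addn0 geom0 addr0 (eq_big_nat _ _ (F2 := fun=> 1)).
    by rewrite sumr_const_nat subn0.
  by move=> k /andP[_ ke]; rewrite (_ : k - e = 0)%N ?expr0 //; lia.
by rewrite addnS big_nat_recr //= IH geomS addrA addKn.
Qed.

Lemma sum_indicator_lt (m u : nat) (f : nat -> rat) : (u <= m)%N ->
  \sum_(0 <= k < m | (k < u)%N) f k = \sum_(0 <= k < u) f k.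
Proof. by move=> um; rewrite (big_nat_widen _ _ _ _ _ um). Qed.

(** The exponents climb from 0 to u - 1 and then descend to 0, whence two geometric sums. Read in d
    = b - k, [slope_count_gt] has this shape. *)
Lemma sum_hat (u w : nat) (f : nat -> rat) : (u <= w <= b.+1)%N ->
  (forall d, (d < u)%N -> f d = Q ^+ d) ->
  (forall d, (u <= d < w)%N -> f d = Q ^+ (w.-1 - d)) ->
  (forall d, (w <= d <= b)%N -> f d = 0) ->
  \sum_(0 <= d < b.+1) f d = geom u + geom (w - u).
Proof.
move=> /andP[uw wb] f1E f2E f3E.
rewrite (big_cat_nat (n := u)) //=; last exact: leq_trans wb.
rewrite (big_cat_nat (n := w) (m := u)) //=; congr (_ + _).
  by apply: eq_big_nat => d /andP[_ /f1E].
have -> : \sum_(w <= d < b.+1) f d = 0 by rewrite big_nat big1 // => d /f3E.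
rewrite addr0.
rewrite (eq_big_nat _ _ f2E); case: w uw {wb f2E f3E} => [|w] uw.
  by rewrite big_geq // sub0n geom0.
by rewrite -[X in \sum_(X <= _ < _) _](subKn uw) sum_rev_geom //; lia.
Qed.

Lemma sum_three (i m : nat) (f g1 g2 g3 : nat -> rat) : (i <= m <= b.+1)%N ->
  (forall k, (k < i)%N -> f k = g1 k) ->
  (forall k, (i <= k < m)%N -> f k = g2 k) ->
  (forall k, (m <= k <= b)%N -> f k = g3 k) ->
  \sum_(0 <= k < b.+1) f k = \sum_(0 <= k < i) g1 k + \sum_(i <= k < m) g2 k
    + \sum_(m <= k < b.+1) g3 k.
Proof.
move=> /andP[im mb] h1 h2 h3.
rewrite (big_cat_nat (n := i)) //=; last exact: leq_trans mb.
rewrite (big_cat_nat (n := m) (m := i)) //= addrA.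
by congr (_ + _ + _); apply: eq_big_nat => k; [case/andP=> _ /h1|exact: h2|exact: h3].
Qed.

Lemma sum_rev (f : nat -> rat) :
  \sum_(0 <= k < b.+1) f k = \sum_(0 <= d < b.+1) f (b - d)%N.
Proof. by rewrite big_nat_rev; apply: eq_bigr => d _; rewrite add0n subSS. Qed.

(** With d = b - k the exponent in [slope_count_gt] is d while m >= a, and then m + d - a, where m
    is 2 (C - d) for C <= b and 2 (b - d) + 1 for C = b + 1; so it falls by 1 at each step, and the
    support ends where it would become negative. *)
Lemma count_gt_even (i : nat) : (C <= b.+1)%N -> let a := (2 * i)%N in
  (C < a <= 2 * b + 1)%N -> (a <= 2 * C)%N ->
  \sum_(0 <= k < b.+1) (slope_count_gt q b C k a)%:R =
    if (C <= b)%N then geom (C - i).+1 + geom (C - i) else 2 * geom (b - i).+1 :> rat.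
Proof.
move=> Cb a ha aC; rewrite sum_rev; case: leqP => Cb'.
  rewrite (@sum_hat (C - i).+1 (2 * C - 2 * i).+1).
  - by congr (_ + geom _); rewrite /a in ha aC; lia.
  - by rewrite /a in ha aC; lia.
  - move=> d hd; rewrite /slope_count_gt ifT; last by rewrite /a in ha aC *; lia.
    by rewrite natrX; congr (_ ^+ _); rewrite /a in ha aC *; lia.
  - move=> d hd; rewrite /slope_count_gt ifT; last by rewrite /a in ha aC *; lia.
    by rewrite natrX; congr (_ ^+ _); rewrite /a in ha aC *; lia.
  - by move=> d hd; rewrite /slope_count_gt ifF // /a in ha aC *; lia.
rewrite (@sum_hat (b - i).+1 (2 * b - 2 * i).+2).
- rewrite mulr_natl mulr2n; congr (_ + geom _); rewrite /a in ha aC; lia.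
- by rewrite /a in ha aC; lia.
- move=> d hd; rewrite /slope_count_gt ifT; last by rewrite /a in ha aC *; lia.
  by rewrite natrX; congr (_ ^+ _); rewrite /a in ha aC *; lia.
- move=> d hd; rewrite /slope_count_gt ifT; last by rewrite /a in ha aC *; lia.
  by rewrite natrX; congr (_ ^+ _); rewrite /a in ha aC *; lia.
- by move=> d hd; rewrite /slope_count_gt ifF // /a in ha aC *; lia.
Qed.

Lemma count_gt_odd (i : nat) : (C <= b.+1)%N -> let a := (2 * i + 1)%N in
  (C < a <= 2 * b + 1)%N -> (a <= 2 * C)%N ->
  \sum_(0 <= k < b.+1) (slope_count_gt q b C k a)%:R =
    if (C <= b)%N then 2 * geom (C - i) else geom (b - i).+1 + geom (b - i) :> rat.
Proof.
move=> Cb a ha aC; rewrite sum_rev; case: leqP => Cb'.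
  rewrite (@sum_hat (C - i) (2 * C - 2 * i)).
  - by rewrite mulr_natl mulr2n; congr (_ + geom _); rewrite /a in ha aC; lia.
  - by rewrite /a in ha aC; lia.
  - move=> d hd; rewrite /slope_count_gt ifT; last by rewrite /a in ha aC *; lia.
    by rewrite natrX; congr (_ ^+ _); rewrite /a in ha aC *; lia.
  - move=> d hd; rewrite /slope_count_gt ifT; last by rewrite /a in ha aC *; lia.
    by rewrite natrX; congr (_ ^+ _); rewrite /a in ha aC *; lia.
  - by move=> d hd; rewrite /slope_count_gt ifF // /a in ha aC *; lia.
rewrite (@sum_hat (b - i).+1 (2 * b - 2 * i).+1).
- congr (_ + geom _); rewrite /a in ha aC; lia.
- by rewrite /a in ha aC; lia.
- move=> d hd; rewrite /slope_count_gt ifT; last by rewrite /a in ha aC *; lia.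
  by rewrite natrX; congr (_ ^+ _); rewrite /a in ha aC *; lia.
- move=> d hd; rewrite /slope_count_gt ifT; last by rewrite /a in ha aC *; lia.
  by rewrite natrX; congr (_ ^+ _); rewrite /a in ha aC *; lia.
- by move=> d hd; rewrite /slope_count_gt ifF // /a in ha aC *; lia.
Qed.

Lemma sum_lt_geom (P : pred nat) (u : nat) : (u <= b.+1)%N ->
  (forall d, (d <= b)%N -> P (b - d)%N = (d < u)%N) ->
  \sum_(0 <= k < b.+1 | P k) Q ^+ (b - k) = geom u.
Proof.
move=> ub PE; rewrite big_mkcond sum_rev /geom -(sum_indicator_lt _ ub) [RHS]big_mkcond.
apply: eq_big_nat => d /andP[_ db].
by rewrite PE //; case: ifP => // _; congr (_ ^+ _); lia.
Qed.

Lemma sum_min_geom a : (a <= b.+1)%N ->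
  \sum_(0 <= k < b.+1 | (a <= 2 * k + 1)%N) Q ^+ minn a./2 (b - k)
  = (b.+1 - 2 * a./2)%:R * Q ^+ a./2 + geom a./2.
Proof.
move=> ab; rewrite big_mkcond /=.
rewrite (@sum_three a./2 (b.+1 - a./2) _ (fun=> 0) (fun=> Q ^+ a./2) (fun k => Q ^+ (b - k))).
- rewrite big1_eq add0r sum_rev_geom; last by lia.
  by rewrite sumr_const_nat mulr_natl; congr (_ *+ _ + _); lia.
- lia.
- by move=> k hk; rewrite ifF //; lia.
- by move=> k hk; rewrite ifT; [congr (_ ^+ _)|]; lia.
- by move=> k hk; rewrite ifT; [congr (_ ^+ _)|]; lia.
Qed.

Lemma sum_even_correction i : (0 < i)%N -> (2 * i <= b.+1)%N ->
  \sum_(1 <= k < b.+1 | (2 * i < 2 * k + 1)%N && (i <= b - k)%N) (Q ^+ i - Q ^+ i.-1)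
  = (b.+1 - 2 * i)%:R * (Q ^+ i - Q ^+ i.-1).
Proof.
move=> i0 ib; rewrite big_mkcond /=.
have -> : \sum_(1 <= k < b.+1)
    (if (2 * i < 2 * k + 1)%N && (i <= b - k)%N then Q ^+ i - Q ^+ i.-1 else 0)
  = \sum_(0 <= k < b.+1)
    (if (2 * i < 2 * k + 1)%N && (i <= b - k)%N then Q ^+ i - Q ^+ i.-1 else 0).
  by rewrite [RHS]big_ltn // ifF ?add0r //; lia.
rewrite (@sum_three i (b.+1 - i) _ (fun=> 0) (fun=> Q ^+ i - Q ^+ i.-1) (fun=> 0)).
- rewrite !big1_eq add0r addr0 sumr_const_nat mulr_natl; congr (_ *+ _); lia.
- lia.
- by move=> k hk; rewrite ifF //; lia.
- by move=> k hk; rewrite ifT //; lia.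
- by move=> k hk; rewrite ifF //; lia.
Qed.

(** The doubled sum covers both flanks of the hat. When the flanks share their peak, doubling counts
    it twice, and the parity-dependent corrections remove one copy. *)
Lemma count_gt a : (C <= b.+1)%N -> (C < a <= 2 * b + 1)%N -> (a <= 2 * C)%N ->
  \sum_(0 <= k < b.+1) (slope_count_gt q b C k a)%:R
  = 2 * (\sum_(0 <= k < b.+1 | (a <= 2 * k + 1)%N && (uphalf a + b <= C + k)%N) Q ^+ (b - k))
    - (if odd a && (b + 1 <= C)%N then Q ^+ (b - a./2) else 0)
    - (if ~~ odd a && (C <= b)%N then Q ^+ (C - a./2) else 0) :> rat.
Proof.
move=> Cb Ca aC; have := odd_double_half a; have := uphalf_half a.
case: (odd a) => /= uE aE; set i := a./2 in uE aE *.
  have aE' : a = (2 * i + 1)%N by lia.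
  rewrite aE' count_gt_odd -?aE' //; case: (leqP C b) => Cb'.
    rewrite (sum_lt_geom (u := (C - i)%N)); [|lia|by move=> d hd; lia].
    by rewrite ifF ?subr0 //; lia.
  rewrite (sum_lt_geom (u := (b - i).+1)); [|lia|by move=> d hd; lia].
  by rewrite ifT ?geomS; [ring|lia].
have aE' : a = (2 * i)%N by lia.
rewrite aE' count_gt_even -?aE' //; case: (leqP C b) => Cb'.
  rewrite (sum_lt_geom (u := (C - i).+1)); [|lia|by move=> d hd; lia].
  by rewrite geomS; ring.
rewrite (sum_lt_geom (u := (b - i).+1)); [|lia|by move=> d hd; lia].
by rewrite !subr0.
Qed.

(** min(b - k, C) is the number of a in [1, C] with a <= b - k, and each a is reached by b + 1 - a
    values of k. These vertical classes join the slope classes of the same a in [count_le]. *)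
Lemma sum_vertical : (\sum_(0 <= k < b.+1) (minn (b - k) C).+1
  = b.+1 + \sum_(1 <= a < C.+1) (b.+1 - a))%N.
Proof.
under eq_bigr do rewrite -addn1.
rewrite big_split /= sum_nat_const_nat subn0 muln1 addnC; congr (_ + _)%N.
elim: C => [|c IH].
  by rewrite [RHS]big_geq // big1 // => k _; rewrite minn0.
rewrite [RHS]big_nat_recr //= -IH.
have <- : (\sum_(0 <= k < b.+1 | k < b - c) 1 = b.+1 - c.+1)%N.
  rewrite -(big_nat_widen _ _ _ predT) ?sum_nat_const_nat ?subn0 ?muln1 ?subSS //; lia.
rewrite [X in _ = (_ + X)%N]big_mkcond -big_split /=; apply: eq_big_nat => k /andP[_ kb].
by case: ifP; lia.
Qed.

Hypothesis q0 : (0 < q)%N.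

(** The spheres telescope. The truncated predecessor of a - (b - k) absorbs the [maxn 1] in [g0]:
    for a <= b - k both exponents are 0. *)
Lemma slope_count_leE k a : (0 < a)%N ->
  let T := minn (2 * k + 1) a in
  let h := uphalf T in
  (a - (b - k) <= T)%N ->
  (slope_count_le q b k a)%:R =
    if (a - (b - k) <= h)%N
    then Q ^+ h.-1 - Q ^+ (a - (b - k)).-1 + Q ^+ (T - h)
    else Q ^+ (T - (a - (b - k))).
Proof.
move=> a0 T h gT; rewrite /slope_count_le -/T -/h; set g0 := maxn _ _.
have T0 : (0 < T)%N by rewrite /T; lia.
have h0 : (0 < h)%N by rewrite /h; lia.
have tel m l : (0 < m)%N -> (m <= l)%N ->
    (\sum_(m <= g < l) (q ^ g - q ^ g.-1))%N%:R = Q ^+ l.-1 - Q ^+ m.-1.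
  move=> m0; elim: l => [|l IH] ml; first by lia.
  have [lm|lm] := ltnP l m.
    by rewrite (_ : m = l.+1) ?big_geq ?subrr //; lia.
  rewrite big_nat_recr //= natrD IH // natrB ?natrX.
    by rewrite addrAC; ring.
  by rewrite leq_pexp2l // leq_pred.
rewrite natrD natrX; case: leqP => gh.
  have g0h : (g0 <= h)%N by rewrite /g0; lia.
  rewrite tel ?(maxn_idPl g0h) //; last by rewrite /g0; lia.
  by congr (_ - _ ^+ _ + _); rewrite /g0; lia.
rewrite big_geq ?add0r; last by rewrite /g0; lia.
by congr (_ ^+ _); rewrite /g0; lia.
Qed.

(** T passes from 2 k + 1 to a at k = i, and the spheres disappear after k = b - i. The truncated
    exponents k - (b - 2 i) are 0 for the first b - 2 i values of k; these contribute -1 each, and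
    the vertical classes added on the left cancel them. The even case is analogous. *)
Lemma count_le_odd (i : nat) : (2 * i <= b)%N -> let a := (2 * i + 1)%N in
  \sum_(0 <= k < b.+1) (slope_count_le q b k a)%:R + (b - 2 * i)%:R
  = (2 * (b - 2 * i) + 1)%:R * Q ^+ i + 2 * geom i.
Proof.
move=> ib a.
have aE k : (a <= b.+1)%N -> (k <= b)%N -> (a - (b - k) <= minn (2 * k + 1) a)%N by lia.
rewrite (@sum_three i (b - i).+1 _ (fun k => 2 * Q ^+ k - Q ^+ (k - (b - 2 * i)))
  (fun k => 2 * Q ^+ i - Q ^+ (k - (b - 2 * i))) (fun k => Q ^+ (b - k))).
- rewrite !sumrB -!mulr_sumr sumr_const_nat.
  have -> : (b - i).+1 = (b.+1 - i)%N by lia.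
  rewrite sum_rev_geom; last by lia.
  have := @sum_trunc_geom (b - 2 * i) (b.+1 - i); rewrite (big_cat_nat (n := i)) //=; last by lia.
  have -> : (b.+1 - i - (b - 2 * i) = i.+1)%N by lia.
  move=> /(_ ltac:(lia)); rewrite geomS.
  have -> : (b.+1 - i - i = b - 2 * i + 1)%N by lia.
  rewrite -/(geom i).
  move: (b - 2 * i)%N (\sum_(0 <= k < i) _) (\sum_(i <= k < _) _) => e A B AB.
  have -> : A = e%:R + (geom i + Q ^+ i) - B by rewrite -AB; ring.
  ring.
- lia.
- move=> k ki; rewrite slope_count_leE //; [|rewrite /a; lia|apply: aE; rewrite /a; lia].
  have -> : minn (2 * k + 1) a = (2 * k + 1)%N by rewrite /a; lia.
  have -> : uphalf (2 * k + 1) = k.+1 by lia.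
  rewrite ifT; last by rewrite /a; lia.
  have -> : (a - (b - k)).-1 = (k - (b - 2 * i))%N by rewrite /a; lia.
  have -> : (2 * k + 1 - k.+1 = k)%N by lia.
  rewrite /=; ring.
- move=> k ki; rewrite slope_count_leE //; [|rewrite /a; lia|apply: aE; rewrite /a; lia].
  have -> : minn (2 * k + 1) a = a by rewrite /a; lia.
  have -> : uphalf a = i.+1 by rewrite /a; lia.
  rewrite ifT; last by rewrite /a; lia.
  have -> : (a - (b - k)).-1 = (k - (b - 2 * i))%N by rewrite /a; lia.
  have -> : (a - i.+1 = i)%N by rewrite /a; lia.
  rewrite /=; ring.
- move=> k ki; rewrite slope_count_leE //; [|rewrite /a; lia|apply: aE; rewrite /a; lia].
  have -> : minn (2 * k + 1) a = a by rewrite /a; lia.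
  have -> : uphalf a = i.+1 by rewrite /a; lia.
  rewrite ifF; last by rewrite /a; lia.
  by congr (_ ^+ _); rewrite /a; lia.
Qed.

Lemma count_le_even (i : nat) : (0 < i)%N -> (2 * i <= b.+1)%N -> let a := (2 * i)%N in
  \sum_(0 <= k < b.+1) (slope_count_le q b k a)%:R + (b.+1 - 2 * i)%:R
  = (b.+1 - 2 * i)%:R * (Q ^+ i + Q ^+ i.-1) + 2 * geom i.
Proof.
move=> i0 ib a.
have aE k : (a <= b.+1)%N -> (k <= b)%N -> (a - (b - k) <= minn (2 * k + 1) a)%N by lia.
rewrite (@sum_three i (b.+1 - i) _ (fun k => 2 * Q ^+ k - Q ^+ (k - (b.+1 - 2 * i)))
  (fun k => (Q ^+ i + Q ^+ i.-1) - Q ^+ (k - (b.+1 - 2 * i))) (fun k => Q ^+ (b - k))).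
- rewrite !sumrB -!mulr_sumr sumr_const_nat.
  rewrite sum_rev_geom; last by lia.
  have := @sum_trunc_geom (b.+1 - 2 * i) (b.+1 - i).
  rewrite (big_cat_nat (n := i)) //=; last by lia.
  have -> : (b.+1 - i - (b.+1 - 2 * i) = i)%N by lia.
  move=> /(_ ltac:(lia)).
  have -> : (b.+1 - i - i = b.+1 - 2 * i)%N by lia.
  rewrite -/(geom i).
  move: (b.+1 - 2 * i)%N (\sum_(0 <= k < i) _) (\sum_(i <= k < _) _) => e A B AB.
  have -> : A = e%:R + geom i - B by rewrite -AB; ring.
  ring.
- lia.
- move=> k ki; rewrite slope_count_leE //; [|rewrite /a; lia|apply: aE; rewrite /a; lia].
  have -> : minn (2 * k + 1) a = (2 * k + 1)%N by rewrite /a; lia.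
  have -> : uphalf (2 * k + 1) = k.+1 by lia.
  rewrite ifT; last by rewrite /a; lia.
  have -> : (a - (b - k)).-1 = (k - (b.+1 - 2 * i))%N by rewrite /a; lia.
  have -> : (2 * k + 1 - k.+1 = k)%N by lia.
  rewrite /=; ring.
- move=> k ki; rewrite slope_count_leE //; [|rewrite /a; lia|apply: aE; rewrite /a; lia].
  have -> : minn (2 * k + 1) a = a by rewrite /a; lia.
  have -> : uphalf a = i by rewrite /a; lia.
  rewrite ifT; last by rewrite /a; lia.
  have -> : (a - (b - k)).-1 = (k - (b.+1 - 2 * i))%N by rewrite /a; lia.
  have -> : (a - i = i)%N by rewrite /a; lia.
  ring.
- move=> k ki; rewrite slope_count_leE //; [|rewrite /a; lia|apply: aE; rewrite /a; lia].
  have -> : minn (2 * k + 1) a = a by rewrite /a; lia.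
  have -> : uphalf a = i by rewrite /a; lia.
  rewrite ifF; last by rewrite /a; lia.
  by congr (_ ^+ _); rewrite /a; lia.
Qed.

(** The term b + 1 - a is the share of vertical classes assigned to a by [sum_vertical]; without it
    the slopes alone do not have the shape of the formula. *)
Lemma count_le a : (0 < a <= b.+1)%N ->
  \sum_(0 <= k < b.+1) (slope_count_le q b k a)%:R + (b.+1 - a)%:R
  = 2 * (\sum_(0 <= k < b.+1 | (a <= 2 * k + 1)%N) Q ^+ minn a./2 (b - k))
    - (if odd a then Q ^+ minn a./2 (b - a./2) else 0)
    - (if ~~ odd a then \sum_(1 <= k < b.+1 | (a < 2 * k + 1)%N && (a./2 <= b - k)%N)
         (Q ^+ a./2 - Q ^+ a./2.-1) else 0).
Proof.
move=> /andP[a0 ab]; rewrite sum_min_geom //.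
have := odd_double_half a; case: (odd a) => /= aE; set i := a./2 in aE *.
  have -> : a = (2 * i + 1)%N by lia.
  have -> : (b.+1 - (2 * i + 1) = b - 2 * i)%N by lia.
  rewrite count_le_odd; last by lia.
  have -> : minn i (b - i) = i by lia.
  have -> : (b.+1 - 2 * i = (b - 2 * i) + 1)%N by lia.
  move: (b - 2 * i)%N => e; ring.
have -> : a = (2 * i)%N by lia.
rewrite sum_even_correction; [|lia|lia].
rewrite count_le_even; [|lia|lia].
move: (b.+1 - 2 * i)%N => e; ring.
Qed.

End CountIdentity.

(** * Assembly of the closed formula *)

Section PaperFormula.
Variables (q b f1 C : nat).
Local Notation Q := (q%:R : rat).

Lemma sum_cut (P : pred nat) (f : nat -> rat) (m : nat) : (C <= f1)%N ->
  \sum_(m <= a < f1.+1 | P a && (a <= C)%N) f a = \sum_(m <= a < C.+1 | P a) f a.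
Proof. by move=> Cf; rewrite (big_nat_widen _ C.+1 f1.+1). Qed.

Lemma ideal_count_formula : (0 < q)%N -> (C <= f1)%N -> (C <= b.+1)%N ->
  (f1 <= 2 * b + 1)%N -> (f1 <= 2 * C)%N ->
  (ideal_count q b f1 C)%:R =
  2 * (\sum_(0 <= k < b.+1)
      (\sum_(0 <= a < f1.+1 | (a <= 2 * k + 1)%N && (a <= C)%N) Q ^+ minn a./2 (b - k)
     + \sum_(C.+1 <= a < f1.+1 | (a <= 2 * k + 1)%N && (uphalf a + b <= C + k)%N)
         Q ^+ (b - k)))
  - b.+1%:R
  - \sum_(1 <= a < f1.+1 | odd a && (a <= C)%N) Q ^+ minn a./2 (b - a./2)
  - \sum_(C.+1 <= a < f1.+1 | odd a && (b + 1 <= C)%N) Q ^+ (b - a./2)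
  - \sum_(1 <= k < b.+1) \sum_(1 <= a < f1.+1 |
      [&& ~~ odd a, (a < 2 * k + 1)%N & (a./2 <= b - k)%N] && (a <= C)%N)
        (Q ^+ a./2 - Q ^+ a./2.-1)
  - \sum_(C.+1 <= a < f1.+1 | ~~ odd a && (C <= b)%N) Q ^+ (C - a./2) :> rat.
Proof.
move=> q0 Cf Cb fb fC.
rewrite /ideal_count big_split /= sum_vertical !natrD big_split /= natrD.
rewrite !natr_sum.
under [X in _ + (X + _)]eq_bigr do rewrite natr_sum.
under [X in _ + (_ + X)]eq_bigr do rewrite natr_sum.
rewrite [X in _ + (X + _)]exchange_big_nat [X in _ + (_ + X)]exchange_big_nat /=.
have -> : \sum_(C.+1 <= a < f1.+1) \sum_(0 <= k < b.+1) (slope_count_gt q b C k a)%:R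
  = \sum_(C.+1 <= a < f1.+1)
     (2 * (\sum_(0 <= k < b.+1 | (a <= 2 * k + 1)%N && (uphalf a + b <= C + k)%N) Q ^+ (b - k))
    - (if odd a && (b + 1 <= C)%N then Q ^+ (b - a./2) else 0)
    - (if ~~ odd a && (C <= b)%N then Q ^+ (C - a./2) else 0)).
  by apply: eq_big_nat => a ha; rewrite count_gt //; lia.
have E1 : \sum_(1 <= a < C.+1) (b.+1 - a)%:R
   + \sum_(1 <= a < C.+1) \sum_(0 <= k < b.+1) (slope_count_le q b k a)%:R
  = \sum_(1 <= a < C.+1)
   (2 * (\sum_(0 <= k < b.+1 | (a <= 2 * k + 1)%N) Q ^+ minn a./2 (b - k))
    - (if odd a then Q ^+ minn a./2 (b - a./2) else 0)
    - (if ~~ odd a then \sum_(1 <= k < b.+1 | (a < 2 * k + 1)%N && (a./2 <= b - k)%N)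
         (Q ^+ a./2 - Q ^+ a./2.-1) else 0)).
  rewrite -big_split /=; apply: eq_big_nat => a ha; rewrite addrC count_le //; lia.
rewrite [LHS]addrA -[X in X + _]addrA E1 !sumrB -!mulr_sumr -!big_mkcond /=.
rewrite big_split /=.
(* The summand a = 0 equals 1. Doubled and summed over k it gives 2 (b + 1), of which the formula
   subtracts b + 1; what is left counts the vertical classes with j = 0. *)
have A k : \sum_(0 <= a < f1.+1 | (a <= 2 * k + 1)%N && (a <= C)%N) Q ^+ minn a./2 (b - k)
    = 1 + \sum_(1 <= a < C.+1 | (a <= 2 * k + 1)%N) Q ^+ minn a./2 (b - k).
  by rewrite sum_cut // big_ltn_cond //= min0n expr0.
under [X in 2 * (X + _)]eq_bigr do rewrite A.
rewrite big_split /= sumr_const_nat subn0.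
rewrite (exchange_big_dep predT) //= [X in 2 * (_ + X)](exchange_big_dep predT) //=.
rewrite sum_cut //.
rewrite [X in _ = _ - _ - _ - _ - X - _](exchange_big_dep (fun a => ~~ odd a && (a <= C)%N)) /=; last first.
  by move=> k a _ /andP[/and3P[-> _ _] ->].
rewrite sum_cut //.
have -> : \sum_(1 <= a < C.+1 | ~~ odd a) \sum_(1 <= k < b.+1 |
    [&& ~~ odd a, (a < 2 * k + 1)%N & (a./2 <= b - k)%N] && (a <= C)%N) (Q ^+ a./2 - Q ^+ a./2.-1)
  = \sum_(1 <= a < C.+1 | ~~ odd a) \sum_(1 <= k < b.+1 | (a < 2 * k + 1)%N && (a./2 <= b - k)%N)
         (Q ^+ a./2 - Q ^+ a./2.-1).
  rewrite big_nat_cond [RHS]big_nat_cond; apply: eq_bigr => a /andP[/andP[_ aC] oa].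
  by apply: eq_bigl => k; rewrite oa (_ : (a <= C)%N) ?andbT.
rewrite -[b.+1%:R]/(1 *+ b.+1); ring.
Qed.

End PaperFormula.

(** * Integer halves and the theorem *)

Lemma ceil_half_def (z m : int) : (m - 1) * 2 < z <= m * 2 -> ceil_half z = m.
Proof.
move=> h; apply: Num.Theory.ceil_def.
by rewrite ler_pdivrMr ?ltr_pdivlMr // -(intrM _ _ 2) -(intrM _ _ 2) ler_int ltr_int.
Qed.

Lemma dvdz2_nat (a : nat) : (2 %| a%:Z)%Z = ~~ odd a.
Proof. by rewrite dvdzE /= dvdn2. Qed.

Lemma dvdz2_pred (a : nat) : (2 %| a%:Z - 1)%Z = odd a.
Proof.
case: a => [|a] //; have -> : a.+1%:Z - 1 = a%:Z by lia.
by rewrite dvdz2_nat.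
Qed.

Lemma divz2_nat (a : nat) : (a%:Z %/ 2)%Z = a./2.
Proof. by rewrite (divz_nat a 2) divn2. Qed.

Lemma divz2_pred (a : nat) : odd a -> ((a%:Z - 1) %/ 2)%Z = a./2.
Proof.
case: a => [|a] // oa; have -> : a.+1%:Z - 1 = a%:Z by lia.
by rewrite divz2_nat; move: oa => /=; lia.
Qed.

Lemma min_nat (m l : nat) : Num.min m%:Z l%:Z = minn m l.
Proof. by rewrite minEle lez_nat /minn; case: (ltngtP m l) => // ->. Qed.

Theorem theorem5p5 (F : fieldType) (v : F -> int) (q : nat) (p : F)
    (L : fieldExtType F) (x : L) (R : set (F * L)) (SR f1 f2 : nat)
    (o := valuation_ring v) (OL := integral_closure o L)
    (b : int := SR%:Z - f1%:Z) (C : int := ceil_half (2 * SR%:Z - f2%:Z))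
    (Q : rat := q%:R) :
  nonarchimedean_local_field v ->
  residue_field o #= `I_q ->
  uniformizer o p ->
  \dim {:L} = 2%N ->
  uniformizer OL x ->
  ramified o p x ->
  is_order o R ->
  conductor o R = scale_set (p ^+ f1) o `*` scale_set (x ^+ f2) OL ->
  quotient_length (diag @` o) R (maximal_order o) SR ->
  exists N : nat, Cl_bar R #= `I_N /\
  N%:R =
    2 * (\sum_(b' <- int_range 0 b)
      (\sum_(a' <- int_range 0 f1 | (a' <= 2 * b' + 1) && (a' <= C))
          Q ^ Num.min (floor_half a') (b - b')
       + \sum_(a' <- int_range (C + 1) f1 | (a' <= 2 * b' + 1)
                                            && (ceil_half a' - b' <= C - b))
          Q ^ (b - b')))
    - (b + 1)%:~R
    - \sum_(a' <- int_range 1 f1 | (a' <= C) && (2 %| a' - 1)%Z)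
        Q ^ Num.min ((a' - 1) %/ 2)%Z (b - ((a' - 1) %/ 2)%Z)
    - \sum_(a' <- int_range (C + 1) f1 | (2 %| a' - 1)%Z && (b + 1 <= C))
        Q ^ (b - ((a' - 1) %/ 2)%Z)
    - \sum_(b' <- int_range 1 b)
        \sum_(a' <- int_range 1 f1 | [&& a' < 2 * b' + 1, (2 %| a')%Z,
                                      a' <= C & (a' %/ 2)%Z <= b - b'])
          (Q ^ (a' %/ 2)%Z - Q ^ ((a' %/ 2)%Z - 1))
    - \sum_(a' <- int_range (C + 1) f1 | (2 %| a')%Z && (C <= b))
        Q ^ (C - (a' %/ 2)%Z).
Proof.
move=> [hv _ _] hF hp dL ux ram hR hC hS.
have [cs [cu [t [n hr]]]] := ramified_coords_exist hv hp dL ux ram.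
have [b0 [C0 [k [hop SE fE]]]] := order_params_exist hv hp hr hR hC hS.
have [Cf Cb] := (op_Cf1 hop, op_Cb hop).
have [fb fC] := (op_f1b hop, op_f1C hop).
(* The residue class of 0 exists. *)
have q0 : (0 < q)%N.
  have [rho [_ _ /(_ 0 (V0 v 0))[i iq _]]] := residue_reps hv hp hF.
  exact: leq_ltn_trans iq.
exists (ideal_count q b0 f1 C0); split.
  exact/num_classes_card/(num_classes_ideals hv hp hr hF hR hop).
have bE : b = b0 by rewrite /b SE; lia.
(* Since C0 = SR - [f2./2], the number 2 SR - f2 is 2 C0 or 2 C0 - 1 according to the parity of
   f2. *)
have CE : C = C0 by apply: ceil_half_def; lia.
rewrite bE CE ideal_count_formula // /Q.
have C1 : C0%:Z + 1 = C0.+1 by lia.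
rewrite C1 !(sum_int_range _ _ 0) !(sum_int_range _ _ 1) !sum_int_range.
have b1 : (b0%:Z + 1)%:~R = b0.+1%:R :> rat.
  by have -> : b0%:Z + 1 = b0.+1 by lia.
rewrite b1; congr (2 * _ - _ - _ - _ - _ - _).
- apply: eq_big_nat => i /andP[_ ib]; rewrite (sum_int_range _ _ 0) sum_int_range.
  have bi : b0%:Z - i%:Z = (b0 - i)%N by lia.
  congr (_ + _); apply: eq_big => [a|a _];
    rewrite ?ceil_half_nat ?floor_half_nat ?bi ?min_nat -?exprnP //.
  by congr (_ && _); lia.
- apply: eq_big => [a|a /andP[oa aC]]; first by rewrite dvdz2_pred andbC; congr (_ && _); lia.
  have ba : b0%:Z - a./2%:Z = (b0 - a./2)%N by lia.
  by rewrite divz2_pred // ba min_nat.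
- rewrite big_nat_cond [RHS]big_nat_cond.
  apply: eq_big => [a|a /andP[ha /andP[oa _]]].
    by rewrite dvdz2_pred; congr (_ && (_ && _)); lia.
  have ba : b0%:Z - a./2%:Z = (b0 - a./2)%N by lia.
  by rewrite divz2_pred // ba.
- apply: eq_big_nat => i /andP[_ ib]; rewrite (sum_int_range _ _ 1).
  rewrite big_nat_cond [RHS]big_nat_cond.
  apply: eq_big => [a|a /andP[ha /andP[/and3P[oa _ _] _]]].
    rewrite dvdz2_nat divz2_nat; congr (_ && _).
    have -> : (a%:Z < 2 * i%:Z + 1) = (a < 2 * i + 1)%N by lia.
    have -> : (a%:Z <= C0%:Z) = (a <= C0)%N by lia.
    have -> : (a./2%:Z <= b0%:Z - i%:Z) = (a./2 <= b0 - i)%N by lia.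
    by case: odd; rewrite /= ?andbF // -andbA; congr (_ && _); rewrite andbC.
  rewrite divz2_nat; have -> : a./2%:Z - 1 = a./2.-1 by lia.
  by [].
- rewrite big_nat_cond [RHS]big_nat_cond.
  apply: eq_big => [a|a /andP[ha _]]; first by rewrite dvdz2_nat; congr (_ && (_ && _)); lia.
  by rewrite divz2_nat; have -> : C0%:Z - a./2%:Z = (C0 - a./2)%N by lia.
Qed.
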